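(* Let $d\ge2$ be an integer, $m>0$ and $\gamma\ge0$. Consider the Itô stochastic differential equation $$dS_t=b_\gamma(S_t)\,dt+\frac1m\,dW_t,\qquad S_0=s_0,\qquad b_\gamma(s)=\frac{d-1}{2m^2}\coth(s)-\frac{\gamma}{2m^2}\tanh(s),\quad s\in(0,+\infty),$$ where $W$ is a standard one-dimensional Wiener process. For every initial condition $s_0\in(0,+\infty)$ this equation has a pathwise unique, strong solution $S=(S_t,\,t\in\mathbb{R}_+)$ which is a.s. strictly positive for all times. For $\gamma\in[0,d-1)$ the solution is transient in the following sense: for every $a>0$ and every initial condition $s_0>a$ the event $\{T_a=+\infty\}$ has strictly positive probability, and on this event $\lim_{t\to+\infty}S_t=+\infty$ $P$-a.s. For $\gamma\ge d-1$ the solution is recurrent in the sense that if $a>0$ and $s_0>a$, then $P$-a.s. $T_a<+\infty$. Here $T_a$ denotes the first hitting time of $a$ by $S$.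
   Context: $\mathbb{R}_+=[0,+\infty)$; $T_a=\inf\{t\ge0:\ S_t=a\}$ with $\inf\emptyset=+\infty$. A solution is a continuous adapted process $S$ with values in $[0,+\infty)$, a.s. spending zero Lebesgue time at $0$, such that a.s. for all $t\ge 0$, $\int_0^t|b_\gamma(S_r)|\,dr<\infty$ and $S_t=s_0+\int_0^t b_\gamma(S_r)\,dr+\frac1m W_t$. Existence of a strong solution means that for any given standard Wiener process $W$ on the real line there is a solution $S$ adapted to the (completed) filtration generated by $W$. Pathwise uniqueness means that if $S$ and $S'$ are two solutions defined on the same probability space with the same initial condition and the same driving Wiener process $W$, then $P(S_t=S'_t,\ t\in\mathbb{R}_+)=1$. *)

(* Defs.v *)
From HB Require Import structures.
From mathcomp Require Import all_boot all_order all_algebra.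
From mathcomp Require Import all_classical all_reals all_analysis.

Set Implicit Arguments.
Unset Strict Implicit.
Unset Printing Implicit Defensive.

Import Order.TTheory GRing.Theory Num.Theory.
Import numFieldNormedType.Exports.

Local Open Scope classical_set_scope.
Local Open Scope ring_scope.

Section Hyperbolic.
Context {R : realType}.
Implicit Types x : R.

Definition sinhR x : R := (expR x - expR (- x)) / 2.
Definition coshR x : R := (expR x + expR (- x)) / 2.
Definition tanhR x : R := sinhR x / coshR x.
Definition cothR x : R := coshR x / sinhR x.

(* As division by 0 returns 0, [radial_drift d m g 0 = 0]; this value has no
   influence because solutions spend zero Lebesgue time at 0. *)
Definition radial_drift (d : nat) (m g : R) (s : R) : R :=
  (d%:R - 1) / (2 * m ^+ 2) * cothR s - g / (2 * m ^+ 2) * tanhR s.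

End Hyperbolic.

(* Processes and filtrations are indexed by [R], but only times [t >= 0] are
   ever constrained. *)
Section Processes.
Context {dT : measure_display} {T : measurableType dT} {R : realType}.
Implicit Types (P : probability T R) (F : R -> set (set T)).
Implicit Types (W S X : R -> T -> R).

Definition filtration F : Prop :=
  (forall t, 0 <= t -> sigma_algebra setT (F t) /\ F t `<=` measurable) /\
  (forall s t, 0 <= s -> s <= t -> F s `<=` F t).

Definition adapted F X : Prop :=
  forall t, 0 <= t -> forall B : set R, measurable B -> F t (X t @^-1` B).

Definition past_events X (t : R) : set (set T) :=
  \bigcup_(s in `[0, t]) preimage_set_system setT (X s) measurable.

Definition natural_filtration X (t : R) : set (set T) :=
  <<s past_events X t >>.

(* Only null sets belonging to the ambient sigma-algebra are added, so that the
   result is a filtration on an arbitrary probability space; when [P] is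
   complete these are all the [P]-negligible sets. *)
Definition completed_filtration P X (t : R) : set (set T) :=
  <<s past_events X t `|` [set N | measurable N /\ P N = 0%E] >>.

(* The second parameter of [normal_prob] is the standard deviation. *)
Definition wiener P F W : Prop :=
  [/\ filtration F,
      adapted F W,
      {ae P, forall w, W 0 w = 0},
      {ae P, forall w, {within `[0, +oo[, continuous (W ^~ w)}} &
      forall s t, 0 <= s -> s < t -> forall B : set R, measurable B ->
        let incr := [set w | B (W t w - W s w)] in
        P incr = normal_prob 0 (Num.sqrt (t - s)) B /\
        (forall A, F s A -> P (A `&` incr) = (P A * P incr)%E) ].

Definition standard_wiener P W : Prop := wiener P (natural_filtration W) W.

(* [S] solves dS = b(S) dt + c dW, S_0 = s0, on the filtered probability space
   [(T, F, P)]; the noise being additive, its stochastic integral is c W_t. *)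
Definition sde_solution P F (b : R -> R) (c : R) W (s0 : R) S : Prop :=
  [/\ wiener P F W,
      adapted F S,
      forall w, {within `[0, +oo[, continuous (S ^~ w)} /\
        (forall t, 0 <= t -> 0 <= S t w),
      {ae P, forall w,
        lebesgue_measure [set t : R | 0 <= t /\ S t w = 0] = 0%E} &
      {ae P, forall w, forall t, 0 <= t ->
        lebesgue_measure.-integrable `[0, t] (fun r => (b (S r w))%:E) /\
        S t w = s0 + \int[lebesgue_measure]_(r in `[0, t]) b (S r w)
                   + c * W t w} ].

Definition hitting_time S (a : R) (w : T) : \bar R :=
  ereal_inf [set t%:E | t in [set t | 0 <= t /\ S t w = a]].

End Processes.

Section SDE.
Context {R : realType}.
Variables (b : R -> R) (c : R).

Definition positive_strong_existence (s0 : R) : Prop :=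
  forall (dT : measure_display) (T : measurableType dT) (P : probability T R)
    (W : R -> T -> R), standard_wiener P W ->
  exists S : R -> T -> R,
    sde_solution P (completed_filtration P W) b c W s0 S /\
    {ae P, forall w, forall t, 0 <= t -> 0 < S t w}.

(* The two solutions may be adapted to different filtrations. *)
Definition pathwise_unique (s0 : R) : Prop :=
  forall (dT : measure_display) (T : measurableType dT) (P : probability T R)
    (F F' : R -> set (set T)) (W S S' : R -> T -> R),
  sde_solution P F b c W s0 S -> sde_solution P F' b c W s0 S' ->
  {ae P, forall w, forall t, 0 <= t -> S t w = S' t w}.

Definition transient : Prop :=
  forall a s0 : R, 0 < a -> a < s0 ->
  forall (dT : measure_display) (T : measurableType dT) (P : probability T R)
    (F : R -> set (set T)) (W S : R -> T -> R),
  sde_solution P F b c W s0 S ->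
  (0 < P [set w | hitting_time S a w = +oo])%E /\
  {ae P, forall w, hitting_time S a w = +oo%E ->
    S t w @[t --> +oo] --> +oo}.

Definition recurrent : Prop :=
  forall a s0 : R, 0 < a -> a < s0 ->
  forall (dT : measure_display) (T : measurableType dT) (P : probability T R)
    (F : R -> set (set T)) (W S : R -> T -> R),
  sde_solution P F b c W s0 S ->
  {ae P, forall w, (hitting_time S a w < +oo)%E}.

End SDE.

(* Main.v *)
Require Import Defs.
From HB Require Import structures.
From mathcomp Require Import all_boot all_order all_algebra.
From mathcomp Require Import all_classical all_reals all_analysis.
From mathcomp Require Import ring lra.
From mathcomp Require Import measurable_realfun.

(* The noise is additive, so a solution is, path by path, a solution of the
   integral equation x_t = s0 + int_0^t b(x) dr + c W_t, and stochastic
   integration can be avoided.  The drift b is decreasing on (0, oo), which gives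
   pathwise uniqueness, and its truncation b (max (., e)) is bounded and
   Lipschitz, so that the truncated equation is solved by Picard iteration for
   every path of W.  The stochastic input is a one-step Gaussian Taylor estimate
   for the Euler chain of the truncated equation: it turns a Lyapunov inequality
   b f' + c^2 f'' / 2 <= k into bounds on exit probabilities for the chain, which
   pass to the solution because the chain converges along each path.
   - f(s) = s^2 / 2 - ln s shows that the truncated solution stays above e up to
     a given time with probability tending to 1 as e -> 0 (this is where d >= 2
     enters, as (d - 1) / (2 m^2) >= c^2 / 2), whence a positive solution;
   - f(s) = exp (- lam s) shows that kap t + c W_t stays above - eta forever with
     positive probability if kap > 0; for g < d - 1 one has
     S_t >= s0 + kap t + c W_t with kap = (d - 1 - g) / (2 m^2) > 0;
   - for g >= d - 1 the drift is O (s^-2), and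
     f(s) = ln (1 + s) + K (1 - exp (- lam s)) satisfies
     b f' + c^2 f'' / 2 <= - c^2 / (4 (1 + s)^2) above any level, while f is
     unbounded: a solution remaining above a would be neither bounded nor
     unbounded. *)

Set Implicit Arguments.
Unset Strict Implicit.
Unset Printing Implicit Defensive.
Import Order.TTheory GRing.Theory Num.Theory.
Import numFieldNormedType.Exports.
Local Open Scope classical_set_scope.
Local Open Scope ring_scope.

(** * Hyperbolic functions and Taylor bounds *)

(** Itô's formula is replaced by a sum of one-step inequalities: a Taylor step of mesh h has error h
    times O(sqrt h), so T / h steps lose only T times O(sqrt h). Gaussian increments are unbounded,
    so the chain may jump out of the region where f satisfies its Lyapunov inequality. Each f is
    therefore extended to the whole line, possibly with a jump, and only an upper bound by the
    second-order expansion plus a cubic remainder is required, from y in the region to arbitrary z;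
    a long jump is paid for by the cubic term. Stopping times are replaced by freezing the chain at
    its first exit, so that an exit before time n is visible in the state at time n. The mesh limit
    is taken on events: the paths whose chains eventually lie in given events form a lim inf of
    sets, which is measurable and has controlled probability. This handles solutions chosen path by
    path before their measurability in w is known; adaptedness is established separately, as a limit
    of chains. *)

Section real_functions.
Context {R : realType}.
Implicit Types s x y : R.

Lemma is_derive_ge0_le (f df : R -> R) a b : a <= b ->
  (forall x, a <= x <= b -> is_derive x 1 f (df x)) ->
  (forall x, a <= x <= b -> 0 <= df x) -> f a <= f b.
Proof.
move=> ab fdf df0.
have fd x : x \in `]a, b[ -> is_derive x 1 f (df x).
  by rewrite in_itv/= => /andP[/ltW ax /ltW xb]; apply: fdf; rewrite ax.
have fc : {within `[a, b], continuous f}.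
  apply: continuous_in_subspaceT => x; rewrite inE/= in_itv/= => /fdf fx.
  exact/differentiable_continuous/derivable1_diffP.
have [c] := MVT_segment ab fd fc.
rewrite in_itv/= => cab fab.
by rewrite -subr_ge0 fab mulr_ge0 ?df0 ?subr_ge0.
Qed.

Lemma is_derive_le0_ge (f df : R -> R) a b : a <= b ->
  (forall x, a <= x <= b -> is_derive x 1 f (df x)) ->
  (forall x, a <= x <= b -> df x <= 0) -> f b <= f a.
Proof.
move=> ab fdf df0; rewrite -lerN2.
apply: (@is_derive_ge0_le (\- f) (\- df) _ _ ab) => x xab.
  exact: is_deriveN (fdf _ xab).
by rewrite oppr_ge0 df0.
Qed.

Lemma sinhR_gt0 s : 0 < s -> 0 < sinhR s.
Proof. by move=> s0; rewrite /sinhR divr_gt0// subr_gt0 ltr_expR; lra. Qed.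

Lemma coshR_gt0 s : 0 < coshR s.
Proof. by rewrite /coshR divr_gt0// addr_gt0 ?expR_gt0. Qed.

Let mulr2s s : 2 * s = s + s. Proof. by ring. Qed.

Lemma cothRE s : 0 < s -> cothR s = 1 + 2 / (expR (2 * s) - 1).
Proof.
move=> s0; rewrite /cothR /coshR /sinhR expRN mulr2s expRD.
have e1 : 1 < expR s by rewrite expR_gt1.
have e0 : 0 < expR s by exact: expR_gt0.
have : expR s * expR s - 1 != 0 by rewrite gt_eqF//; nra.
have : expR s != 0 by rewrite gt_eqF.
move: (expR s) => e d1 d2.
have d3 : e - e^-1 != 0.
  have -> : e - e^-1 = (e * e - 1) / e by field.
  by rewrite mulf_neq0 ?invr_eq0.
by field; rewrite d1 d2.
Qed.

Lemma tanhRE s : tanhR s = 1 - 2 / (expR (2 * s) + 1).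
Proof.
rewrite /tanhR /coshR /sinhR expRN mulr2s expRD.
have e0 : 0 < expR s by exact: expR_gt0.
have : expR s * expR s + 1 != 0 by rewrite gt_eqF//; nra.
have : expR s != 0 by rewrite gt_eqF.
move: (expR s) => e d1 d2.
have d3 : e + e^-1 != 0.
  have -> : e + e^-1 = (e * e + 1) / e by field.
  by rewrite mulf_neq0 ?invr_eq0.
by field; rewrite d1 d2.
Qed.

Lemma sinhR_le_mul_coshR s : 0 <= s -> sinhR s <= s * coshR s.
Proof.
move=> s0.
suff : 0 * (expR 0 + expR (- 0)) - (expR 0 - expR (- 0)) <=
    s * (expR s + expR (- s)) - (expR s - expR (- s)) :> R.
  rewrite oppr0 mul0r subrr subr0 /sinhR /coshR; lra.
apply: (@is_derive_ge0_le (fun s => s * (expR s + expR (- s)) - (expR s - expR (- s)))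
  (fun s => s * (expR s - expR (- s)))) => // x /andP[x0 _].
  apply: is_derive_eq; rewrite /GRing.scale/=; ring.
by rewrite mulr_ge0// subr_ge0 ler_expR; lra.
Qed.

Let expR2_gt1 s : 0 < s -> 1 + 2 * s <= expR (2 * s).
Proof. by move=> s0; apply: expR_ge1Dx. Qed.

Lemma cothR_ge1 s : 0 < s -> 1 <= cothR s.
Proof.
move=> s0; rewrite cothRE// lerDl divr_ge0//.
by have := expR2_gt1 s0; lra.
Qed.

Lemma cothR_gt0 s : 0 < s -> 0 < cothR s.
Proof. by move=> /cothR_ge1; apply: lt_le_trans. Qed.

Lemma cothR_le s : 0 < s -> cothR s <= 1 + s^-1.
Proof.
move=> s0; rewrite cothRE// lerD2l.
have h := expR2_gt1 s0.
rewrite ler_pdivrMr; last lra.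
by rewrite mulrC ler_pdivlMr//; lra.
Qed.

Lemma cothR_ge s : 0 < s -> s^-1 <= cothR s.
Proof.
move=> s0; rewrite /cothR ler_pdivlMr ?sinhR_gt0// mulrC ler_pdivrMr//.
by rewrite mulrC; apply: sinhR_le_mul_coshR; exact: ltW.
Qed.

(** From e^(2 s) >= 1 + 2 s^2. Decay of order s^-2 is enough for recurrence, since the critical
    order of a drift against constant noise is 1 / s. *)
Lemma cothR_sub1_le s : 0 < s -> cothR s - 1 <= s ^- 2.
Proof.
move=> s0; rewrite cothRE// addrC addKr.
have h : 1 + (2 * s) ^+ 2 / 2 <= expR (2 * s).
  by apply: (@expR_ge1Dxn _ _ 1); lra.
have s2 : 0 < s ^+ 2 by rewrite exprn_gt0.
rewrite ler_pdivrMr; last by move: h; rewrite exprMn; lra.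
by rewrite mulrC ler_pdivlMr//; move: h; rewrite exprMn; lra.
Qed.

Lemma tanhR_le1 s : tanhR s <= 1.
Proof. by rewrite tanhRE gerBl divr_ge0// addr_ge0// expR_ge0. Qed.

Lemma tanhR_ge0 s : 0 <= s -> 0 <= tanhR s.
Proof.
move=> s0; rewrite divr_ge0 ?(ltW (coshR_gt0 _))//.
by rewrite divr_ge0// subr_ge0 ler_expR; lra.
Qed.

Lemma tanhR_le s : 0 <= s -> tanhR s <= s.
Proof.
by move=> s0; rewrite /tanhR ler_pdivrMr ?coshR_gt0// sinhR_le_mul_coshR.
Qed.

Lemma onem_tanhR_le s : 0 < s -> 1 - tanhR s <= s ^- 2.
Proof.
move=> s0; rewrite tanhRE opprB addrC subrK.
have h : 1 + (2 * s) ^+ 2 / 2 <= expR (2 * s).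
  by apply: (@expR_ge1Dxn _ _ 1); lra.
have s2 : 0 < s ^+ 2 by rewrite exprn_gt0.
rewrite ler_pdivrMr; last by move: h; rewrite exprMn; lra.
by rewrite mulrC ler_pdivlMr//; move: h; rewrite exprMn; lra.
Qed.

(** The tangent inequality e^t >= 1 + t at t = 2 x - 2 y, multiplied by e^(2 y). *)
Let expR_slope x y : x <= y -> expR (2 * y) - expR (2 * x) <= 2 * (y - x) * expR (2 * y).
Proof.
move=> xy; have := expR_ge1Dx (2 * x - 2 * y).
have -> : expR (2 * x) = expR (2 * x - 2 * y) * expR (2 * y) by rewrite -expRD subrK.
have := expR_gt0 (2 * y); nra.
Qed.

Lemma cothR_nincr x y : 0 < x -> x <= y -> cothR y <= cothR x.
Proof.
move=> x0 xy; have y0 := lt_le_trans x0 xy.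
have hx := expR2_gt1 x0; have hy := expR2_gt1 y0.
rewrite !cothRE// lerD2l ler_pM2l// lef_pV2 ?posrE; [|lra|lra].
by rewrite lerB// ler_expR; lra.
Qed.

Lemma tanhR_ndecr x y : x <= y -> tanhR x <= tanhR y.
Proof.
move=> xy; have hx := expR_gt0 (2 * x); have hy := expR_gt0 (2 * y).
rewrite !tanhRE lerD2l lerN2 ler_pM2l// lef_pV2 ?posrE; [|lra|lra].
by rewrite lerD2r ler_expR; lra.
Qed.

(** With E = e^(2 x) and F = e^(2 y) the difference is 2 (F - E) / ((E - 1) (F - 1)). The constant
    collects F - E <= 2 (y - x) F, F / (F - 1) <= 1 + 1 / (2 e) and E - 1 >= 2 e. *)
Lemma cothR_lipschitz e x y : 0 < e -> e <= x -> x <= y ->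
  cothR x - cothR y <= (2 * (1 + 1 / (2 * e)) / e) * (y - x).
Proof.
move=> e0 ex xy.
have x0 := lt_le_trans e0 ex; have y0 := lt_le_trans x0 xy.
have hx := expR2_gt1 x0; have hy := expR2_gt1 y0.
have sl := expR_slope xy.
rewrite !cothRE//; move: hx hy sl; set E := expR (2 * x); set F := expR (2 * y) => hx hy sl.
have -> : 1 + 2 / (E - 1) - (1 + 2 / (F - 1)) = 2 * (F - E) / ((E - 1) * (F - 1)).
  by field; apply/andP; split; rewrite gt_eqF//; lra.
have E1 : 2 * e <= E - 1 by lra.
have F1 : 2 * e <= F - 1 by lra.
have FF : F <= (1 + 1 / (2 * e)) * (F - 1).
  rewrite mulrDl !mul1r.
  suff : 1 <= (2 * e)^-1 * (F - 1) by lra.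
  by rewrite mulrC ler_pdivlMr; lra.
rewrite ler_pdivrMr; last by nra.
set k := 1 + 1 / (2 * e) in FF *.
have k0 : 0 <= k by rewrite addr_ge0// divr_ge0//; lra.
have xy0 : 0 <= y - x by lra.
apply: (@le_trans _ _ (2 * (2 * (y - x) * (k * (F - 1))))).
  rewrite ler_pM2l//; apply: le_trans sl _.
  by rewrite ler_wpM2l//; lra.
have -> : 2 * k / e * (y - x) * ((E - 1) * (F - 1)) = (2 * (y - x) * (k * (F - 1))) * ((E - 1) / e).
  by ring.
rewrite [leLHS]mulrC ler_wpM2l//.
  rewrite !mulr_ge0//; lra.
by rewrite ler_pdivlMr.
Qed.

Lemma tanhR_lipschitz x y : 0 <= x -> x <= y -> tanhR y - tanhR x <= 2 * (y - x).
Proof.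
move=> x0 xy.
have sl := expR_slope xy; rewrite !tanhRE.
have hx := expR_ge1Dx (2 * x); have hy := expR_ge1Dx (2 * y).
move: hx hy sl; set E := expR (2 * x); set F := expR (2 * y) => hx hy sl.
have -> : 1 - 2 / (F + 1) - (1 - 2 / (E + 1)) = 2 * (F - E) / ((E + 1) * (F + 1)).
  by field; apply/andP; split; rewrite gt_eqF//; lra.
have E1 : 2 <= E + 1 by lra.
rewrite ler_pdivrMr; last by nra.
apply: (@le_trans _ _ (2 * (2 * (y - x) * F))); first by rewrite ler_pM2l.
have : 0 <= y - x by lra.
have : 0 <= F by lra.
set d := y - x => F0 d0.
have : 0 <= d * F by exact: mulr_ge0.
have : 0 <= d * (E - 1) * (F + 1) by rewrite !mulr_ge0//; lra.
nra.
Qed.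

End real_functions.

Section taylor.
Context {R : realType}.
Implicit Types u v x y : R.

Lemma expR_ge_taylor2 u : 0 <= u -> 1 + u + u ^+ 2 / 2 <= expR u.
Proof.
move=> u0; suff : expR 0 - (1 + 0 + 0 ^+ 2 / 2) <= expR u - (1 + u + u ^+ 2 / 2) :> R.
  rewrite expR0; lra.
apply: (@is_derive_ge0_le _ (fun u => expR u - (1 + u + u ^+ 2 / 2))
  (fun u => expR u - (1 + u))) => // x /andP[x0 _].
  by apply: is_derive_eq; rewrite /GRing.scale/=; field.
by rewrite subr_ge0 expR_ge1Dx.
Qed.

Lemma expR_le_taylor2 u : u <= 0 -> expR u <= 1 + u + u ^+ 2 / 2.
Proof.
move=> u0; suff : expR u - (1 + u + u ^+ 2 / 2) <= expR 0 - (1 + 0 + 0 ^+ 2 / 2) :> R.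
  rewrite expR0; lra.
apply: (@is_derive_ge0_le _ (fun u => expR u - (1 + u + u ^+ 2 / 2))
  (fun u => expR u - (1 + u))) => // x _.
  by apply: is_derive_eq; rewrite /GRing.scale/=; field.
by rewrite subr_ge0 expR_ge1Dx.
Qed.

(** The derivative of the difference is the second-order remainder, which has the sign of u, so the
    difference is minimal at 0. *)
Lemma expR_ge_taylor3 u : 1 + u + u ^+ 2 / 2 + u ^+ 3 / 6 <= expR u.
Proof.
pose g u : R := expR u - (1 + u + u ^+ 2 / 2 + u ^+ 3 / 6).
have gE x : is_derive x 1 g (expR x - (1 + x + x ^+ 2 / 2)).
  by apply: is_derive_eq; rewrite /GRing.scale/=; field.
have g0 : g 0 = 0 by rewrite /g expR0; field.
have [u0|/ltW u0] := leP 0 u.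
  suff : g 0 <= g u by rewrite g0 /g subr_ge0.
  apply: is_derive_ge0_le (fun x _ => gE x) _ => // x /andP[x0 _].
  by rewrite subr_ge0 expR_ge_taylor2.
suff : g 0 <= g u by rewrite g0 /g subr_ge0.
apply: (is_derive_le0_ge u0 (fun x _ => gE x)) => x /andP[_ x0].
by rewrite subr_le0 expR_le_taylor2.
Qed.

(** The symmetric weight covers both signs of u at once and remains integrable against every
    Gaussian law. *)
Lemma normr_expR_taylor2 u :
  `|expR u - (1 + u + u ^+ 2 / 2)| <= `|u| ^+ 3 * (expR u + expR (- u)).
Proof.
have e0 := expR_gt0 u; have en0 := expR_gt0 (- u).
have t3 := expR_ge_taylor3 u.
have ee : 2 <= expR u + expR (- u).
  by have := expR_ge1Dx u; have := expR_ge1Dx (- u); lra.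
have [u0|/ltW u0] := leP 0 u; last first.
  rewrite ler0_norm ?subr_le0 ?expR_le_taylor2//.
  have : 0 <= (- u) ^+ 3 by rewrite exprn_ge0// oppr_ge0.
  rewrite (ler0_norm u0); have -> : (- u) ^+ 3 = - (u ^+ 3) by ring.
  nra.
rewrite ger0_norm ?subr_ge0 ?expR_ge_taylor2// ger0_norm//.
have h : expR u <= 1 + u + u ^+ 2 / 2 + u ^+ 3 * expR u.
  have l1 x : (1 - x) * expR x <= 1 :> R.
    have := expR_ge1Dx (- x); rewrite expRN => h.
    by rewrite -ler_pdivlMr ?expR_gt0// div1r.
  suff : 1 + 0 + 0 ^+ 2 / 2 + 0 ^+ 3 * expR 0 - expR 0 <=
      1 + u + u ^+ 2 / 2 + u ^+ 3 * expR u - expR u :> R.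
    rewrite expR0; lra.
  apply: (@is_derive_ge0_le _ (fun u => 1 + u + u ^+ 2 / 2 + u ^+ 3 * expR u - expR u)
    (fun u => 1 + u + 3 * u ^+ 2 * expR u + u ^+ 3 * expR u - expR u)) => // x /andP[x0 _].
    by apply: is_derive_eq; rewrite /GRing.scale/=; field.
  (* Multiplying (1 - x) e^x <= 1 by 1 + x gives e^x <= 1 + x + x^2 e^x, and the term 3 x^2 e^x of
     the derivative absorbs the last summand. *)
  have := l1 x; have := expR_gt0 x; move: (expR x) => e e1 h.
  have : 0 <= x ^+ 3 * e by rewrite mulr_ge0 ?exprn_ge0// ltW.
  have : 0 <= x ^+ 2 * e by rewrite mulr_ge0 ?exprn_ge0// ltW.
  have : 0 <= (1 + x) * (1 - (1 - x) * e) by rewrite mulr_ge0//; lra.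
  nra.
have : 0 <= u ^+ 3 * expR (- u) by rewrite mulr_ge0// ?exprn_ge0// ltW.
lra.
Qed.

Lemma normrX3_le_expR u : `|u| ^+ 3 <= 6 * (expR u + expR (- u)).
Proof.
suff H v : 0 <= v -> v ^+ 3 <= 6 * expR v.
  have [u0|/ltW u0] := leP 0 u.
    rewrite ger0_norm//; apply: le_trans (H _ u0) _.
    by rewrite ler_pM2l// lerDl expR_ge0.
  rewrite ler0_norm//; apply: le_trans (H _ _) _; rewrite ?oppr_ge0//.
  by rewrite ler_pM2l// lerDr expR_ge0.
move=> v0; have := expR_ge_taylor3 v.
have : 0 <= v ^+ 2 by rewrite sqr_ge0.
lra.
Qed.

Lemma is_derive_ln1D x : -1 < x -> is_derive x 1 (fun u => ln (1 + u)) ((1 + x)^-1).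
Proof.
move=> x1; have Dl : is_derive (1 + x) 1 (@ln R) (1 + x)^-1.
  by apply: is_derive1_ln; lra.
have D1 : is_derive x 1 (fun u => 1 + u) (1 : R).
  by apply: is_derive_eq; rewrite /GRing.scale/= add0r mul1r.
by have := @is_derive1_comp _ (@ln R) (fun u => 1 + u) x _ _ Dl D1; rewrite mulr1.
Qed.

(** The difference has derivative u^3 / (1 + u), again of the sign of u. *)
Lemma ln1D_le_taylor3 u : -1 < u -> ln (1 + u) <= u - u ^+ 2 / 2 + u ^+ 3 / 3.
Proof.
move=> u1.
pose g u : R := u - u ^+ 2 / 2 + u ^+ 3 / 3 - ln (1 + u).
have gE x : -1 < x -> is_derive x 1 g (x ^+ 3 / (1 + x)).
  move=> x1; have x1' : 0 < 1 + x by lra.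
  have D := is_derive_ln1D x1.
  apply: is_derive_eq; rewrite /GRing.scale/=; field; rewrite gt_eqF//; lra.
have g0 : g 0 = 0 by rewrite /g addr0 ln1; field.
rewrite -subr_ge0 -/(g u) -g0.
have [u0|/ltW u0] := leP 0 u.
  apply: (is_derive_ge0_le u0 (fun x xu => gE x _)) => x /andP[x0 _].
    by lra.
  by rewrite divr_ge0 ?exprn_ge0//; lra.
have gx x : u <= x <= 0 -> is_derive x 1 g (x ^+ 3 / (1 + x)).
  by move=> /andP[ux _]; apply: gE; apply: lt_le_trans u1 ux.
apply: (is_derive_le0_ge u0 gx) => x /andP[ux x0].
rewrite ler_pdivrMr; last by lra.
have : 0 <= (- x) ^+ 3 by rewrite exprn_ge0//; lra.
have -> : (- x) ^+ 3 = - (x ^+ 3) by ring.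
lra.
Qed.

(** Since - ln (1 + u) explodes at -1, the distance e kept from -1 has to enter the remainder, as
    the factor 1 / e. *)
Lemma oppr_ln1D_le_taylor2 e u : 0 < e -> e - 1 <= u ->
  - ln (1 + u) <= - u + u ^+ 2 / 2 + `|u| ^+ 3 / e.
Proof.
move=> e0 u1.
pose g u : R := - u + u ^+ 2 / 2 - u ^+ 3 / e + ln (1 + u).
have gE x : -1 < x -> is_derive x 1 g (x ^+ 2 / (1 + x) - 3 * x ^+ 2 / e).
  move=> x1; have x1' : 0 < 1 + x by lra.
  have D := is_derive_ln1D x1.
  apply: is_derive_eq; rewrite /GRing.scale/=; field; apply/andP; split; rewrite gt_eqF//; lra.
have g0 : g 0 = 0 by rewrite /g addr0 ln1; field; rewrite gt_eqF//; lra.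
have [u0|/ltW u0] := leP 0 u.
  suff : 0 <= ln (1 + u) - (u - u ^+ 2 / 2).
    have : 0 <= `|u| ^+ 3 / e by rewrite divr_ge0 ?exprn_ge0// ltW.
    lra.
  pose k u : R := ln (1 + u) - (u - u ^+ 2 / 2).
  have k0 : k 0 = 0 by rewrite /k addr0 ln1; field.
  rewrite -/(k u) -k0.
  have kx x : 0 <= x <= u -> is_derive x 1 k (x ^+ 2 / (1 + x)).
    move=> /andP[x0 _].
    have x1' : 0 < 1 + x by lra.
    have D : is_derive x 1 (fun u => ln (1 + u)) ((1 + x)^-1) by apply: is_derive_ln1D; lra.
    by apply: is_derive_eq; rewrite /GRing.scale/=; field; rewrite gt_eqF//; lra.
  by apply: (is_derive_ge0_le u0 kx) => x /andP[x0 _]; rewrite divr_ge0 ?sqr_ge0//; lra.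
suff : g 0 <= g u.
  rewrite g0 /g ler0_norm//; have -> : (- u) ^+ 3 = - (u ^+ 3) by ring.
  lra.
have gx x : u <= x <= 0 -> is_derive x 1 g (x ^+ 2 / (1 + x) - 3 * x ^+ 2 / e).
  by move=> /andP[ux _]; apply: gE; lra.
apply: (is_derive_le0_ge u0 gx) => x /andP[ux x0].
rewrite subr_le0; apply: (@le_trans _ _ (x ^+ 2 / e)).
  by rewrite ler_wpM2l ?sqr_ge0// lef_pV2 ?posrE; lra.
rewrite ler_pM2r ?invr_gt0//; have := sqr_ge0 x; lra.
Qed.

End taylor.

(** * The radial drift and its truncations *)

Section drift.
Context {R : realType} (d : nat) (m g : R).
Hypotheses (hd : (2 <= d)%N) (hm : 0 < m) (hg : 0 <= g).
Implicit Types e s x y : R.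

Let A : R := (d%:R - 1) / (2 * m ^+ 2).
Let B : R := g / (2 * m ^+ 2).
Let b := radial_drift d m g.

Let bE s : b s = A * cothR s - B * tanhR s. Proof. by []. Qed.

Let m2_gt0 : 0 < 2 * m ^+ 2. Proof. by rewrite mulr_gt0// exprn_gt0. Qed.

(** Near 0 the equation behaves like a Bessel process of dimension d with noise 1 / m; this
    inequality says that the dimension is at least 2, the critical one for not hitting 0. *)
Lemma coth_coeff_ge : m^-1 ^+ 2 / 2 <= A.
Proof.
rewrite /A exprVn -[leLHS]invfM mulrC -[leLHS]mul1r ler_pM2r ?invr_gt0//.
have : 2 <= d%:R :> R by rewrite (ler_nat R 2 d).
lra.
Qed.

Lemma coth_coeff_ge0 : 0 <= A.
Proof. by apply: le_trans coth_coeff_ge; rewrite divr_ge0// sqr_ge0. Qed.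

Lemma tanh_coeff_ge0 : 0 <= B.
Proof. by rewrite divr_ge0// ltW. Qed.

Let A0 := coth_coeff_ge0.
Let B0 := tanh_coeff_ge0.

Lemma radial_drift_nincr x y : 0 < x -> x <= y -> b y <= b x.
Proof.
by move=> x0 xy; rewrite !bE lerB// ler_wpM2l// ?cothR_nincr// tanhR_ndecr.
Qed.

Lemma radial_drift_ge s : 0 < s -> A - B <= b s.
Proof.
move=> s0; rewrite bE lerB//; first by rewrite ler_peMr// cothR_ge1.
by rewrite ler_piMr// tanhR_le1.
Qed.

Lemma radial_drift_le s : 0 < s -> b s <= A * (1 + s^-1).
Proof.
move=> s0; rewrite bE lerBlDr -[leLHS]addr0 lerD// ?ler_wpM2l ?cothR_le//.
by rewrite mulr_ge0// tanhR_ge0// ltW.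
Qed.

(** The quotient b / s is the contribution of the drift to the generator of ln; its singular part A
    / s^2 is what compensates the second-order term of - ln. *)
Lemma radial_drift_div_ge s : 0 < s -> A / s ^+ 2 - B <= b s / s.
Proof.
move=> s0; rewrite bE mulrBl lerB//.
  rewrite -[A * cothR s / s]mulrA ler_wpM2l// expr2 invfM ler_wpM2r ?invr_ge0 ?(ltW s0)//.
  exact: cothR_ge.
by rewrite ler_pdivrMr// ler_wpM2l// tanhR_le// ltW.
Qed.

(** The hypothesis on g means A <= B, so b <= A (coth - tanh), and both functions are within s^-2 of
    1. *)
Lemma radial_drift_le_sqr s : d%:R - 1 <= g -> 0 < s -> b s <= 2 * A / s ^+ 2.
Proof.
move=> gd s0; rewrite bE.
have AB : A <= B by rewrite /A /B ler_pM2r ?invr_gt0.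
have t0 := tanhR_ge0 (ltW s0).
have c1 := cothR_sub1_le s0; have t1 := onem_tanhR_le s0.
move: c1 t1; set q := s ^- 2 => c1 t1.
apply: (@le_trans _ _ (A * (cothR s - tanhR s))).
  by rewrite mulrBr lerD2l lerN2 ler_wpM2r.
have : A * (cothR s - tanhR s) <= A * (2 * q) by rewrite ler_wpM2l//; lra.
lra.
Qed.

(** Truncating the argument rather than the value keeps the drift nonincreasing on the whole line,
    so that solutions for different levels e can be compared by uniqueness. *)
Definition cutoff_drift e s := radial_drift d m g (Num.max s e).

Lemma cutoff_driftE e s : e <= s -> cutoff_drift e s = b s.
Proof. by move=> es; rewrite /cutoff_drift max_l. Qed.

Let max_gt0 e s : 0 < e -> 0 < Num.max s e.
Proof. by move=> e0; rewrite lt_max e0 orbT. Qed.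

Lemma cutoff_drift_nincr e x y : 0 < e -> x <= y ->
  cutoff_drift e y <= cutoff_drift e x.
Proof.
move=> e0 xy; apply: radial_drift_nincr; first exact: max_gt0.
by rewrite ge_max !le_max xy lexx orbT.
Qed.

Lemma cutoff_drift_bounded e : 0 < e ->
  forall s, `|cutoff_drift e s| <= A * (1 + e^-1) + B.
Proof.
move=> e0 s; have s0 := max_gt0 s e0.
rewrite /cutoff_drift -/b bE; apply: (le_trans (ler_normB _ _)).
rewrite (normrM A) (normrM B) (ger0_norm A0) (ger0_norm B0).
rewrite (gtr0_norm (cothR_gt0 s0)) (ger0_norm (tanhR_ge0 (ltW s0))).
rewrite lerD//; last by rewrite ler_piMr// tanhR_le1.
rewrite ler_wpM2l// (le_trans (cothR_le s0))// lerD2l lef_pV2 ?posrE//.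
by rewrite le_max lexx orbT.
Qed.

Lemma cutoff_drift_lipschitz e : 0 < e -> exists2 L, 0 < L &
  forall x y, `|cutoff_drift e x - cutoff_drift e y| <= L * `|x - y|.
Proof.
move=> e0.
pose k := 2 * (1 + 1 / (2 * e)) / e.
have k0 : 0 <= k by rewrite divr_ge0 ?mulr_ge0 ?addr_ge0 ?divr_ge0 ?mulr_ge0 ?ltW.
exists (A * k + 2 * B + 1).
  by rewrite ltr_wpDl// addr_ge0// mulr_ge0.
suff H x y : x <= y ->
    `|cutoff_drift e x - cutoff_drift e y| <= (A * k + 2 * B + 1) * `|x - y|.
  move=> x y; have [/H//|/ltW/H] := leP x y.
  by rewrite distrC (distrC y).
move=> xy; rewrite ger0_norm ?subr_ge0 ?cutoff_drift_nincr//.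
rewrite (distrC x) ger0_norm ?subr_ge0//.
rewrite /cutoff_drift -/b !bE.
set X := Num.max x e; set Y := Num.max y e.
have XY : X <= Y by rewrite ge_max !le_max xy lexx orbT.
have eX : e <= X by rewrite le_max lexx orbT.
have YX : Y - X <= y - x.
  rewrite /X /Y; case: (leP x e) => xe; case: (leP y e) => ye; lra.
have c1 := cothR_lipschitz e0 eX XY.
have t1 := tanhR_lipschitz (le_trans (ltW e0) eX) XY.
have -> : A * cothR X - B * tanhR X - (A * cothR Y - B * tanhR Y) =
  A * (cothR X - cothR Y) + B * (tanhR Y - tanhR X) by ring.
apply: (@le_trans _ _ (A * (k * (Y - X)) + B * (2 * (Y - X)))).
  by rewrite lerD// ler_wpM2l.
have r0 : 0 <= y - x - (Y - X) by lra.
have := mulr_ge0 (mulr_ge0 A0 k0) r0; have := mulr_ge0 B0 r0.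
lra.
Qed.

End drift.

(** * Integral equations and their Euler chains *)

Section continuity.
Context {R : realType}.
Implicit Types (A : set R) (f u v : R -> R).

Lemma within_continuousP A f : {within A, continuous f} <->
  forall x, A x -> forall e, 0 < e ->
    exists2 del, 0 < del & forall y, A y -> `|x - y| < del -> `|f x - f y| < e.
Proof.
split=> [/subspace_continuousP cf x Ax e e0|H].
  have /cvgrPdist_lt /(_ e e0) := cf x Ax.
  rewrite near_withinE => /nbhs_ballP[del /= del0 H].
  by exists del => // y Ay xy; apply: H.
apply/subspace_continuousP => x Ax; apply/cvgrPdist_lt => e e0.
have [del del0 Hd] := H x Ax e e0.
rewrite near_withinE; apply/nbhs_ballP; exists del => //= y xy Ay.
exact: Hd.
Qed.

Lemma compact_uniform_continuous A f : compact A -> {within A, continuous f} ->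
  forall e, 0 < e -> exists2 del, 0 < del &
    forall x y, A x -> A y -> `|x - y| < del -> `|f x - f y| < e.
Proof.
move=> /compact_near_coveringP cA /within_continuousP cf e e0.
pose P (del x : R) := A x -> forall y, A y -> `|x - y| < del -> `|f x - f y| < e.
have : \forall del \near 0^'+, A `<=` P del.
  apply: cA => x Ax.
  have [|del del0 Hd] := cf x Ax (e / 2); first by rewrite divr_gt0.
  near=> x' t => /= Ax' y Ay x'y.
  have xx' : `|x - x'| < del / 2 by near: x'; apply: nbhsx_ballx; rewrite divr_gt0.
  have td : t < del / 2 by near: t; apply: nbhs_right_lt; rewrite divr_gt0.
  have h1 : `|f x - f x'| < e / 2 by apply: Hd => //; apply: lt_trans xx' _; lra.
  have h2 : `|f x - f y| < e / 2.
    apply: Hd => //; have := ler_distD x' x y; lra.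
  by have := ler_distD (f x) (f x') (f y); rewrite (distrC (f x') (f x)); lra.
move=> H; near (0:R)^'+ => del.
exists del => // x y Ax Ay xy; rewrite -/(P del x).
suff : P del x by exact.
by apply: (near H del).
Unshelve. all: by end_near. Qed.

End continuity.

Section integral_equation.
Context {R : realType}.
Implicit Types (u v x y : R -> R) (r s t T : R).
Notation mu := (@lebesgue_measure R).

Lemma Rintegral_le0_ae (D : set R) v : measurable D ->
  mu.-integrable D (EFin \o v) ->
  {ae mu, forall r, D r -> v r <= 0} -> \int[mu]_(r in D) v r <= 0.
Proof.
move=> mD iv v0; rewrite /Rintegral.
have mv := measurable_int _ iv.
(* Replacing v by - max (- v, 0), equal to it almost everywhere on D, makes the sign hold
   pointwise. *)
have -> : (\int[mu]_(r in D) (v r)%:E =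
    \int[mu]_(r in D) - (Num.max (- v r) 0)%:E)%E.
  apply: ae_eq_integral => //.
    apply/measurable_EFinP/measurableT_comp => //.
    apply: measurable_maxr => //; apply/measurableT_comp => //.
    exact/measurable_EFinP.
  apply: filterS v0; first exact: (ae_filter_ringOfSetsType mu).
  by move=> r vr Dr /=; rewrite max_l ?oppr_ge0 ?vr//= opprK.
have m0 r : D r -> (0 <= (Num.max (- v r) 0)%:E :> \bar R)%E.
  by rewrite lee_fin le_max lexx orbT.
by rewrite integral_ge0N// fineN oppr_le0 fine_ge0// integral_ge0.
Qed.

(** If u t > 0, let s be the last time before t with u s <= 0. On ]s, t] the function u is positive,
    so its integrand is almost everywhere nonpositive and u t <= u s, a contradiction. *)
Lemma integral_eq_le0 T u v : {within `[0, T], continuous u} ->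
  (forall t, 0 <= t <= T -> mu.-integrable `[0, t] (EFin \o v) /\
     u t = \int[mu]_(r in `[0, t]) v r) ->
  {ae mu, forall r, 0 <= r <= T -> 0 < u r -> v r <= 0} ->
  forall t, 0 <= t <= T -> u t <= 0.
Proof.
move=> /within_continuousP uc uv v0 t /andP[t0 tT]; rewrite leNgt; apply/negP => ut.
have u0 : u 0 = 0.
  have [|_ ->] := uv 0; first by rewrite lexx (le_trans t0).
  by rewrite set_itv1 Rintegral_set1.
pose Z := [set r | 0 <= r <= t /\ u r <= 0].
have Z0 : Z 0 by rewrite /Z/= lexx t0 u0.
have supZ : has_sup Z.
  by split; [exists 0|exists t => r [/andP[]]].
pose s := sup Z.
have s0 : 0 <= s by exact: ub_le_sup supZ.2 _ Z0.
have st : s <= t by apply: ge_sup; [exists 0|move=> r [/andP[]]].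
have us : u s <= 0.
  rewrite leNgt; apply/negP => us.
  have [|del del0 H] := uc s _ _ us.
    by rewrite /= in_itv/= s0 (le_trans st).
  have [r Zr sr] := sup_adherent del0 supZ.
  have rs : r <= s by exact: ub_le_sup supZ.2 _ Zr.
  have [/andP[r0 rt] ur] := Zr.
  have := H r; rewrite /= in_itv/= r0 (le_trans rt)// => /(_ isT).
  rewrite ger0_norm ?subr_ge0// ltrBlDr -ltrBlDl sr => /(_ isT).
  by rewrite ltr_norml => /andP[_]; lra.
have sr r : s < r <= t -> 0 < u r.
  move=> /andP[sr rt]; rewrite ltNge; apply/negP => ur.
  have : r <= s.
    by apply: ub_le_sup supZ.2 _ _; split => //; rewrite rt (le_trans s0 (ltW sr)).
  by rewrite leNgt sr.
have [|it utE] := uv t; first by rewrite t0.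
rewrite utE in ut.
have [|_ sE] := uv s; first by rewrite s0 (le_trans st).
have := @Rintegral_itvB _ v (BLeft 0) (BRight t) s it.
rewrite !bnd_simp => /(_ s0 st); rewrite -sE.
have : \int[mu]_(r in `]s, t]) v r <= 0.
  apply: Rintegral_le0_ae => //.
    apply: integrableS it => //; apply: subset_itv; rewrite ?bnd_simp//.
  apply: filterS v0; first exact: (ae_filter_ringOfSetsType mu).
  move=> r vr; rewrite /= in_itv/= => srt.
  apply: vr; last exact: sr.
  by move/andP: srt => [/ltW sr' rt]; rewrite (le_trans s0 sr') (le_trans rt).
by move: (\int[mu]_(r in `]s, t]) v r) us ut => z; lra.
Qed.

End integral_equation.

Section euler.
Context {R : realType}.
Implicit Types (u v x w : R -> R) (r s t T y e : R).
Notation mu := (@lebesgue_measure R).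

Lemma fine_lebesgue_oc s t : s <= t -> fine (mu `]s, t]) = t - s.
Proof.
rewrite le_eqVlt => /predU1P[->|st].
  by rewrite set_itv_ge ?bnd_simp ?ltxx// measure0 subrr.
by rewrite lebesgue_measure_itv/= lte_fin st.
Qed.

Lemma Rintegral_oc_approx v s t y e : s <= t ->
  mu.-integrable `]s, t] (EFin \o v) ->
  (forall r, s < r <= t -> `|v r - y| <= e) ->
  `|\int[mu]_(r in `]s, t]) v r - (t - s) * y| <= (t - s) * e.
Proof.
move=> st iv vy.
have icst z : mu.-integrable `]s, t] (EFin \o cst z).
  have : mu.-integrable `[s, t] (EFin \o cst z).
    apply: continuous_compact_integrable; first exact: segment_compact.
    by move=> ?; apply: cvg_cst.
  by apply: integrableS => //; apply: subset_itv; rewrite bnd_simp.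
have -> : (t - s) * y = \int[mu]_(r in `]s, t]) cst y r.
  by rewrite Rintegral_cst// fine_lebesgue_oc// mulrC.
rewrite -RintegralB//.
have ivy : mu.-integrable `]s, t] (EFin \o (fun r => v r - cst y r)).
  exact: (integrableB _ iv (icst y)).
apply: (le_trans (le_normr_Rintegral _ ivy)) => //.
have -> : (t - s) * e = \int[mu]_(r in `]s, t]) cst e r.
  by rewrite Rintegral_cst// fine_lebesgue_oc// mulrC.
apply: le_Rintegral => //; first exact: integrable_norm ivy.
Qed.

(* The Euler scheme of mesh h for dx = b(x) dt + c dw, frozen once outside I. *)
Definition chain (I : set R) (b : R -> R) (c h x0 : R) (w : R -> R) : nat -> R :=
  fix chain k := if k is k'.+1 then
    let x := chain k' in
    x + \1_I x * (h * b x + c * (w (h * k'.+1%:R) - w (h * k'%:R)))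
  else x0.

Lemma chainS I b c h (x0 : R) w k : chain I b c h x0 w k.+1 =
  chain I b c h x0 w k + \1_I (chain I b c h x0 w k) *
  (h * b (chain I b c h x0 w k) + c * (w (h * k.+1%:R) - w (h * k%:R))).
Proof. by []. Qed.

Lemma chain_stopped I b c h (x0 : R) w k n : (k <= n)%N ->
  ~ I (chain I b c h x0 w k) -> chain I b c h x0 w n = chain I b c h x0 w k.
Proof.
move=> kn Ik; elim: n kn => [|n IH]; first by rewrite leqn0 => /eqP->.
rewrite leq_eqVlt => /predU1P[->//|/IH E].
by rewrite chainS E indicE memNset// mul0r addr0.
Qed.

Lemma chain_unstopped I b c h (x0 : R) w n :
  (forall k, (k < n)%N -> I (chain setT b c h x0 w k)) ->
  forall k, (k <= n)%N -> chain I b c h x0 w k = chain setT b c h x0 w k.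
Proof.
move=> H; elim=> [//|k IH kn].
by rewrite !chainS IH ?(ltnW kn)// !indicE !mem_set//; exact: H.
Qed.

(* Leaving [I] once is enough for the stopped chain to end outside [I]. *)
Lemma chain_exit I b c h (x0 : R) w k n : (k <= n)%N ->
  ~ I (chain setT b c h x0 w k) -> ~ I (chain I b c h x0 w n).
Proof.
move=> kn Ik.
have : exists k, `[< ~ I (chain setT b c h x0 w k) >] by exists k; apply/asboolP.
case/ex_minnP => j /asboolP Ij jmin.
have jn : (j <= n)%N by apply: leq_trans kn; apply: jmin; apply/asboolP.
have E : chain I b c h x0 w j = chain setT b c h x0 w j.
  apply: (@chain_unstopped _ _ _ _ _ _ j) => // i ij.
  by apply: contrapT => /asboolP /jmin; rewrite leqNgt ij.
by rewrite (chain_stopped jn) E.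
Qed.

Lemma chain_stay I b c h (x0 : R) w n :
  (forall k, (k <= n)%N -> I (chain setT b c h x0 w k)) ->
  I (chain I b c h x0 w n).
Proof.
move=> H; rewrite (@chain_unstopped _ _ _ _ _ _ n)//; first exact: H.
by move=> k /ltnW; exact: H.
Qed.

Definition ode_solution (b : R -> R) (c x0 : R) (w : R -> R) T x : Prop :=
  {within `[0, T], continuous x} /\
  forall t, 0 <= t <= T -> mu.-integrable `[0, t] (EFin \o (b \o x)) /\
    x t = x0 + \int[mu]_(r in `[0, t]) b (x r) + c * w t.

Lemma ode_solution_incr b c (x0 : R) w T x s t : ode_solution b c x0 w T x ->
  0 <= s -> s <= t -> t <= T ->
  mu.-integrable `]s, t] (EFin \o (b \o x)) /\
  x t - x s = \int[mu]_(r in `]s, t]) b (x r) + c * (w t - w s).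
Proof.
move=> [_ xE] s0 st tT.
have [|it ->] := xE t; first by rewrite (le_trans s0).
have [|_ ->] := xE s; first by rewrite s0 (le_trans st).
split.
  by apply: integrableS it => //; apply: subset_itv; rewrite bnd_simp.
have := @Rintegral_itvB _ (b \o x) (BLeft 0) (BRight t) s it.
rewrite !bnd_simp => /(_ s0 st) <- /=; ring.
Qed.

(* With [w] the modulus of continuity of [x] at scale [h], the error [e_k]
   of the scheme satisfies [e_(k+1) + w <= (1 + L h) (e_k + w)]. *)
Lemma chain_cvg b c (x0 : R) w T x L : 0 < L ->
  (forall y z, `|b y - b z| <= L * `|y - z|) ->
  w 0 = 0 -> ode_solution b c x0 w T x ->
  forall e, 0 < e -> exists2 del, 0 < del &
    forall h n, 0 < h < del -> h * n%:R <= T -> forall k, (k <= n)%N ->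
      `|chain setT b c h x0 w k - x (h * k%:R)| < e.
Proof.
move=> L0 bL w0 xsol e e0.
(* A discrete Gronwall bound: (1 + L h)^k <= e^(L T) as long as k h <= T, so a modulus [om] equal to
   e times e^(- L T) keeps the error below e. *)
have [cx xE] := xsol.
pose om := e / expR (L * T).
have om0 : 0 < om by rewrite divr_gt0 ?expR_gt0.
have [del del0 Hd] := compact_uniform_continuous (@segment_compact _ _ _) cx om0.
exists del => // h n /andP[h0 hdel] hnT k kn.
suff H : `|chain setT b c h x0 w k - x (h * k%:R)| + om <= (1 + L * h) ^+ k * om.
  have : (1 + L * h) ^+ k * om <= e.
    rewrite mulrA ler_pdivrMr ?expR_gt0// mulrC ler_pM2l//.
    apply: (@le_trans _ _ (expR (L * h) ^+ k)).
      by rewrite lerXn2r ?nnegrE ?expR_ge1Dx ?expR_ge0// addr_ge0// mulr_ge0// ltW.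
    rewrite -expRM_natl ler_expR mulrC -mulrA ler_pM2l//.
    by rewrite (le_trans _ hnT)// ler_pM2l// ler_nat.
  move: H; lra.
elim: k kn => [_|k IH kn].
  rewrite /= mulr0 expr0 mul1r.
  have [|_ ->] := xE 0.
    by rewrite lexx (le_trans _ hnT)// mulr_ge0// ltW.
  by rewrite set_itv1 Rintegral_set1 w0 mulr0 !addr0 subrr normr0 add0r.
have {}IH := IH (ltnW kn).
set s := h * k%:R in IH *; set t := h * k.+1%:R.
have s0 : 0 <= s by rewrite mulr_ge0// ltW.
have tsh : t - s = h by rewrite /t /s -mulrBr -natrB// subSnn mulr1.
have st : s <= t by lra.
have tT : t <= T by rewrite (le_trans _ hnT)// ler_pM2l// ler_nat.
have [it xts] := ode_solution_incr xsol s0 st tT.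
rewrite chainS indicE in_setT mul1r -/s -/t.
move: IH; set y := chain setT b c h x0 w k => IH.
have I1 : `|\int[mu]_(r in `]s, t]) b (x r) - (t - s) * b (x s)| <= (t - s) * (L * om).
  apply: Rintegral_oc_approx => // r /andP[sr rt].
  apply: le_trans (bL _ _) _; rewrite ler_pM2l// ltW// Hd//.
  - by rewrite /= in_itv/= (le_trans s0 (ltW sr)) (le_trans rt).
  - by rewrite /= in_itv/= s0 (le_trans st).
  - by rewrite ger0_norm; lra.
have I2 : `|h * b y - h * b (x s)| <= h * (L * `|y - x s|).
  by rewrite -mulrBr normrM gtr0_norm// ler_pM2l.
rewrite tsh in I1.
have -> : y + (h * b y + c * (w t - w s)) - x t = (y - x s) +
   (h * b y - h * b (x s)) - (\int[mu]_(r in `]s, t]) b (x r) - h * b (x s)).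
  have -> : x t = x s + (\int[mu]_(r in `]s, t]) b (x r) + c * (w t - w s)).
    by rewrite -xts; ring.
  ring.
have := ler_normB (y - x s + (h * b y - h * b (x s)))
  (\int[mu]_(r in `]s, t]) b (x r) - h * b (x s)).
have := ler_normD (y - x s) (h * b y - h * b (x s)).
have : (1 + L * h) * (`|y - x s| + om) <= (1 + L * h) * ((1 + L * h) ^+ k * om).
  by rewrite ler_pM2l// ltr_wpDr// mulr_ge0// ltW.
rewrite exprS -mulrA.
set X := (_ ^+ k * om) in IH *.
lra.
Qed.

End euler.

(** * Picard iteration for bounded Lipschitz drifts *)

Section picard.
Context {R : realType}.
Implicit Types (b f u v x w : R -> R) (r s t T y e : R).
Notation mu := (@lebesgue_measure R).

Lemma le_add_geometric (a b C : R) : 0 <= C ->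
  (forall n, a <= b + C / 2 ^+ n) -> a <= b.
Proof.
move=> C0 H; apply/ler_addgt0Pr => e e0.
have := @upper_nthrootP _ (C / e) (Num.bound (C / e)) (leqnn _).
set n := Num.bound _ => Cn.
apply: le_trans (H n) _; rewrite lerD2l ler_pdivrMr ?exprn_gt0//.
by rewrite mulrC -ler_pdivrMr// ltW.
Qed.

(** With d n the geometric tail, the intervals of centre a n and radius d n intersect pairwise, so
    the supremum of their left ends lies in all of them. This gives the limit together with its
    rate. *)
Lemma geometric_cauchy_lim (a : nat -> R) C :
  (forall n, `|a n.+1 - a n| <= C / 2 ^+ n) ->
  exists l, forall n, `|l - a n| <= 2 * C / 2 ^+ n.
Proof.
move=> aC.
pose d n : R := 2 * C / 2 ^+ n.
have dS n : d n = C / 2 ^+ n + d n.+1.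
  rewrite /d exprS invfM; have : 2 ^+ n != 0 :> R by rewrite expf_neq0.
  by move=> ?; field.
have d0 n : 0 <= d n.
  rewrite /d -mulrA mulr_ge0//; apply: le_trans (aC n); exact: normr_ge0.
have H k n : `|a (n + k)%N - a n| <= d n - d (n + k)%N.
  elim: k => [|k IH]; first by rewrite addn0 !subrr normr0.
  rewrite addnS; have := aC (n + k)%N; have := dS (n + k)%N.
  have := ler_distD (a (n + k)%N) (a (n + k).+1) (a n); lra.
have low m n : a m - d m <= a n + d n.
  have [/subnKC E|/ltnW/subnKC E] := leqP m n.
    have := H (n - m)%N m; rewrite E ler_norml => /andP[h1 _].
    have := d0 n; lra.
  have := H (m - n)%N n; rewrite E ler_norml => /andP[_ h1].
  have := d0 m; lra.
pose Z := range (fun n => a n - d n).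
have supZ : has_sup Z.
  by split; [exists (a 0%N - d 0%N), 0%N|exists (a 0%N + d 0%N) => _ [n _ <-]].
exists (sup Z) => n; rewrite -/(d n) ler_distl; apply/andP; split.
  by apply: ub_le_sup supZ.2 _ _; exists n.
apply: ge_sup; first exact: supZ.1.
by move=> _ [m _ <-].
Qed.

Lemma Rintegral_expR (k t : R) : 0 < k -> 0 <= t ->
  \int[mu]_(r in `[0, t]) expR (k * r) = (expR (k * t) - 1) / k.
Proof.
move=> k0; rewrite le_eqVlt => /predU1P[<-|t0].
  by rewrite set_itv1 Rintegral_set1 mulr0 expR0 subrr mul0r.
have dF (z : R) : is_derive z 1 (fun r => expR (k * r) / k) (expR (k * z)).
  have D : is_derive z 1 (fun r => k * r) k.
    by apply: is_derive_eq; rewrite /GRing.scale/= mulr1.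
  have De := is_derive_expR (k * z).
  have Dc := @is_derive1_comp _ (@expR R) (fun r => k * r) z _ _ De D.
  apply: is_derive_eq; rewrite /GRing.scale/= mulr0 add0r.
  by field; rewrite gt_eqF.
have cF (z : R) : {for z, continuous (fun r => expR (k * r) / k)}.
  exact/differentiable_continuous/derivable1_diffP.
have cf : {within `[0, t], continuous (fun r => expR (k * r))}.
  apply: continuous_subspaceT => z.
  apply: continuous_comp; last exact: continuous_expR.
  exact: mulrl_continuous.
have := @continuous_FTC2 _ (fun r => expR (k * r)) (fun r => expR (k * r) / k) 0 t t0 cf.
rewrite /Rintegral => ->.
- by rewrite /= mulr0 expR0 mulrBl.
- split=> [z _||]; first by [].
    exact: (cvg_at_right_filter (cF _)).
  exact: (cvg_at_left_filter (cF _)).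
- by move=> z _; rewrite derive1E; exact: derive_val.
Qed.

Lemma lipschitz_within_continuous (A : set R) f K :
  (forall r t, A r -> A t -> r <= t -> `|f t - f r| <= K * (t - r)) ->
  {within A, continuous f}.
Proof.
move=> H; apply/within_continuousP => r Ar e e0.
have K0 : 0 < `|K| + 1 by rewrite ltr_wpDl.
exists (e / (`|K| + 1)); first by rewrite divr_gt0.
move=> t At rt.
suff : `|f r - f t| <= (`|K| + 1) * `|r - t|.
  by move=> h; apply: (le_lt_trans h); rewrite mulrC -ltr_pdivlMr.
have KK : K <= `|K| + 1 by have := ler_norm K; lra.
have [rt'|/ltW rt'] := leP r t.
  rewrite (distrC (f r)) (distrC r); apply: (le_trans (H _ _ Ar At rt')).
  by rewrite (@ger0_norm _ (t - r)) ?subr_ge0// ler_wpM2r// subr_ge0.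
apply: (le_trans (H _ _ At Ar rt')).
by rewrite (@ger0_norm _ (r - t)) ?subr_ge0// ler_wpM2r// subr_ge0.
Qed.

Lemma within_continuous_lipschitz_comp (A : set R) b f L : 0 < L ->
  (forall y z, `|b y - b z| <= L * `|y - z|) ->
  {within A, continuous f} -> {within A, continuous (b \o f)}.
Proof.
move=> L0 bL /within_continuousP cf; apply/within_continuousP => r Ar e e0.
have [|del del0 Hd] := cf r Ar (e / L); first by rewrite divr_gt0.
exists del => // t At rt; apply: le_lt_trans (bL _ _) _.
by rewrite mulrC -ltr_pdivlMr// Hd.
Qed.

Lemma Rintegral_itv_lipschitz f K s t : 0 <= s -> s <= t ->
  mu.-integrable `[0, t] (EFin \o f) -> (forall r, `|f r| <= K) ->
  `|\int[mu]_(r in `[0, t]) f r - \int[mu]_(r in `[0, s]) f r| <= K * (t - s).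
Proof.
move=> s0 st it fK.
have := @Rintegral_itvB _ f (BLeft 0) (BRight t) s it.
rewrite !bnd_simp => /(_ s0 st) ->.
have ist : mu.-integrable `]s, t] (EFin \o f).
  by apply: integrableS it => //; apply: subset_itv; rewrite bnd_simp.
have := @Rintegral_oc_approx _ f s t 0 K st ist.
rewrite mulr0 subr0 (mulrC K); apply => r _; rewrite subr0; exact: fK.
Qed.

Section existence.
Variables (b w : R -> R) (c x0 K L : R).
Hypotheses (L0 : 0 < L) (bL : forall y z : R, `|b y - b z| <= L * `|y - z|).
Hypotheses (K0 : 0 <= K) (bK : forall y, `|b y| <= K).
Hypothesis cw : {within `[0, +oo[, continuous w}.

(** The iteration acts on x - c w, which is Lipschitz in time however rough the path w is. *)
Fixpoint picard n : R -> R := if n is n'.+1 then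
    fun t => x0 + \int[mu]_(r in `[0, t]) b (picard n' r + c * w r)
  else cst x0.

Let cwT T : {within `[0, T], continuous w}.
Proof. by apply: continuous_subspaceW cw; apply: subset_itvl. Qed.

Let bint f T : {within `[0, T], continuous f} ->
  mu.-integrable `[0, T] (EFin \o (fun r => b (f r + c * w r))).
Proof.
move=> cf; apply: continuous_compact_integrable; first exact: segment_compact.
apply: (within_continuous_lipschitz_comp L0 bL) => r.
apply: cvgD; first exact: cf.
by apply: cvgM; [exact: cvg_cst|exact: cwT].
Qed.

Let pic_cont n T : {within `[0, T], continuous (picard n)}.
Proof.
elim: n T => [T r|n IH T]; first exact: cvg_cst.
apply: (@lipschitz_within_continuous _ _ K) => r t.
rewrite /= !in_itv/= => /andP[r0 rT] /andP[t0 tT] rt.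
rewrite opprD addrACA subrr add0r.
apply: (@Rintegral_itv_lipschitz (fun r => b (picard n r + c * w r))) => //.
exact: bint.
Qed.

Let pic_lip n r t : 0 <= r -> r <= t -> `|picard n t - picard n r| <= K * (t - r).
Proof.
case: n => [r0 rt|n r0 rt]; first by rewrite subrr normr0 mulr_ge0// subr_ge0.
rewrite /= opprD addrACA subrr add0r.
apply: (@Rintegral_itv_lipschitz (fun r => b (picard n r + c * w r))) => //.
exact/bint/pic_cont.
Qed.

(** In the weight e^(2 L t) the Picard map contracts by 1/2 on the whole half-line, so one geometric
    bound serves all times. The first increment is at most K t <= K / (2 L) e^(2 L t). *)
Let pic_cauchy n t : 0 <= t ->
  `|picard n.+1 t - picard n t| <= K / (2 * L) * expR (2 * L * t) / 2 ^+ n.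
Proof.
have L20 : 0 < 2 * L by rewrite mulr_gt0.
elim: n t => [|n IH] t t0.
  have := @Rintegral_itv_lipschitz (fun r => b (x0 + c * w r)) K 0 t (lexx _) t0.
  rewrite set_itv1 Rintegral_set1 !subr0.
  move=> /(_ (bint (@pic_cont 0%N t)) (fun r => bK _)) h.
  rewrite /= addrC addKr expr0 divr1; apply: (le_trans h).
  rewrite -mulrA ler_wpM2l// mulrC ler_pdivlMr// mulrC.
  by apply: le_trans (expR_ge1Dx _); rewrite lerDr.
set C := K / (2 * L).
rewrite [picard n.+2 t]/= [X in _ - X]/= opprD addrACA subrr add0r.
have i1 := bint (@pic_cont n.+1 t); have i0 := bint (@pic_cont n t).
rewrite -RintegralB//.
apply: (le_trans (le_normr_Rintegral _ _)) => //; first exact: (integrableB _ i1 i0).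
have ie : mu.-integrable `[0, t] (EFin \o (fun r => expR (2 * L * r))).
  apply: continuous_compact_integrable; first exact: segment_compact.
  apply: continuous_subspaceT => r.
  apply: continuous_comp; last exact: continuous_expR.
  exact: mulrl_continuous.
pose C' := L * (C / 2 ^+ n).
apply: (@le_trans _ _ (\int[mu]_(r in `[0, t]) (C' * expR (2 * L * r)))).
  apply: le_Rintegral => //.
  - exact: (integrable_norm (integrableB _ i1 i0)).
  - exact: (integrableZl _ _ ie).
  - move=> r; rewrite /= in_itv/= => /andP[r0 _].
    apply: (le_trans (bL _ _)).
    rewrite (_ : _ - _ = picard n.+1 r - picard n r); last by rewrite /=; ring.
    rewrite /C' -mulrA ler_pM2l//; apply: (le_trans (IH _ r0)).
    by rewrite -/C mulrAC.
rewrite RintegralZl// Rintegral_expR//.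
have C0 : 0 <= C by rewrite divr_ge0// ltW.
have -> : C' * ((expR (2 * L * t) - 1) / (2 * L)) = C * (expR (2 * L * t) - 1) / 2 ^+ n.+1.
  rewrite /C' exprS; field; rewrite !gt_eqF ?exprn_gt0//.
by rewrite ler_pM2r ?invr_gt0 ?exprn_gt0// ler_wpM2l//; lra.
Qed.

Lemma ode_solution_exists : exists x, forall T, ode_solution b c x0 w T x.
Proof.
pose C t := 2 * (K / (2 * L) * expR (2 * L * t)).
have C0 t : 0 <= C t by rewrite !mulr_ge0 ?invr_ge0 ?mulr_ge0 ?expR_ge0 ?(ltW L0).
have /choice[z zP] : forall t, exists l, 0 <= t ->
    forall n, `|l - picard n t| <= C t / 2 ^+ n.
  move=> t; have [t0|t0] := leP 0 t; last first.
    by exists 0.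
  have [l lP] := geometric_cauchy_lim (fun n => @pic_cauchy n t t0).
  by exists l => _ n; apply: lP.
have zlip r t : 0 <= r -> r <= t -> `|z t - z r| <= K * (t - r).
  move=> r0 rt; apply: (@le_add_geometric _ _ (C t + C r)); first exact: addr_ge0.
  move=> n; have := zP t (le_trans r0 rt) n; have := zP r r0 n.
  have := pic_lip n r0 rt; rewrite mulrDl.
  have := ler_distD (picard n t) (z t) (z r).
  have := ler_distD (picard n r) (picard n t) (z r).
  rewrite (distrC (picard n r) (z r)); lra.
have zc T : {within `[0, T], continuous z}.
  apply: (@lipschitz_within_continuous _ _ K) => r t.
  by rewrite /= !in_itv/= => /andP[r0 rT] /andP[t0 tT]; exact: zlip.
exists (fun t => z t + c * w t) => T; split.
  move=> r; apply: cvgD; first exact: zc.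
  by apply: cvgM; [exact: cvg_cst|exact: cwT].
move=> t /andP[t0 tT]; split; first exact: bint.
congr (_ + _).
apply/eqP; rewrite -subr_eq0 -normr_le0.
have D0 : 0 <= C t * (1 + L * t).
  by rewrite mulr_ge0// addr_ge0// mulr_ge0// ltW.
(* The two sides are compared through the iterate of rank n + 1: it is close to z by the rate of
   convergence, and close to the integral of z by the Lipschitz bound and the rate at rank n. *)
apply: (@le_add_geometric _ _ (C t * (1 + L * t))) => // n.
rewrite add0r.
have iz := bint (@zc t); have ip := bint (@pic_cont n t).
have h1 := zP t t0 n.+1.
have h2 : `|\int[mu]_(r in `[0, t]) b (picard n r + c * w r) -
    \int[mu]_(r in `[0, t]) b (z r + c * w r)| <= L * (C t / 2 ^+ n) * (t - 0).
  rewrite -RintegralB//.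
  apply: (le_trans (le_normr_Rintegral _ _)) => //; first exact: (integrableB _ ip iz).
  have ic : mu.-integrable `[0, t] (EFin \o cst (L * (C t / 2 ^+ n))).
    apply: continuous_compact_integrable; first exact: segment_compact.
    by move=> ?; apply: cvg_cst.
  apply: (@le_trans _ _ (\int[mu]_(r in `[0, t]) (cst (L * (C t / 2 ^+ n)) r))).
    apply: le_Rintegral => //; first exact: (integrable_norm (integrableB _ ip iz)).
    move=> r; rewrite /= in_itv/= => /andP[r0 rt].
    apply: (le_trans (bL _ _)); rewrite ler_pM2l//.
    rewrite (_ : _ - _ = - (z r - picard n r)); last by ring.
    rewrite normrN; apply: (le_trans (zP r r0 n)).
    rewrite ler_pM2r ?invr_gt0 ?exprn_gt0// /C ler_pM2l// ler_wpM2l//.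
      by rewrite divr_ge0// mulr_ge0// ltW.
    by rewrite ler_expR ler_pM2l// mulr_gt0.
  rewrite Rintegral_cst// [X in _ * X](_ : _ = t - 0)//.
  have := lebesgue_measure_itv (R:=R) `[0, t]; rewrite /= lte_fin.
  move: t0; rewrite le_eqVlt => /predU1P[<-|t0].
    by rewrite set_itv1 lebesgue_measure_set1 subrr.
  by rewrite t0 => ->.
rewrite /= in h1.
have E : C t / 2 ^+ n.+1 = C t / 2 ^+ n / 2 by rewrite exprS invfM mulrA mulrAC.
rewrite E subr0 in h1 h2.
have := ler_distD (x0 + \int[mu]_(r in `[0, t]) b (picard n r + c * w r)) (z t)
  (x0 + \int[mu]_(r in `[0, t]) b (z r + c * w r)).
move: h1 h2.
set I1 := \int[mu]_(r in _) b (picard _ _ + _).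
set I2 := \int[mu]_(r in _) b (z _ + _) => h1 h2.
rewrite (_ : x0 + I1 - (x0 + I2) = I1 - I2); last by ring.
have : 0 <= C t / 2 ^+ n by rewrite divr_ge0// exprn_ge0.
have -> : C t * (1 + L * t) / 2 ^+ n = C t / 2 ^+ n + L * (C t / 2 ^+ n) * t by ring.
lra.
Qed.

End existence.

End picard.

(** * Gaussian increments *)

Section gauss.
Context {R : realType}.
Implicit Types (f : R -> \bar R) (g : R -> R) (u x h : R).
Notation mu := (@lebesgue_measure R).

(** The Radon-Nikodym derivative and the explicit density have the same integral over every
    measurable set, hence agree almost everywhere. *)
Lemma integral_normal_prob (m s : R) f : measurable_fun setT f ->
  (forall x, 0 <= f x)%E ->
  (\int[normal_prob m s]_x f x = \int[mu]_x (f x * (normal_pdf m s x)%:E))%E.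
Proof.
move=> mf f0.
have dom := @normal_prob_dominates R m s.
rewrite -(Radon_Nikodym_SigmaFinite.change_of_variables dom)//.
apply: ae_eq_integral => //.
- apply: emeasurable_funM => //.
  exact: (measurable_int mu (Radon_Nikodym_SigmaFinite.f_integrable dom)).
- by apply: emeasurable_funM => //; apply/measurable_EFinP; exact: measurable_normal_pdf.
- apply: ae_eqe_mul2l; apply: integral_ae_eq => //.
  + exact: Radon_Nikodym_SigmaFinite.f_integrable.
  + by apply/measurable_EFinP; exact: measurable_normal_pdf.
  + by move=> E _ mE; rewrite -Radon_Nikodym_SigmaFinite.f_integral.
Qed.

(** Parametrised by the variance, which is the length of the time step. *)
Definition gauss_prob h := normal_prob (0 : R) (Num.sqrt h).

HB.instance Definition _ h := Probability.on (gauss_prob h).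

(** Completing the square turns e^(u x) times the centred density into a constant times the density
    of mean u h. *)
Lemma gauss_mgf h u : 0 < h ->
  (\int[gauss_prob h]_x (expR (u * x))%:E = (expR (u ^+ 2 * h / 2))%:E)%E.
Proof.
move=> h0.
have s0 : Num.sqrt h != 0 by rewrite sqrtr_eq0 -ltNge.
have mexp : measurable_fun setT (fun x => (expR (u * x))%:E).
  by apply/measurable_EFinP; apply: measurableT_comp => //; exact: measurable_funM.
have mpdf m s : measurable_fun setT (fun x : R => (normal_pdf m s x)%:E).
  by apply/measurable_EFinP; exact: measurable_normal_pdf.
rewrite integral_normal_prob//.
rewrite -[RHS]mule1 -(@integral_normal_pdf R (u * h) (Num.sqrt h)).
have pdf0 x : (0 <= (normal_pdf (u * h) (Num.sqrt h) x)%:E)%E by rewrite lee_fin normal_pdf_ge0.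
transitivity (\int[lebesgue_measure]_x ((expR (u ^+ 2 * h / 2))%:E *
    (normal_pdf (u * h) (Num.sqrt h) x)%:E))%E; last first.
  by apply: ge0_integralZl => //; exact: mpdf.
apply: eq_integral => x _; rewrite -!EFinM !normal_pdfE// /normal_fun; congr EFin.
rewrite mulrCA [RHS]mulrCA; congr (_ * _).
rewrite -!expRD sqr_sqrtr ?(ltW h0)//; congr expR.
by field; rewrite gt_eqF.
Qed.

Lemma gauss_integrable_exp h u : 0 < h ->
  (gauss_prob h).-integrable setT (EFin \o (fun x => expR (u * x))).
Proof.
move=> h0; apply/integrableP; split.
  by apply/measurable_EFinP; apply: measurableT_comp => //; exact: measurable_funM.
under eq_integral do rewrite /= ger0_norm ?expR_ge0//.
by rewrite gauss_mgf// ltry.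
Qed.

Lemma gauss_integrable_bounded h g u C : 0 < h -> measurable_fun setT g ->
  (forall x, `|g x| <= C * (expR (u * x) + expR (- u * x))) ->
  (gauss_prob h).-integrable setT (EFin \o g).
Proof.
move=> h0 mg gC.
have i : (gauss_prob h).-integrable setT
    (EFin \o (fun x => C * (expR (u * x) + expR (- u * x)))).
  apply: (integrableZl _ C (integrableD _ (gauss_integrable_exp u h0)
    (gauss_integrable_exp (- u) h0))) => //.
apply: (le_integrable _ _ _ i) => //; first exact/measurable_EFinP.
by move=> x _ /=; rewrite lee_fin (le_trans (gC x))// ler_norm.
Qed.

Lemma gauss_Rmgf h u : 0 < h ->
  \int[gauss_prob h]_x expR (u * x) = expR (u ^+ 2 * h / 2).
Proof. by move=> h0; rewrite /Rintegral gauss_mgf. Qed.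

Lemma gauss_RintegralZD h u C : 0 < h ->
  \int[gauss_prob h]_x (C * (expR (u * x) + expR (- u * x))) =
    2 * C * expR (u ^+ 2 * h / 2).
Proof.
move=> h0; have i1 := gauss_integrable_exp u h0; have i2 := gauss_integrable_exp (- u) h0.
rewrite RintegralZl//; last exact: (integrableD _ i1 i2).
by rewrite RintegralD// !gauss_Rmgf// sqrrN; ring.
Qed.

Lemma expRD_scale u x : `|u| <= 1 -> expR (u * x) + expR (- (u * x)) <= 2 * (expR x + expR (- x)).
Proof.
move=> u1.
suff H y : `|y| <= `|x| -> expR y <= expR x + expR (- x).
  have hx : `|u * x| <= `|x| by rewrite normrM ler_piMl.
  have := H _ hx; have := H (- (u * x)); rewrite normrN => /(_ hx); lra.
move=> yx; have : expR y <= expR `|x| by rewrite ler_expR (le_trans (ler_norm _)).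
have := expR_ge0 x; have := expR_ge0 (- x).
by have [x0|x0] := ger0P x; lra.
Qed.

(* From |x|^3 <= 6 (e^x + e^-x) scaled by h^(-1/2), and the value e^(1/2) of the
   moment generating function. *)
Definition gauss_c3 : R := 12 * expR (2^-1).

Lemma gauss_integrable_moments h : 0 < h ->
  [/\ (gauss_prob h).-integrable setT (EFin \o (fun x => x)),
      (gauss_prob h).-integrable setT (EFin \o (fun x => x ^+ 2)) &
      (gauss_prob h).-integrable setT (EFin \o (fun x => `|x| ^+ 3))].
Proof.
move=> h0.
have m3 : measurable_fun setT (fun x : R => `|x| ^+ 3).
  by apply: measurable_funX; exact: normr_measurable.
have H x : `|x| ^+ 3 <= 6 * (expR (1 * x) + expR (- 1 * x)).
  by rewrite mul1r mulN1r normrX3_le_expR.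
have H2 x : 2 <= expR (1 * x) + expR (- 1 * x).
  have := expR_ge1Dx (1 * x); have := expR_ge1Dx (- 1 * x); lra.
have bnd k x : (k <= 3)%N -> `|x| ^+ k <= 7 * (expR (1 * x) + expR (- 1 * x)).
  move=> k3; apply: (@le_trans _ _ (1 + `|x| ^+ 3)); last by have := H x; have := H2 x; lra.
  have [x1|/ltW x1] := leP `|x| 1.
    by apply: (le_trans (exprn_ile1 _ _ x1)) => //; rewrite lerDl exprn_ge0.
  by apply: (le_trans (ler_weXn2l x1 k3)); rewrite lerDr.
split.
- by apply: gauss_integrable_bounded (bnd 1%N ^~ _).
- apply: (gauss_integrable_bounded h0 (u := 1) (C := 7)); first exact: measurable_funX.
  by move=> x; rewrite normrX; exact: bnd.
- apply: (gauss_integrable_bounded h0 m3 (u := 1) (C := 7)).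
  by move=> x; rewrite normrX normr_id; exact: bnd.
Qed.

Lemma gauss_moment3 h : 0 < h ->
  \int[gauss_prob h]_x (`|x| ^+ 3) <= gauss_c3 * (h * Num.sqrt h).
Proof.
move=> h0; have s0 : 0 < Num.sqrt h by rewrite sqrtr_gt0.
have [_ _ i3] := gauss_integrable_moments h0.
set s := Num.sqrt h in s0 *.
have sh : s ^+ 2 = h by rewrite sqr_sqrtr// ltW.
apply: (@le_trans _ _ (\int[gauss_prob h]_x (6 * s ^+ 3 * (expR (s^-1 * x) + expR (- s^-1 * x))))).
  apply: le_Rintegral => //.
    apply: (integrableZl _ _ (integrableD _ (gauss_integrable_exp s^-1 h0)
      (gauss_integrable_exp (- s^-1) h0))) => //.
  move=> x _; have := normrX3_le_expR (s^-1 * x).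
  rewrite normrM exprMn ger0_norm ?invr_ge0 ?(ltW s0)// exprVn mulrC.
  rewrite ler_pdivrMr ?exprn_gt0// mulNr => H; apply: le_trans H _.
  by rewrite mulrAC.
rewrite gauss_RintegralZD// exprVn sh mulVf ?gt_eqF// div1r /gauss_c3.
by rewrite -sh le_eqVlt; apply/orP; left; apply/eqP; ring.
Qed.

(** The moments are read off from the moment generating function: both of its expansions at u = 0
    agree up to O(|u|^3), the values at u and - u separate m1 from m2 - h, and u tends to 0. *)
Lemma gauss_moment12 h : 0 < h ->
  \int[gauss_prob h]_x x = 0 /\ \int[gauss_prob h]_x (x ^+ 2) = h.
Proof.
move=> h0; have [i1 i2 i3] := gauss_integrable_moments h0.
set m1 := \int[gauss_prob h]_x x; set m2 := \int[gauss_prob h]_x (x ^+ 2).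
have icst k : (gauss_prob h).-integrable setT (EFin \o cst k).
  exact: finite_measure_integrable_cst.
(* A bound, uniform in |u| <= 1, for |x|^3 (e^(u x) + e^(- u x)): it equals 12 (e^x + e^-x)^2, the
   product of 6 (e^x + e^-x) and 2 (e^x + e^-x). *)
pose q x : R := 12 * (2 + (expR (2 * x) + expR (- 2 * x))).
have iq : (gauss_prob h).-integrable setT (EFin \o q).
  exact: (integrableZl _ 12 (integrableD _ (icst 2) (integrableD _
    (gauss_integrable_exp 2 h0) (gauss_integrable_exp (- 2) h0)))).
pose Q := \int[gauss_prob h]_x q x.
have bound u : `|u| <= 1 ->
    `|expR (u ^+ 2 * h / 2) - (1 + u * m1 + u ^+ 2 / 2 * m2)| <= `|u| ^+ 3 * Q.
  move=> u1.
  have ie := gauss_integrable_exp u h0.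
  have ip : (gauss_prob h).-integrable setT (EFin \o (fun x => 1 + u * x + u ^+ 2 / 2 * x ^+ 2)).
    exact: (integrableD _ (integrableD _ (icst 1) (integrableZl _ u i1)) (integrableZl _ (u ^+ 2 / 2) i2)).
  have -> : 1 + u * m1 + u ^+ 2 / 2 * m2 = \int[gauss_prob h]_x (1 + u * x + u ^+ 2 / 2 * x ^+ 2).
    rewrite RintegralD//; last 2 first.
      exact: (integrableD _ (icst 1) (integrableZl _ u i1)).
      exact: (integrableZl _ (u ^+ 2 / 2) i2).
    rewrite RintegralD//; [|exact: icst|exact: (integrableZl _ u i1)].
    rewrite !RintegralZl// -/m1 -/m2; congr (_ + _ + _).
    rewrite Rintegral_cst// mul1r.
    exact: (esym (congr1 fine (@probability_setT _ _ _ (gauss_prob h)))).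
  rewrite -gauss_Rmgf// -RintegralB//.
  apply: (le_trans (le_normr_Rintegral _ _)) => //; first exact: (integrableB _ ie ip).
  rewrite /Q -RintegralZl//; apply: le_Rintegral => //.
  - exact: (integrable_norm (integrableB _ ie ip)).
  - exact: (integrableZl _ _ iq).
  - move=> x _.
    have := normr_expR_taylor2 (u * x).
    have -> : 1 + u * x + (u * x) ^+ 2 / 2 = 1 + u * x + u ^+ 2 / 2 * x ^+ 2 by ring.
    rewrite normrM (exprMn _ `|u|).
    move=> H; apply: le_trans H _; rewrite -mulrA ler_wpM2l ?exprn_ge0//.
    apply: (@le_trans _ _ (6 * (expR x + expR (- x)) * (2 * (expR x + expR (- x))))).
      rewrite ler_pM ?exprn_ge0 ?addr_ge0 ?expR_ge0//; first exact: normrX3_le_expR.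
      exact: expRD_scale.
    have -> : q x = 12 * (expR x + expR (- x)) ^+ 2.
      rewrite /q; have -> : 2 * x = x + x by ring.
      have -> : - 2 * x = - x + - x by ring.
      rewrite !expRD expRN; have : expR x != 0 by rewrite gt_eqF ?expR_gt0.
      by move: (expR x) => e e0; field.
    by rewrite le_eqVlt; apply/orP; left; apply/eqP; ring.
have Q0 : 0 <= Q.
  by apply: Rintegral_ge0 => x _; rewrite mulr_ge0// !addr_ge0 ?expR_ge0.
have [C C0 bound2] : exists2 C, 0 <= C & forall u, `|u| <= 1 ->
    `|u * m1 + u ^+ 2 / 2 * (m2 - h)| <= `|u| ^+ 3 * C.
  (* Bounds the remainder of e^v at v = u^2 h / 2 beyond 1 + v; the powers |u|^4 and |u|^6 that
     arise are at most |u|^3. *)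
  pose D := (h / 2) ^+ 2 / 2 + (h / 2) ^+ 3 * (2 * (expR h + expR (- h))).
  have D0 : 0 <= D.
    by rewrite addr_ge0 ?divr_ge0 ?mulr_ge0 ?addr_ge0 ?expR_ge0 ?exprn_ge0// ?divr_ge0// ltW.
  exists (Q + D); first exact: addr_ge0.
  move=> u u1; have := bound u u1.
  set v := u ^+ 2 * h / 2.
  have uv : v = `|u| ^+ 2 * (h / 2) by rewrite real_normK ?num_real// /v; ring.
  have v0 : 0 <= v by rewrite uv mulr_ge0 ?sqr_ge0// divr_ge0// ltW.
  have vh : `|v| <= `|h|.
    rewrite !ger0_norm// ?(ltW h0)// uv.
    have : `|u| ^+ 2 <= 1 by rewrite exprn_ile1.
    have : 0 <= h by exact: ltW.
    nra.
  have h2 : `|expR v - (1 + v)| <= `|u| ^+ 3 * D.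
    have := normr_expR_taylor2 v.
    have e2 : expR v + expR (- v) <= 2 * (expR h + expR (- h)).
      have := @expRD_scale (v / h) h; rewrite divfK ?gt_eqF//; apply.
      by rewrite normrM normfV ler_pdivrMr ?normr_gt0 ?gt_eqF// mul1r.
    have h3 : `|v| ^+ 3 <= `|u| ^+ 3 * (h / 2) ^+ 3.
      rewrite ger0_norm// uv exprMn ler_wpM2r ?exprn_ge0 ?divr_ge0// ?(ltW h0)//.
      by rewrite -exprM ler_wiXn2l.
    have h4 : v ^+ 2 / 2 <= `|u| ^+ 3 * ((h / 2) ^+ 2 / 2).
      rewrite mulrA ler_pM2r// uv exprMn ler_wpM2r ?sqr_ge0//.
      by rewrite -exprM ler_wiXn2l.
    have h5 : `|v| ^+ 3 * (expR v + expR (- v)) <=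
       `|u| ^+ 3 * (h / 2) ^+ 3 * (2 * (expR h + expR (- h))).
      by rewrite ler_pM ?exprn_ge0 ?addr_ge0 ?expR_ge0.
    have : 0 <= v ^+ 2 / 2 by rewrite divr_ge0 ?sqr_ge0.
    rewrite /D mulrDr mulrA => h6.
    have -> : expR v - (1 + v + v ^+ 2 / 2) = (expR v - (1 + v)) - v ^+ 2 / 2 by ring.
    have := ler_distD (v ^+ 2 / 2) (expR v - (1 + v)) 0.
    rewrite !subr0 (ger0_norm h6); lra.
  have -> : u * m1 + u ^+ 2 / 2 * (m2 - h) = (expR v - (1 + v)) -
     (expR v - (1 + u * m1 + u ^+ 2 / 2 * m2)) by rewrite /v; ring.
  have := ler_normB (expR v - (1 + v)) (expR v - (1 + u * m1 + u ^+ 2 / 2 * m2)).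
  rewrite mulrDr; lra.
have pos u : 0 < u -> u <= 1 -> `|m1| <= C * u /\ `|m2 - h| <= 2 * C * u.
  move=> u0 u1.
  have nu : `|u| = u by rewrite gtr0_norm.
  have := bound2 u; rewrite nu => /(_ u1) b1.
  have := bound2 (- u); rewrite normrN nu sqrrN mulNr => /(_ u1) b2.
  set a := u * m1 in b1 b2; set b := u ^+ 2 / 2 * (m2 - h) in b1 b2.
  have na : `|a| <= u ^+ 3 * C.
    have -> : a = ((a + b) - (- a + b)) / 2 by field.
    rewrite normrM (@ger0_norm _ 2^-1)//.
    have := ler_normB (a + b) (- a + b); lra.
  have nb : `|b| <= u ^+ 3 * C.
    have -> : b = ((a + b) + (- a + b)) / 2 by field.
    rewrite normrM (@ger0_norm _ 2^-1)//.
    have := ler_normD (a + b) (- a + b); lra.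
  split.
    move: na; rewrite /a normrM nu exprS -mulrA ler_pM2l// => H.
    apply: le_trans H _; rewrite mulrC ler_wpM2l// expr2 ler_piMl// ltW//.
  move: nb; rewrite /b normrM (@gtr0_norm _ (u ^+ 2 / 2)) ?divr_gt0 ?exprn_gt0// => H.
  have {}H : u ^+ 2 * `|m2 - h| <= u ^+ 2 * (2 * C * u).
    by move: H; rewrite exprS; lra.
  by rewrite ler_pM2l ?exprn_gt0 in H.
have zero (a D : R) : 0 <= D -> (forall u, 0 < u -> u <= 1 -> `|a| <= D * u) -> a = 0.
  move=> D0 H; apply/eqP; rewrite -normr_le0; apply/ler_addgt0Pr => e e0.
  rewrite add0r; have D1 : 0 < D + 1 by lra.
  have := H (Num.min 1 (e / (D + 1))).
  rewrite lt_min ltr01 divr_gt0// ge_min lexx => /(_ isT isT) K.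
  apply: le_trans K _; apply: (@le_trans _ _ ((D + 1) * (e / (D + 1)))).
    rewrite ler_pM// ?le_min ?ler01 ?divr_ge0 ?(ltW e0) ?(ltW D1)//; first by lra.
    by rewrite ge_min lexx orbT.
  by rewrite mulrCA divff ?mulr1// gt_eqF.
split.
  by apply: (zero _ C) => // u u0 u1; have [] := pos u u0 u1.
apply/eqP; rewrite -subr_eq0; apply/eqP; apply: (zero _ (2 * C)).
  by rewrite mulr_ge0.
by move=> u u0 u1; have [] := pos u u0 u1.
Qed.

End gauss.

Section taylor_step.
Context {R : realType}.
Implicit Types (f : R -> R) (u x h p q C K Q b c : R).

(** Error of one step divided by h: the drift part of the quadratic term, and the cubic remainder
    split by |r + s|^3 <= 4 (|r|^3 + |s|^3). Its slowest term is of order sqrt h. *)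
Definition step_error C K Q c h : R :=
  Q * K ^+ 2 * h / 2 + 4 * C * (K ^+ 3 * h ^+ 2 + `|c| ^+ 3 * gauss_c3 * Num.sqrt h).

(** A supermartingale estimate only asks for an upper expansion of f. The terms linear in z
    integrate to 0, so the slope p may be unbounded, and z^2 yields the second-order part of the
    generator. *)
Lemma gauss_taylor_step f x p q C K Q b c h : 0 < h -> 0 <= C ->
  measurable_fun setT f -> (forall y, 0 <= f y) ->
  (forall y, f y <= f x + p * (y - x) + q / 2 * (y - x) ^+ 2 + C * `|y - x| ^+ 3) ->
  `|b| <= K -> `|q| <= Q ->
  (\int[gauss_prob h]_z (f (x + (h * b + c * z)))%:E <=
   (f x + h * (p * b + c ^+ 2 / 2 * q) + h * step_error C K Q c h)%:E)%E.
Proof.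
move=> h0 C0 mf f0 ft bK qQ.
have [i1 i2 i3] := gauss_integrable_moments h0.
have [m1 m2] := gauss_moment12 h0.
have m3 := gauss_moment3 h0.
have icst k : (gauss_prob h).-integrable setT (EFin \o cst k).
  exact: finite_measure_integrable_cst.
pose a0 := f x + p * (h * b) + q / 2 * (h * b) ^+ 2 + 4 * C * `|h * b| ^+ 3.
pose a1 := p * c + q * (h * b) * c.
pose a2 := q / 2 * c ^+ 2.
pose a3 := 4 * C * `|c| ^+ 3.
pose P z := a0 + a1 * z + a2 * z ^+ 2 + a3 * `|z| ^+ 3.
have fP z : f (x + (h * b + c * z)) <= P z.
  apply: (le_trans (ft _)).
  rewrite (_ : x + (h * b + c * z) - x = h * b + c * z); last by ring.
  set A := h * b.
  have cube : `|A + c * z| ^+ 3 <= 4 * (`|A| ^+ 3 + `|c| ^+ 3 * `|z| ^+ 3).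
    rewrite -exprMn -normrM.
    apply: (@le_trans _ _ ((`|A| + `|c * z|) ^+ 3)).
      by rewrite lerXn2r ?nnegrE ?addr_ge0// ler_normD.
    move: (normr_ge0 A) (normr_ge0 (c * z)).
    move: `|A| `|c * z| => r s r0 s0.
    rewrite -subr_ge0.
    have -> : 4 * (r ^+ 3 + s ^+ 3) - (r + s) ^+ 3 = 3 * (r + s) * (r - s) ^+ 2 by ring.
    by apply: mulr_ge0; [apply: mulr_ge0 => //; exact: addr_ge0|exact: sqr_ge0].
  have := ler_wpM2l C0 cube.
  rewrite /P /a0 /a1 /a2 /a3 -/A.
  lra.
have e1 : (gauss_prob h).-integrable setT (EFin \o (fun z => a1 * z)).
  exact: (integrableZl _ a1 i1).
have e2 : (gauss_prob h).-integrable setT (EFin \o (fun z => a2 * z ^+ 2)).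
  exact: (integrableZl _ a2 i2).
have e3 : (gauss_prob h).-integrable setT (EFin \o (fun z => a3 * `|z| ^+ 3)).
  exact: (integrableZl _ a3 i3).
have iP1 : (gauss_prob h).-integrable setT (EFin \o (fun z => a0 + a1 * z)).
  exact: (integrableD _ (icst a0) e1).
have iP2 : (gauss_prob h).-integrable setT (EFin \o (fun z => a0 + a1 * z + a2 * z ^+ 2)).
  exact: (integrableD _ iP1 e2).
have iP : (gauss_prob h).-integrable setT (EFin \o P).
  exact: (integrableD _ iP2 e3).
apply: (@le_trans _ _ (\int[gauss_prob h]_z (P z)%:E)%E).
  apply: ge0_le_integral => //.
  - by move=> z _; rewrite lee_fin.
  - apply/measurable_EFinP; apply: measurableT_comp => //.
    by apply: measurable_funD => //; apply: measurable_funD => //; exact: measurable_funM.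
  - exact: (measurable_int _ iP).
  - by move=> z _; rewrite lee_fin.
have -> : (\int[gauss_prob h]_z (P z)%:E)%E = (\int[gauss_prob h]_z (P z))%:E.
  by rewrite fineK// integrable_fin_num.
rewrite lee_fin /P RintegralD// RintegralD//.
rewrite RintegralD//; [|exact: icst].
rewrite (RintegralZl a1)// (RintegralZl a2)// (RintegralZl a3)// m1 m2.
have -> : \int[gauss_prob h]_z cst a0 z = a0.
  rewrite Rintegral_cst//.
  rewrite -[RHS]mulr1; congr (_ * _).
  exact: (congr1 fine (@probability_setT _ _ _ (gauss_prob h))).
have a30 : 0 <= a3 by rewrite !mulr_ge0// exprn_ge0.
have := ler_wpM2l a30 m3.
have hh : 0 <= h by exact: ltW.
have K0 : 0 <= K by exact: le_trans bK.
have b2 : q / 2 * (h * b) ^+ 2 <= Q * (h * K) ^+ 2 / 2.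
  have hb : (h * b) ^+ 2 <= (h * K) ^+ 2.
    rewrite -real_normK ?num_real// lerXn2r ?nnegrE ?mulr_ge0//.
    by rewrite normrM ger0_norm// ler_wpM2l.
  have q1 : q * (h * b) ^+ 2 <= `|q| * (h * b) ^+ 2.
    by rewrite ler_wpM2r ?sqr_ge0// ler_norm.
  have q2 : `|q| * (h * b) ^+ 2 <= Q * (h * K) ^+ 2 by rewrite ler_pM ?sqr_ge0.
  lra.
have b3 : 4 * C * `|h * b| ^+ 3 <= 4 * C * (h * K) ^+ 3.
  rewrite ler_wpM2l ?mulr_ge0// lerXn2r ?nnegrE ?mulr_ge0//.
  by rewrite normrM ger0_norm// ler_wpM2l.
rewrite /a0 /a2 /a3 /step_error.
set M := `|c| ^+ 3; set s := Num.sqrt h.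
set I3 := \int[_]_z _.
have -> : 4 * C * M * (gauss_c3 * (h * s)) = h * (4 * C * (M * gauss_c3 * s)) by ring.
move: b2 b3; rewrite !exprMn; lra.
Qed.

End taylor_step.

(** * Lyapunov estimates for Euler chains of a Wiener process *)

Section sub_sigma_algebra.
Context {dT : measure_display} {T : measurableType dT} {R : realType}.
Implicit Types (G : set (set T)) (X D : T -> R).

Lemma sub_measurable_funP G X : sigma_algebra setT G ->
  measurable_fun [set: g_sigma_algebraType G] (X : g_sigma_algebraType G -> R) <->
  forall B : set R, measurable B -> G (X @^-1` B).
Proof.
move=> sG; split=> [mX B mB|H _ B mB].
  by have := mX measurableT B mB; rewrite setTI /measurable/= sigma_algebra_id.
by rewrite setTI /measurable/= sigma_algebra_id//; exact: H.
Qed.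

(** The product formula on rectangles identifies the joint law of X and D with the product law,
    after which integrating out D is Tonelli's theorem. *)
Lemma indep_integral {d1 d2} {T1 : measurableType d1} {T2 : measurableType d2}
    (P : probability T R) (nu : probability T2 R) G (X : T -> T1) (D : T -> T2)
    (phi : T1 * T2 -> \bar R) :
  G `<=` measurable -> measurable_fun setT D ->
  (forall B, measurable B -> G (X @^-1` B)) ->
  (forall A B, G A -> measurable B -> P (A `&` D @^-1` B) = (P A * nu B)%E) ->
  measurable_fun setT phi -> (forall z, 0 <= phi z)%E ->
  (\int[P]_w phi (X w, D w) = \int[P]_w \int[nu]_z phi (X w, z))%E.
Proof.
move=> GM mD GX ind mphi phi0.
have mX : measurable_fun setT X.
  by move=> _ B mB; rewrite setTI; apply: GM; exact: GX.
have mXD : measurable_fun setT (fun w => (X w, D w)) by exact: measurable_fun_pair.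
pose X' : {mfun T >-> T1} := HB.pack X (isMeasurableFun.Build _ _ _ _ _ mX).
pose XD' : {mfun T >-> (T1 * T2)%type} := HB.pack (fun w => (X w, D w))
  (isMeasurableFun.Build _ _ _ _ _ mXD).
transitivity (\int[distribution P XD']_z phi z)%E.
  by rewrite ge0_integral_pushforward// preimage_setT.
transitivity (\int[distribution P X' \x nu]_z phi z)%E.
  apply: eq_measure_integral => S mS _; symmetry.
  apply: (product_measure_unique (m' := distribution P XD')) => // A B mA mB.
  by rewrite /distribution /pushforward -ind//; exact: GX.
rewrite fubini_tonelli1// ge0_integral_pushforward//.
- exact: measurable_fun_fubini_tonelli_F.
- by move=> x _; apply: integral_ge0.
Qed.

End sub_sigma_algebra.

Lemma integral_cst_prob {d} {T : measurableType d} {R : realType} (P : probability T R) (k : R) :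
  (\int[P]_w k%:E = k%:E)%E.
Proof.
rewrite integral_cst// -[RHS]mule1; congr (_ * _)%E; exact: probability_setT.
Qed.

Section chain_expectation.
Context {dT : measure_display} {T : measurableType dT} {R : realType}.
Variables (P : probability T R) (F : R -> set (set T)) (W : R -> T -> R).
Hypothesis hW : wiener P F W.
Variables (I : set R) (b : R -> R) (c h x0 : R).
Hypotheses (mI : measurable I) (mb : measurable_fun setT b) (h0 : 0 < h).

Let X k w := chain I b c h x0 (W ^~ w) k.

Let hk_ge0 (k : nat) : 0 <= h * k%:R. Proof. by rewrite mulr_ge0// ltW. Qed.

Lemma wiener_sigma_algebra t : 0 <= t -> sigma_algebra setT (F t).
Proof. by case: hW => -[+ _] _ _ _ _ => /[apply] -[]. Qed.

Lemma wiener_sub_measurable t : 0 <= t -> F t `<=` measurable.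
Proof. by case: hW => -[+ _] _ _ _ _ => /[apply] -[]. Qed.

Lemma wiener_filtration_le s t : 0 <= s -> s <= t -> F s `<=` F t.
Proof. by case: hW => -[_ +] _ _ _ _; apply. Qed.

Lemma wiener_measurable t : 0 <= t -> measurable_fun setT (W t).
Proof.
move=> t0 _ B mB; rewrite setTI; apply: (wiener_sub_measurable t0).
by have [_ aW _ _ _] := hW; exact: aW.
Qed.

Lemma chain_adapted k (B : set R) : measurable B -> F (h * k%:R) (X k @^-1` B).
Proof.
have fin n := @wiener_sigma_algebra (h * n%:R) (hk_ge0 n).
have mW n m : (n <= m)%N -> measurable_fun
    [set: g_sigma_algebraType (F (h * m%:R))] (W (h * n%:R) : g_sigma_algebraType (F (h * m%:R)) -> R).
  move=> nm; apply/sub_measurable_funP => // A mA.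
  apply: wiener_filtration_le (hk_ge0 n) _ _ _.
    by rewrite ler_pM2l// ler_nat.
  by have [_ aW _ _ _] := hW; exact: aW.
suff : measurable_fun [set: g_sigma_algebraType (F (h * k%:R))]
    (X k : g_sigma_algebraType (F (h * k%:R)) -> R).
  by move/sub_measurable_funP; apply.
elim: k {B} => [|k IH]; first exact: measurable_cst.
have mX : measurable_fun [set: g_sigma_algebraType (F (h * k.+1%:R))]
    (X k : g_sigma_algebraType (F (h * k.+1%:R)) -> R).
  apply/sub_measurable_funP => // A mA.
  apply: wiener_filtration_le (hk_ge0 k) _ _ _.
    by rewrite ler_pM2l// ler_nat.
  by apply: (proj1 (sub_measurable_funP _ (fin k)) IH).
apply: measurable_funD => //; apply: measurable_funM.
  by apply: measurableT_comp => //; exact: measurable_indic.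
apply: measurable_funD; first by apply: measurable_funM => //; exact: measurableT_comp.
by apply: measurable_funM => //; apply: measurable_funB; apply: mW.
Qed.

Lemma chain_measurable k : measurable_fun setT (X k).
Proof.
move=> _ B mB; rewrite setTI; apply: wiener_sub_measurable (hk_ge0 k) _ _.
exact: chain_adapted.
Qed.

Lemma chain_preimage_measurable k (B : set R) : measurable B ->
  measurable [set w | B (X k w)].
Proof. by move=> mB; have := chain_measurable k measurableT mB; rewrite setTI. Qed.

Variables (f l : R -> R) (e : R).
Hypotheses (mf : measurable_fun setT f) (f0 : forall x, 0 <= f x).
Hypotheses (ml : measurable_fun setT l) (l0 : forall x, 0 <= l x).
Hypothesis (e0 : 0 <= e).
Hypothesis step : forall x, I x ->
  (\int[gauss_prob h]_z (f (x + (h * b x + c * z)))%:E + (h * l x)%:E <= (f x + e)%:E)%E.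

(** Inside I this is [step] averaged over the independent increment. Outside I the chain is frozen
    and the indicator switches the dissipation off, so e >= 0 is enough. *)
Lemma chain_step k :
  (\int[P]_w (f (X k.+1 w))%:E + \int[P]_w (h * (\1_I (X k w) * l (X k w)))%:E
   <= \int[P]_w (f (X k w))%:E + e%:E)%E.
Proof.
have mX := chain_measurable k.
pose D w := W (h * k.+1%:R) w - W (h * k%:R) w.
have hS : h * k.+1%:R - h * k%:R = h by rewrite -mulrBr -natrB// subSnn mulr1.
have mD : measurable_fun setT D by apply: measurable_funB; exact: wiener_measurable.
pose phi (z : R * measurableTypeR R) : \bar R :=
  (f (z.1 + \1_I z.1 * (h * b z.1 + c * z.2)))%:E.
have mphi : measurable_fun setT phi.
  apply/measurable_EFinP; apply: measurableT_comp => //.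
  apply: measurable_funD => //; apply: measurable_funM.
    by apply: measurableT_comp => //; exact: measurable_indic.
  apply: measurable_funD; first by apply: measurable_funM => //; exact: measurableT_comp.
  by apply: measurable_funM.
have E : (\int[P]_w (f (X k.+1 w))%:E = \int[P]_w \int[gauss_prob h]_z phi (X k w, z))%E.
  rewrite -(@indep_integral _ _ _ _ _ _ _ P (gauss_prob h) (F (h * k%:R)) (X k) D phi)//.
  - exact: wiener_sub_measurable.
  - by move=> B mB; exact: chain_adapted.
  - move=> A B FA mB.
    have [_ _ _ _ /(_ (h * k%:R) (h * k.+1%:R) (hk_ge0 k))] := hW.
    rewrite ltr_pM2l// ltr_nat ltnSn => /(_ isT B mB)[PD].
    by move=> /(_ A FA); rewrite PD hS => ->.
  - by move=> z; rewrite lee_fin.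
have phi0 z : (0 <= phi z)%E by rewrite lee_fin.
have gphi0 x : (0 <= \int[gauss_prob h]_z phi (x, z))%E.
  by apply: integral_ge0 => z _; exact: phi0.
have mgphi : measurable_fun setT (fun w => \int[gauss_prob h]_z phi (X k w, z))%E.
  have mF : measurable_fun setT (fun x : R => \int[gauss_prob h]_z phi (x, z))%E.
    exact: (measurable_fun_fubini_tonelli_F (m2 := gauss_prob h) phi mphi phi0).
  exact: (measurableT_comp mF mX).
have l10 x : 0 <= h * (\1_I x * l x) by rewrite !mulr_ge0// ltW.
have ml1 : measurable_fun setT (fun w => (h * (\1_I (X k w) * l (X k w)))%:E).
  apply/measurable_EFinP; apply: measurable_funM => //; apply: measurable_funM => //.
    by apply: measurableT_comp => //; exact: measurable_indic.
  exact: measurableT_comp.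
have mfX : measurable_fun setT (fun w => (f (X k w))%:E).
  by apply/measurable_EFinP; exact: measurableT_comp.
rewrite E -ge0_integralD//; last by move=> w _; rewrite lee_fin.
rewrite -(integral_cst_prob P e).
rewrite -ge0_integralD//; last by move=> w _; rewrite lee_fin.
apply: ge0_le_integral => //.
- by move=> w _; rewrite adde_ge0// lee_fin.
- exact: emeasurable_funD.
- exact: emeasurable_funD.
- move=> w _; rewrite /phi/= indicE; have [IX|IX] := boolP (X k w \in I).
    rewrite mul1r; under eq_integral do rewrite mul1r.
    by apply: step; rewrite inE in IX.
  rewrite mul0r mulr0 adde0; under eq_integral do rewrite mul0r addr0.
  rewrite (integral_cst_prob (gauss_prob h)).
  by rewrite lee_fin lerDl.
Qed.

(** Finiteness propagates from the deterministic start by the one-step inequality itself; from here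
    on the estimates are sums of real numbers. *)
Lemma chain_moments : exists A D : nat -> R, A 0%N = f x0 /\ forall k,
  [/\ (\int[P]_w (f (X k w))%:E = (A k)%:E)%E,
      (\int[P]_w (h * (\1_I (X k w) * l (X k w)))%:E = (D k)%:E)%E,
      0 <= A k, 0 <= D k & A k.+1 + D k <= A k + e].
Proof.
pose EA k := (\int[P]_w (f (X k w))%:E)%E.
pose ED k := (\int[P]_w (h * (\1_I (X k w) * l (X k w)))%:E)%E.
have EA0 k : (0 <= EA k)%E by apply: integral_ge0 => w _; rewrite lee_fin.
have ED0 k : (0 <= ED k)%E.
  by apply: integral_ge0 => w _; rewrite lee_fin !mulr_ge0// ltW.
have EA00 : EA 0%N = (f x0)%:E.
  have H := integral_cst_prob P (f x0); exact: H.
have st k : (EA k.+1 + ED k <= EA k + e%:E)%E by exact: chain_step.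
have fin k : EA k \is a fin_num.
  elim: k => [|k IH]; first by rewrite EA00.
  rewrite ge0_fin_numE//; apply: (@le_lt_trans _ _ (EA k + e%:E)%E).
    by apply: le_trans (st k); rewrite leeDl.
  by rewrite lte_add_pinfty ?ltry// -ge0_fin_numE.
have finD k : ED k \is a fin_num.
  rewrite ge0_fin_numE//; apply: (@le_lt_trans _ _ (EA k + e%:E)%E).
    by apply: le_trans (st k); rewrite leeDr.
  by rewrite lte_add_pinfty ?ltry// -ge0_fin_numE.
exists (fine \o EA), (fine \o ED); split; first by rewrite /= EA00.
move=> k; split; rewrite /= ?fine_ge0//.
- by rewrite fineK.
- by rewrite fineK.
- have := st k; rewrite -{1}(fineK (fin k.+1)) -{1}(fineK (finD k)) -{1}(fineK (fin k)).
  by rewrite -!EFinD lee_fin.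
Qed.

Lemma markov_le (B : set T) (u : T -> R) (q : R) : measurable B ->
  measurable_fun setT u -> (forall w, 0 <= u w) -> 0 <= q ->
  (forall w, B w -> q <= u w) -> (q%:E * P B <= \int[P]_w (u w)%:E)%E.
Proof.
move=> mB mu u0 q0 qu.
rewrite -integral_cst//; apply: (@le_trans _ _ (\int[P]_(w in B) (u w)%:E)%E).
  apply: ge0_le_integral => //.
  by apply/measurable_EFinP; exact: measurable_funTS.
apply: ge0_subset_integral => //; first exact/measurable_EFinP.
by move=> w _; rewrite lee_fin.
Qed.

(** Freezing makes any earlier exit visible at time n, so Markov's inequality at that single time
    does the work of a maximal inequality. *)
Lemma chain_exit_prob q n : 0 <= q -> (forall y, ~ I y -> q <= f y) ->
  (q%:E * P [set w | ~ I (X n w)] <= (f x0 + n%:R * e)%:E)%E.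
Proof.
move=> q0 qf; have [A [D [A0 H]]] := chain_moments.
have [EA _ _ _ _] := H n.
apply: (@le_trans _ _ (\int[P]_w (f (X n w))%:E)%E).
  apply: markov_le => //; last by move=> w; exact: qf.
    exact: (chain_preimage_measurable n (measurableC mI)).
  exact: measurableT_comp (chain_measurable n).
rewrite EA lee_fin -A0; elim: n {EA} => [|n IH]; first by rewrite mul0r addr0.
have [_ _ _ D0 AD] := H n; rewrite -natr1 mulrDl mul1r; lra.
Qed.

(* As long as the chain is in I, either l is at least eta, which the summed
   dissipation limits, or f is at least phi, which the mean of f limits. *)
Lemma chain_stay_prob eta phi M n : 0 < eta -> 0 < phi -> (0 < n)%N ->
  (forall y, I y -> y <= M -> eta <= l y) -> (forall y, I y -> M < y -> phi <= f y) ->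
  (P [set w | I (X n w)] <=
    ((f x0 + n%:R * e) * ((n%:R * h * eta)^-1 + phi^-1))%:E)%E.
Proof.
move=> eta0 phi0 n0 le fp; have [A [D [A0 H]]] := chain_moments.
pose S k := [set w | I (X k w)].
pose S1 k := [set w | I (X k w) /\ X k w <= M].
pose S2 k := [set w | I (X k w) /\ M < X k w].
have mpre k (B : set R) : measurable B -> measurable [set w | B (X k w)].
  exact: chain_preimage_measurable.
have mS1 k : measurable (S1 k).
  by apply: (mpre k (I `&` [set` `]-oo, M]])); exact: measurableI.
have mS2 k : measurable (S2 k).
  have := mpre k _ (measurableI _ _ mI (measurable_itv `]M, +oo[)).
  by congr (measurable _); apply/seteqP; split => w; rewrite /S2/= in_itv/= andbT.
have mS k : measurable (S k) by exact: mpre.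
have AF k : (k <= n)%N -> A k <= f x0 + n%:R * e.
  move=> kn; apply: (@le_trans _ _ (f x0 + k%:R * e)); last first.
    by rewrite lerD2l ler_wpM2r// ler_nat.
  rewrite -A0; elim: k {kn} => [|k IH]; first by rewrite mul0r addr0.
  have [_ _ _ D0 AD] := H k; rewrite -natr1 mulrDl mul1r; lra.
set F0 := f x0 + n%:R * e in AF *.
pose p := fine (P (S n)).
have pE : P (S n) = p%:E by rewrite fineK// fin_num_measure.
have key k : (k < n)%N -> h * eta * p <= D k + h * eta * (F0 / phi).
  move=> kn; have [EA ED _ _ _] := H k.
  have i1 : ((h * eta)%:E * P (S1 k) <= (D k)%:E)%E.
    rewrite -ED; apply: markov_le => //.
    - apply: measurable_funM => //; apply: measurable_funM => //.
        apply: measurableT_comp (chain_measurable k); exact: measurable_indic.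
      exact: measurableT_comp (chain_measurable k).
    - by move=> w; rewrite !mulr_ge0// ltW.
    - by rewrite mulr_ge0// ltW.
    - move=> w [IX XM]; rewrite indicE mem_set// mul1r ler_pM2l//; exact: le.
  have i2 : (phi%:E * P (S2 k) <= (A k)%:E)%E.
    rewrite -EA; apply: markov_le => //.
    - exact: measurableT_comp (chain_measurable k).
    - exact: ltW.
    - by move=> w [IX XM]; exact: fp.
  have i3 : (P (S n) <= P (S1 k) + P (S2 k))%E.
    apply: (@le_trans _ _ (P (S1 k `|` S2 k))).
      apply: le_measure; rewrite ?inE//; first exact: measurableU.
      move=> w /= IXn.
      (* A chain outside I at time k is frozen there and would still be outside I at time n. *)
      have IXk : I (X k w).
        apply: contrapT => nI; apply: nI; apply: contrapT => nI.
        by move: IXn; rewrite /S/= /X (chain_stopped (ltnW kn) nI).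
      by have [XM|XM] := leP (X k w) M; [left|right].
    exact: measureU2.
  have f1 : P (S1 k) \is a fin_num by rewrite fin_num_measure.
  have f2 : P (S2 k) \is a fin_num by rewrite fin_num_measure.
  move: i1 i2 i3; rewrite pE -(fineK f1) -(fineK f2) -EFinD -!EFinM !lee_fin.
  set p1 := fine _; set p2 := fine _ => i1 i2 i3.
  have i4 : p2 <= F0 / phi.
    by rewrite ler_pdivlMr// mulrC (le_trans i2)// AF// ltnW.
  have he : 0 < h * eta by rewrite mulr_gt0.
  have : h * eta * p <= h * eta * (p1 + p2) by rewrite ler_pM2l.
  have : h * eta * p2 <= h * eta * (F0 / phi) by rewrite ler_pM2l.
  lra.
have sum k : (k <= n)%N -> k%:R * (h * eta * p) + A k <= f x0 + k%:R * e + k%:R * (h * eta * (F0 / phi)).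
  elim: k => [_|k IH kn]; first by rewrite !mul0r A0 add0r !addr0.
  have [_ _ _ _ AD] := H k; have := IH (ltnW kn); have := key k kn.
  rewrite -natr1 !mulrDl !mul1r; lra.
have := sum n (leqnn n); have [_ _ An _ _] := H n.
rewrite -/F0 => sm.
have nhe : 0 < n%:R * h * eta by rewrite !mulr_gt0// ltr0n.
rewrite -/(S n) pE lee_fin mulrDr -(ler_pM2l nhe) mulrDr mulrCA divff ?gt_eqF// mulr1.
lra.
Qed.

End chain_expectation.

(** * Passage to the limit in the mesh *)

Section grid.
Context {R : realType}.
Implicit Types (w x : R -> R).

Lemma mesh_lt (T del : R) : 0 < del -> exists N, forall n, (N <= n)%N -> T / n.+1%:R < del.
Proof.
move=> del0; exists (Num.bound (T / del)) => n Nn.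
rewrite ltr_pdivrMr ?ltr0n// mulrC -ltr_pdivrMr//.
apply: (lt_le_trans (unstable.ltr_bound _)).
by rewrite ler_nat (leq_trans Nn).
Qed.

(** Being outside the closed set I is an open condition, so an exit at t0 is shared by the chain at
    the last grid point before t0 once the mesh is fine. *)
Lemma chain_exit_eventually (I : set R) b c (x0 : R) w T x L t0 : closed I -> 0 < T -> 0 < L ->
  (forall y z : R, `|b y - b z| <= L * `|y - z|) ->
  w 0 = 0 -> ode_solution b c x0 w T x -> 0 <= t0 <= T -> ~ I (x t0) ->
  exists N, forall n, (N <= n)%N -> ~ I (chain I b c (T / n.+1%:R) x0 w n.+1).
Proof.
move=> cI T0 L0 bL w0 xsol /andP[t00 t0T] It0.
have : nbhs (x t0) (~` I) by apply: open_nbhs_nbhs; split => //; exact: closed_openC.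
move=> /nbhs_ballP[e /= e0 eI].
have e20 : 0 < e / 2 by rewrite divr_gt0.
have [d1 d10 H1] := chain_cvg L0 bL w0 xsol e20.
have [d2 d20 H2] : exists2 del, 0 < del & forall y, `[0, T]%classic y -> `|t0 - y| < del -> `|x t0 - x y| < e / 2.
  by have [/within_continuousP cx _] := xsol; apply: cx => //; rewrite /= in_itv/= t00.
have [N HN] := @mesh_lt T (Num.min d1 d2) (ltac:(by rewrite lt_min d10)).
exists N => n Nn; set h := T / n.+1%:R.
have h0 : 0 < h by rewrite divr_gt0// ltr0n.
have hnT : h * n.+1%:R = T by rewrite /h divfK// gt_eqF// ltr0n.
have := HN n Nn; rewrite lt_min -/h => /andP[hd1 hd2].
pose k := Num.truncn (t0 / h).
have /truncn_itv : 0 <= t0 / h by rewrite divr_ge0// ltW.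
rewrite -/k => /andP[k1 k2].
have hk : h * k%:R <= t0 by rewrite mulrC -ler_pdivlMr.
have hk' : t0 < h * k.+1%:R by rewrite mulrC -ltr_pdivrMr.
have kn : (k <= n.+1)%N.
  by rewrite -(ler_nat R) -(ler_pM2l h0) hnT (le_trans hk).
suff yball : ball (x t0) e (chain setT b c h x0 w k).
  exact: (@chain_exit _ I b c h x0 w k n.+1 kn (eI _ yball)).
change (`|x t0 - chain setT b c h x0 w k| < e).
have := H1 h n.+1; rewrite h0 hd1 hnT => /(_ isT (lexx _) k kn) a1.
have := H2 (h * k%:R); rewrite /= in_itv/= (le_trans hk t0T) mulr_ge0 ?(ltW h0)// => /(_ isT).
rewrite ger0_norm ?subr_ge0// => a2.
have {}a2 : `|x t0 - x (h * k%:R)| < e / 2.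
  apply: a2; apply: lt_trans hd2; rewrite ltrBlDr.
  by move: hk'; rewrite -natr1 mulrDr mulr1 addrC.
have := ler_distD (x (h * k%:R)) (x t0) (chain setT b c h x0 w k).
rewrite (distrC (x (h * k%:R)) (chain _ _ _ _ _ _ _)); lra.
Qed.

(** The gap between a' and a absorbs the error of the scheme. *)
Lemma chain_stay_eventually b c (x0 : R) w T x L (a a' : R) : 0 < T -> 0 < L -> a' < a ->
  (forall y z : R, `|b y - b z| <= L * `|y - z|) ->
  w 0 = 0 -> ode_solution b c x0 w T x -> (forall t, 0 <= t <= T -> a <= x t) ->
  exists N, forall n, (N <= n)%N ->
    a' <= chain [set y | a' <= y] b c (T / n.+1%:R) x0 w n.+1.
Proof.
move=> T0 L0 aa bL w0 xsol xa.
have e0 : 0 < a - a' by rewrite subr_gt0.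
have [d1 d10 H1] := chain_cvg L0 bL w0 xsol e0.
have [N HN] := @mesh_lt T d1 d10.
exists N => n Nn; set h := T / n.+1%:R.
have h0 : 0 < h by rewrite divr_gt0// ltr0n.
have hnT : h * n.+1%:R = T by rewrite /h divfK// gt_eqF// ltr0n.
apply: (@chain_stay _ [set y | a' <= y]) => k kn /=.
have := H1 h n.+1; rewrite h0 HN// hnT => /(_ isT (lexx _) k kn).
have := xa (h * k%:R); rewrite mulr_ge0 ?(ltW h0)//= -[X in _ <= X]hnT ler_pM2l// ler_nat kn => /(_ isT).
rewrite ltr_norml => ? /andP[? _]; lra.
Qed.

End grid.

Section small_sets.
Context {dT : measure_display} {T : measurableType dT} {R : realType}.
Variables (P : probability T R).

(** Fatou's lemma for sets: D is the lim inf of the events, an increasing union of their tail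
    intersections. *)
Lemma liminf_prob (E : nat -> set T) (q : R) : (forall n, measurable (E n)) ->
  (forall e, 0 < e -> exists N, forall n, (N <= n)%N -> (P (E n) <= (q + e)%:E)%E) ->
  exists D, [/\ measurable D, (P D <= q%:E)%E &
    forall w, (exists N, forall n, (N <= n)%N -> E n w) -> D w].
Proof.
move=> mE Eq; pose G m := \bigcap_(n in [set n | (m <= n)%N]) E n.
have mG m : measurable (G m) by apply: bigcap_measurable => //; exists m => /=.
exists (\bigcup_m G m); split.
- exact: bigcup_measurable.
- have ndG : nondecreasing_seq G.
    move=> m n mn; apply/subsetPset => w Gw k /= nk; apply: Gw => /=.
    exact: leq_trans nk.
  have /cvg_lim <- // := nondecreasing_cvg_mu (mu := P) mG (bigcup_measurable (fun m _ => mG m)) ndG.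
  apply: lime_le.
    by apply: ereal_nondecreasing_is_cvgn => m n mn; apply: le_measure; rewrite ?inE//; apply/subsetPset; exact: ndG.
  apply: nearW => m /=; apply/lee_addgt0Pr => e e0.
  have [N HN] := Eq e e0; rewrite -EFinD; apply: le_trans (HN (maxn m N) (leq_maxr _ _)).
  apply: le_measure; rewrite ?inE//.
  by apply: bigcap_inf => /=; exact: leq_maxl.
- by move=> w [N HN]; exists N.
Qed.

Lemma ae_small (Q : T -> Prop) : (forall e : R, 0 < e -> exists D, [/\ measurable D,
   (P D <= e%:E)%E & {ae P, forall w, ~ D w -> Q w}]) -> {ae P, forall w, Q w}.
Proof.
move=> H.
have /choice[D DP] : forall n : nat, exists D, [/\ measurable D,
   (P D <= (n.+1%:R^-1)%:E)%E & {ae P, forall w, ~ D w -> Q w}].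
  by move=> n; apply: H; rewrite invr_gt0 ltr0n.
have mN : measurable (\bigcap_n D n) by apply: bigcap_measurable => // n _; have [] := DP n.
have N0 : P (\bigcap_n D n) = 0%E.
  apply/eqP; rewrite -measure_le0; apply/lee_addgt0Pr => e e0; rewrite add0e.
  have [N HN] := @mesh_lt _ 1 e e0.
  have [mD PD _] := DP N.
  apply: (@le_trans _ _ (P (D N))).
    by apply: le_measure; rewrite ?inE//; exact: bigcap_inf.
  apply: (le_trans PD); rewrite lee_fin.
  by have := HN N (leqnn _); rewrite div1r => /ltW.
rewrite /prop_near1 /= /nbhs/= /almost_everywhere.
apply: (@negligibleS _ _ _ _ (\bigcap_n D n `|` \bigcup_n ~` [set w | ~ D n w -> Q w])).
  move=> w /= nQ; have [wD|wD] := pselect ((\bigcap_n D n) w); [by left|right].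
  have [n nD] : exists n, ~ D n w.
    apply: contrapT => K; apply: wD => n _; apply: contrapT => K2; apply: K; by exists n.
  by exists n => // K; exact: nQ (K nD).
apply: negligibleU; first by exists (\bigcap_n D n); split.
by apply: negligible_bigcup => n; have [_ _] := DP n.
Qed.

End small_sets.

Lemma lipschitz_measurable_fun {R : realType} (b : R -> R) (L : R) : 0 < L ->
  (forall y z, `|b y - b z| <= L * `|y - z|) -> measurable_fun setT b.
Proof.
move=> L0 bL; apply: continuous_measurable_fun => y.
have /within_continuousP h : {within [set: R], continuous b}.
  have -> : b = b \o id by [].
  apply: (within_continuous_lipschitz_comp L0 bL).
  by apply: continuous_subspaceT => z; exact: cvg_id.
apply/cvgrPdist_lt => e e0; have [del del0 H] := h y I e e0.
by apply/nbhs_ballP; exists del => // z yz; exact: H.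
Qed.

Section limits.
Context {dT : measure_display} {T : measurableType dT} {R : realType}.
Variables (P : probability T R) (F : R -> set (set T)) (W : R -> T -> R).
Hypothesis hW : wiener P F W.
Variables (b : R -> R) (c x0 L : R).
Hypotheses (L0 : 0 < L) (bL : forall y z : R, `|b y - b z| <= L * `|y - z|).
Variables (Te : R) (x : T -> R -> R).
Hypothesis Te0 : 0 < Te.
Hypothesis xsol : {ae P, forall w, ode_solution b c x0 (W ^~ w) Te (x w)}.

Let mb : measurable_fun setT b.
Proof. exact: lipschitz_measurable_fun bL. Qed.

Let W0 : {ae P, forall w, W 0 w = 0}. Proof. by have [] := hW. Qed.

(** The exceptional event D is built from the chains alone, which makes it measurable although x is
    an arbitrary choice of solutions path by path. *)
Lemma exit_prob_limit (I : set R) (f : R -> R) (gam q : R) : closed I ->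
  measurable_fun setT f -> (forall y, 0 <= f y) -> 0 <= gam -> 0 < q ->
  (forall y, ~ I y -> q <= f y) ->
  (forall e, 0 < e -> exists2 del, 0 < del & forall h, 0 < h < del -> forall y, I y ->
    (\int[gauss_prob h]_z (f (y + (h * b y + c * z)))%:E <= (f y + h * (gam + e))%:E)%E) ->
  exists D, [/\ measurable D, (P D <= ((f x0 + Te * gam) / q)%:E)%E &
    {ae P, forall w, ~ D w -> forall t, 0 <= t <= Te -> I (x w t)}].
Proof.
move=> cI mf f0 gam0 q0 qf H.
have mI : measurable I by exact: closed_measurable.
pose h n := Te / n.+1%:R.
have h0 n : 0 < h n by rewrite divr_gt0// ltr0n.
have hn n : n.+1%:R * h n = Te by rewrite mulrC /h divfK// gt_eqF// ltr0n.
pose E n := [set w | ~ I (chain I b c (h n) x0 (W ^~ w) n.+1)].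
have mE n : measurable (E n).
  exact: (chain_preimage_measurable hW c x0 mI mb (h0 n) n.+1 (measurableC mI)).
have [D [mD PD ED]] : exists D, [/\ measurable D, (P D <= ((f x0 + Te * gam) / q)%:E)%E &
    forall w, (exists N, forall n, (N <= n)%N -> E n w) -> D w].
  apply: liminf_prob => // e e0.
  (* This slack adds up to e q over n + 1 steps of mesh Te / (n + 1), and the division by q leaves
     e. *)
  have e1 : 0 < e * q / Te by rewrite divr_gt0// mulr_gt0.
  have [del del0 Hd] := H _ e1.
  have [N HN] := mesh_lt Te del0.
  exists N => n Nn.
  have hd : 0 < h n < del by rewrite h0 HN.
  have he0 : 0 <= h n * (gam + e * q / Te).
    by apply: mulr_ge0; [exact: ltW|rewrite addr_ge0// ltW].
  have step y : I y -> (\int[gauss_prob (h n)]_z (f (y + (h n * b y + c * z)))%:E +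
      (h n * cst 0 y)%:E <= (f y + h n * (gam + e * q / Te))%:E)%E.
    by move=> Iy; rewrite /= mulr0 adde0; exact: Hd.
  have := @chain_exit_prob _ _ _ _ _ _ hW I b c (h n) x0 mI mb (h0 n) f (cst 0) _ mf f0
    (measurable_cst (0 : R)) (fun _ => lexx _) he0 step q n.+1 (ltW q0) qf.
  rewrite -/(E n) mulrA hn => HE.
  have fE : P (E n) \is a fin_num by rewrite fin_num_measure.
  rewrite -(fineK fE) lee_fin; move: HE; rewrite -(fineK fE) -EFinM lee_fin => HE.
  rewrite -(ler_pM2l q0); apply: (le_trans HE).
  rewrite le_eqVlt; apply/orP; left; apply/eqP.
  by field; rewrite !gt_eqF.
exists D; split => //.
apply: filterS2 xsol W0 => w xw W0w nD t tT.
apply: contrapT => It; apply: nD; apply: ED.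
exact: (chain_exit_eventually cI Te0 L0 bL W0w xw tT It).
Qed.

Lemma stay_prob_limit (f l : R -> R) (a a' eta phi M : R) : a' < a ->
  measurable_fun setT f -> (forall y, 0 <= f y) ->
  measurable_fun setT l -> (forall y, 0 <= l y) -> 0 < eta -> 0 < phi ->
  (forall y, a' <= y -> y <= M -> eta <= l y) -> (forall y, a' <= y -> M < y -> phi <= f y) ->
  (forall e, 0 < e -> exists2 del, 0 < del & forall h, 0 < h < del -> forall y, a' <= y ->
    (\int[gauss_prob h]_z (f (y + (h * b y + c * z)))%:E + (h * l y)%:E <= (f y + h * e)%:E)%E) ->
  exists D, [/\ measurable D, (P D <= (f x0 * ((Te * eta)^-1 + phi^-1))%:E)%E &
    {ae P, forall w, (forall t, 0 <= t <= Te -> a <= x w t) -> D w}].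
Proof.
move=> aa mf f0 ml l0 eta0 phi0 le fp H.
pose I := [set y : R | a' <= y].
have mI : measurable I.
  have -> : I = [set` `[a', +oo[] by apply/seteqP; split => y; rewrite /= in_itv/= andbT.
  exact: measurable_itv.
pose h n := Te / n.+1%:R.
have h0 n : 0 < h n by rewrite divr_gt0// ltr0n.
have hn n : n.+1%:R * h n = Te by rewrite mulrC /h divfK// gt_eqF// ltr0n.
pose E n := [set w | I (chain I b c (h n) x0 (W ^~ w) n.+1)].
have mE n : measurable (E n).
  exact: (chain_preimage_measurable hW c x0 mI mb (h0 n) n.+1 mI).
pose S := (Te * eta)^-1 + phi^-1.
have S0 : 0 < S by rewrite addr_gt0// invr_gt0// mulr_gt0.
have [D [mD PD ED]] : exists D, [/\ measurable D, (P D <= (f x0 * S)%:E)%E &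
    forall w, (exists N, forall n, (N <= n)%N -> E n w) -> D w].
  apply: liminf_prob => // e e0.
  (* Over the total time Te this slack adds e / S to the mean of f, hence e to the bound. *)
  have e1 : 0 < e / (Te * S) by rewrite divr_gt0// mulr_gt0.
  have [del del0 Hd] := H _ e1.
  have [N HN] := mesh_lt Te del0.
  exists N => n Nn.
  have hd : 0 < h n < del by rewrite h0 HN.
  have he0 : 0 <= h n * (e / (Te * S)) by apply: mulr_ge0; exact: ltW.
  have := @chain_stay_prob _ _ _ _ _ _ hW I b c (h n) x0 mI mb (h0 n) f l _ mf f0 ml l0 he0
    (Hd _ hd) eta phi M n.+1 eta0 phi0 (ltn0Sn _) le fp.
  rewrite -/(E n) mulrA hn -/S => HE; apply: (le_trans HE); rewrite lee_fin.
  rewrite le_eqVlt; apply/orP; left; apply/eqP.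
  by field; rewrite !gt_eqF.
exists D; split => //.
apply: filterS2 xsol W0 => w xw W0w xa; apply: ED.
exact: (chain_stay_eventually Te0 L0 aa bL W0w xw xa).
Qed.

End limits.

Section taylor_condition.
Context {R : realType}.

Lemma step_error_small (C K Q c e : R) : 0 <= C -> 0 <= K -> 0 <= Q -> 0 < e ->
  exists2 del, 0 < del & forall h, 0 < h < del -> step_error C K Q c h <= e.
Proof.
move=> C0 K0 Q0 e0.
have c3 : 0 <= gauss_c3 :> R by rewrite mulr_ge0// expR_ge0.
(* For h <= 1 both h and h^2 are at most sqrt h, so the error is at most S sqrt h; the summand 1
   makes S positive. *)
pose S : R := Q * K ^+ 2 / 2 + 4 * C * (K ^+ 3 + `|c| ^+ 3 * gauss_c3) + 1.
have A0 : 0 <= Q * K ^+ 2 / 2 by rewrite divr_ge0// mulr_ge0// sqr_ge0.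
have B0 : 0 <= 4 * C * K ^+ 3 by rewrite !mulr_ge0// exprn_ge0.
have D0 : 0 <= 4 * C * (`|c| ^+ 3 * gauss_c3) by rewrite !mulr_ge0// exprn_ge0.
have S0 : 0 < S by rewrite /S mulrDr; lra.
exists (Num.min 1 ((e / S) ^+ 2)); first by rewrite lt_min ltr01 exprn_gt0// divr_gt0.
move=> h /andP[h0]; rewrite lt_min => /andP[h1 h2].
pose s := Num.sqrt h.
have s0 : 0 < s by rewrite sqrtr_gt0.
have sh : s ^+ 2 = h by rewrite sqr_sqrtr// ltW.
have s1 : s <= 1 by rewrite -(ler_pXn2r (n := 2)) ?nnegrE// ?(ltW s0)// sh expr1n ltW.
have se : s <= e / S.
  by rewrite -(ler_pXn2r (n := 2)) ?nnegrE ?divr_ge0 ?(ltW s0) ?(ltW S0) ?(ltW e0)// sh ltW.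
have hs : h <= s by rewrite -sh expr2 ler_piMl// ltW.
have hhs : h ^+ 2 <= s.
  by apply: le_trans hs; rewrite expr2 ler_piMl// ltW.
apply: (@le_trans _ _ (S * s)); last by rewrite mulrC -ler_pdivlMr.
rewrite /step_error -/s /S.
have := ler_wpM2l A0 hs; have := ler_wpM2l B0 hhs.
have : 0 <= s by exact: ltW.
set K3 := K ^+ 3; set c3' := `|c| ^+ 3 * gauss_c3.
have -> : Q * K ^+ 2 * h / 2 = Q * K ^+ 2 / 2 * h by ring.
lra.
Qed.

(** Turns the infinitesimal inequality p b + c^2 q / 2 <= gam - l into the one-step inequality of
    the chain. The bounds K, Q and C are what makes the mesh threshold uniform in y. *)
Lemma taylor_step_condition (I : set R) (f b p q l : R -> R) (C K Q c gam : R) :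
  0 <= C -> 0 <= K -> 0 <= Q -> measurable_fun setT f -> (forall y, 0 <= f y) ->
  (forall y, `|b y| <= K) -> (forall y, I y -> `|q y| <= Q) ->
  (forall y z, I y -> f z <= f y + p y * (z - y) + q y / 2 * (z - y) ^+ 2 + C * `|z - y| ^+ 3) ->
  (forall y, I y -> p y * b y + c ^+ 2 / 2 * q y <= gam - l y) ->
  forall e, 0 < e -> exists2 del, 0 < del & forall h, 0 < h < del -> forall y, I y ->
    (\int[gauss_prob h]_z (f (y + (h * b y + c * z)))%:E + (h * l y)%:E <=
      (f y + h * (gam + e))%:E)%E.
Proof.
move=> C0 K0 Q0 mf f0 bK qQ ft gen e e0.
have [del del0 Hd] := step_error_small c C0 K0 Q0 e0.
exists del => // h hd y Iy; have /andP[h0 _] := hd.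
have := @gauss_taylor_step _ f y (p y) (q y) C K Q (b y) c h h0 C0 mf f0
  (fun z => ft y z Iy) (bK y) (qQ y Iy).
move=> H; apply: (le_trans (leeD H (lexx _))).
rewrite -EFinD lee_fin.
have := Hd h hd; rewrite -(ler_pM2l h0) => H1.
have := gen y Iy; rewrite -(ler_pM2l h0) => H2.
lra.
Qed.

End taylor_condition.

(** * Brownian motion with positive drift *)

Section brownian_drift.
Context {dT : measure_display} {T : measurableType dT} {R : realType}.
Variables (P : probability T R) (F : R -> set (set T)) (W : R -> T -> R).
Hypothesis hW : wiener P F W.
Notation mu := (@lebesgue_measure R).

Lemma Rintegral_cst0 (k t : R) : 0 <= t -> \int[mu]_(r in `[0, t]) k = k * t.
Proof.
move=> t0; rewrite Rintegral_cst//; congr (_ * _).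
have := lebesgue_measure_itv (R:=R) `[0, t]; rewrite /= lte_fin.
move: t0; rewrite le_eqVlt => /predU1P[<-|t0].
  by rewrite set_itv1 lebesgue_measure_set1.
by rewrite t0 => -> /=; rewrite subr0.
Qed.

Lemma integrable_cst0 (k t : R) : mu.-integrable `[0, t] (EFin \o cst k).
Proof.
apply: continuous_compact_integrable; first exact: segment_compact.
by move=> ?; apply: cvg_cst.
Qed.

(** The rate lam = 2 kap / c^2 is the nonzero root of - lam kap + c^2 lam^2 / 2 = 0. The mean of exp
    (- lam y) is then exactly preserved by each step, so the bound carries no term growing with the
    horizon. *)
Lemma brownian_drift_ge (c kap eta : R) : 0 < c -> 0 < kap -> 0 < eta ->
  exists D, [/\ measurable D, (P D <= (expR (- (2 * kap / c ^+ 2 * eta)))%:E)%E &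
    {ae P, forall w, ~ D w -> forall t, 0 <= t -> - eta <= kap * t + c * W t w}].
Proof.
move=> c0 kap0 eta0; pose lam := 2 * kap / c ^+ 2.
have lam0 : 0 < lam by rewrite divr_gt0 ?mulr_gt0// exprn_gt0.
have cW : {ae P, forall w, {within `[0, +oo[, continuous (W ^~ w)}} by have [] := hW.
pose x (w : T) t := kap * t + c * W t w.
have xsol (Te : R) : {ae P, forall w, ode_solution (cst kap) c 0 (W ^~ w) Te (x w)}.
  apply: filterS cW => w cWw; split.
    move=> t; apply: cvgD.
      have /continuous_subspaceT h : continuous ( *%R kap) by exact: mulrl_continuous.
      exact: h.
    apply: cvgM; first exact: cvg_cst.
    by apply: (continuous_subspaceW _ cWw); exact: subset_itvl.
  move=> t /andP[t0 _]; split; first exact: integrable_cst0.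
  by rewrite add0r Rintegral_cst0.
pose f y := expR (- lam * y).
have mf : measurable_fun setT f.
  by apply: measurableT_comp => //; exact: measurable_funM.
pose I := [set y : R | - eta <= y].
have cI : closed I by exact: closed_ge.
have /choice[D HD] : forall n : nat, exists D, [/\ measurable D,
    (P D <= (expR (- (lam * eta)))%:E)%E &
    {ae P, forall w, ~ D w -> forall t, 0 <= t <= n.+1%:R -> I (x w t)}].
  move=> n.
  have [||||||D [mD PD HD]] := @exit_prob_limit _ _ _ P F W hW (cst kap) c 0 1 ltr01 _ n.+1%:R x
    (ltr0Sn _ n) (xsol _) I f 0 (expR (lam * eta)) cI mf.
  - by move=> y z; rewrite subrr normr0 mul1r.
  - by move=> y; exact: expR_ge0.
  - by [].
  - exact: expR_gt0.
  - move=> y /negP; rewrite -ltNge => ye; rewrite ler_expR mulNr -mulrN ler_pM2l// lerNr.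
    exact: ltW.
  - move=> e e0; exists 1 => // h /andP[h0 _] y _.
    have E z : f (y + (h * kap + c * z)) = expR (- lam * (y + h * kap)) * expR (- lam * c * z).
      by rewrite -expRD; congr expR; ring.
    under eq_integral do rewrite E EFinM.
    rewrite ge0_integralZl//; last first.
    + by apply/measurable_EFinP; apply: measurableT_comp => //; exact: measurable_funM.
    rewrite gauss_mgf// -EFinM lee_fin -expRD.
    have -> : - lam * (y + h * kap) + (- lam * c) ^+ 2 * h / 2 = - lam * y.
      by rewrite /lam; field; rewrite gt_eqF.
    by rewrite lerDl add0r mulr_ge0// ltW.
  exists D; split => //; apply: (le_trans PD).
  by rewrite lee_fin mulr0 addr0 /f mulr0 expR0 div1r -expRN.
(* The bound is the same for all horizons n + 1, so it survives the lim inf of the exceptional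
   events. A path outside D' avoids D n for arbitrarily large n, which covers every time. *)
have [D' [mD' PD' ED']] : exists D', [/\ measurable D', (P D' <= (expR (- (lam * eta)))%:E)%E &
    forall w, (exists N, forall n, (N <= n)%N -> D n w) -> D' w].
  apply: liminf_prob; first by move=> n; have [] := HD n.
  move=> e e0; exists 0%N => n _; have [_ PD _] := HD n.
  by apply: (le_trans PD); rewrite lee_fin lerDl ltW.
exists D'; split => //.
have : {ae P, forall w, forall n, ~ D n w -> forall t, 0 <= t <= n.+1%:R -> I (x w t)}.
  by apply/ae_foralln => n; have [] := HD n.
apply: filterS => w Hw nD t t0; apply: contrapT => It; apply: nD; apply: ED'.
exists (Num.bound t) => n tn; apply: contrapT => nDn; apply: It.
apply: (Hw n nDn); rewrite t0/= ltW// (lt_le_trans (unstable.ltr_bound _))//.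
by rewrite ler_nat (leq_trans tn).
Qed.

Lemma brownian_drift_bounded_below (c kap : R) : 0 < c -> 0 < kap ->
  {ae P, forall w, exists C, forall t, 0 <= t -> - C <= kap * t + c * W t w}.
Proof.
move=> c0 kap0; apply: ae_small => e e0.
pose lam := 2 * kap / c ^+ 2.
have lam0 : 0 < lam by rewrite divr_gt0 ?mulr_gt0// exprn_gt0.
(* With this level the probability is at most e^(- 1 / e), and e^(1 / e) >= 1 / e. *)
have eta0 : 0 < (e * lam)^-1 by rewrite invr_gt0 mulr_gt0.
have [D [mD PD HD]] := brownian_drift_ge c0 kap0 eta0.
exists D; split => //; last by apply: filterS HD => w Hw nD; exists (e * lam)^-1; exact: Hw.
apply: (le_trans PD); rewrite lee_fin -/lam.
have -> : lam * (e * lam)^-1 = e^-1 by field; rewrite !gt_eqF.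
rewrite expRN -[leRHS]invrK lef_pV2 ?posrE ?expR_gt0 ?invr_gt0//.
by apply: le_trans (expR_ge1Dx _); rewrite lerDr.
Qed.

End brownian_drift.

(** * Positivity *)

Section lyapunov_at_zero.
Context {R : realType}.
Implicit Types (e M y : R).
(** A common lower bound for the barrier at both ends of [e, M]. Above M it comes from ln y <= y -
    1, since y^2 / 2 - (y - 1) >= (y - 1)^2 / 2; below e it comes from the condition e <= exp (- q
    M), that is q M <= - ln e. *)
Local Notation q M := ((M - 1) ^+ 2 / 2).

(* The value below [e / 2] is chosen so as to keep the barrier above
   [- ln e] to the left of the interval [e, M]. *)
Definition log_barrier e y : R :=
  if e / 2 <= y then y ^+ 2 / 2 - ln y else - ln e.

Let e_lt1 e M (M1 : 1 < M) (eM : e <= expR (- q M)) : e < 1.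
Proof.
apply: (le_lt_trans eM); rewrite -[ltRHS]expR0 ltr_expR oppr_lt0.
by rewrite divr_gt0// exprn_gt0// subr_gt0.
Qed.

Let q_le e M (e0 : 0 < e) (eM : e <= expR (- q M)) : q M <= - ln e.
Proof.
by rewrite lerNr -[leRHS]expRK ler_ln ?posrE ?expR_gt0.
Qed.

Let q_ge0 M : 0 <= q M. Proof. by rewrite divr_ge0// sqr_ge0. Qed.

Let ln_le (y : R) : 0 < y -> ln y <= y - 1.
Proof. by move=> y0; have := @le_ln1Dx R (y - 1); rewrite (addrC 1) subrK; apply; lra. Qed.

Lemma log_barrier_ge0 e M y (e0 : 0 < e) (M1 : 1 < M) (eM : e <= expR (- q M)) :
  0 <= log_barrier e y.
Proof.
have q0 := q_ge0 M; have qe := q_le e0 eM.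
rewrite /log_barrier; case: ifPn => [ey|_]; last exact: le_trans qe.
have y0 : 0 < y by apply: lt_le_trans ey; rewrite divr_gt0.
have := ln_le y0; have := sqr_ge0 (y - 1); nra.
Qed.

Lemma measurable_log_barrier e : measurable_fun setT (log_barrier e).
Proof.
apply: measurable_fun_ifT => //.
- exact: measurable_fun_ler.
- apply: measurable_funB; first by apply: measurable_funM => //; exact: measurable_funX.
  exact: measurable_ln.
Qed.

Lemma log_barrier_exit e M y (e0 : 0 < e) (M1 : 1 < M) (eM : e <= expR (- q M)) :
  ~ `[e, M]%classic y -> q M <= log_barrier e y.
Proof.
have qe := q_le e0 eM; have e1 := e_lt1 M1 eM.
rewrite /= in_itv/= => /negP; rewrite negb_and -!ltNge => /orP[ye|yM].
  rewrite /log_barrier; case: ifPn => // ey; apply: (le_trans qe).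
  have y0 : 0 < y by apply: lt_le_trans ey; rewrite divr_gt0.
  have : ln y <= ln e by rewrite ler_ln ?posrE// ltW.
  have := sqr_ge0 y; lra.
have y1 : 1 < y by exact: lt_trans yM.
have y0 : 0 < y by exact: lt_trans y1.
have ey : e / 2 <= y by lra.
rewrite /log_barrier ey.
have := @ln_le y.
move=> /(_ y0) h.
have My : M - 1 <= y - 1 by rewrite lerD2r ltW.
have M10 : 0 <= M - 1 by rewrite subr_ge0 ltW.
have h2 : (M - 1) ^+ 2 <= (y - 1) ^+ 2.
  by rewrite lerXn2r// nnegrE// (le_trans M10).
have h3 : (y - 1) ^+ 2 = y ^+ 2 - 2 * y + 1 by ring.
lra.
Qed.

(** For z >= e / 2 this is the expansion of - ln (1 + u) with u = (z - y) / y, whose remainder gives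
    C1. For z < e / 2 the jump from y >= e is longer than e / 2, so powers of (2 / e) |z - y| >= 1
    turn the constant and linear terms into cubic ones; this gives C2. *)
Lemma log_barrier_taylor e M (e0 : 0 < e) (M1 : 1 < M) (eM : e <= expR (- q M)) :
  exists2 C, 0 <= C & forall y z, e <= y <= M ->
  log_barrier e z <= log_barrier e y + (y - y^-1) * (z - y) +
    (1 + y ^- 2) / 2 * (z - y) ^+ 2 + C * `|z - y| ^+ 3.
Proof.
have q0 := q_ge0 M; have qe := q_le e0 eM.
pose C1 := 2 * M / e / e ^+ 3.
pose Pm := M + e^-1.
pose C2 := - ln e * (2 / e) ^+ 3 + Pm * (2 / e) ^+ 2.
have le0 : 0 <= - ln e by exact: le_trans qe.
have M0 : 0 < M by lra.
have Pm0 : 0 <= Pm by rewrite addr_ge0 ?invr_ge0 ?ltW.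
have C10 : 0 <= C1 by rewrite divr_ge0 ?exprn_ge0 ?divr_ge0 ?mulr_ge0 ?(ltW e0)// ltW.
have C20 : 0 <= C2.
  by rewrite addr_ge0// mulr_ge0// exprn_ge0// divr_ge0// ltW.
exists (C1 + C2); first exact: addr_ge0.
move=> y z /andP[ey yM].
have y0 : 0 < y by exact: lt_le_trans ey.
have E : log_barrier e y = y ^+ 2 / 2 - ln y by rewrite /log_barrier ifT//; lra.
have r3 : 0 <= `|z - y| ^+ 3 by rewrite exprn_ge0.
have q20 : 0 <= (1 + y ^- 2) / 2 * (z - y) ^+ 2.
  rewrite mulr_ge0 ?sqr_ge0// divr_ge0// addr_ge0// invr_ge0 exprn_ge0//; exact: ltW.
have [ez|ez] := leP (e / 2) z; last first.
  have lz : log_barrier e z = - ln e by rewrite /log_barrier ifF// leNgt ez.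
  have fy := log_barrier_ge0 y e0 M1 eM.
  have p1 : `|y - y^-1| <= Pm.
    apply: (le_trans (ler_normB _ _)); rewrite !gtr0_norm ?invr_gt0//.
    by rewrite lerD// lef_pV2.
  have p2 : - (Pm * `|z - y|) <= (y - y^-1) * (z - y).
    have := ler_norm (- ((y - y^-1) * (z - y))); rewrite normrN normrM.
    have := ler_wpM2r (normr_ge0 (z - y)) p1; lra.
  have r1 : 1 <= 2 / e * `|z - y|.
    rewrite ltr0_norm; last by lra.
    by rewrite mulrAC ler_pdivlMr// mul1r; lra.
  set r := `|z - y| in r1 r3 p2 *.
  have r0 : 0 <= r by exact: normr_ge0.
  have c1 : - ln e <= - ln e * (2 / e) ^+ 3 * r ^+ 3.
    by rewrite -mulrA ler_peMr// -exprMn exprn_ege1.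
  have c2 : Pm * r <= Pm * (2 / e) ^+ 2 * r ^+ 3.
    rewrite -mulrA ler_wpM2l// [r ^+ 3]exprSr mulrA ler_peMl// -exprMn exprn_ege1//.
  have c3 : 0 <= C1 * r ^+ 3 by exact: mulr_ge0.
  have -> : (C1 + C2) * r ^+ 3 = C1 * r ^+ 3 +
      (- ln e * (2 / e) ^+ 3 * r ^+ 3 + Pm * (2 / e) ^+ 2 * r ^+ 3).
    by rewrite /C2; ring.
  rewrite lz; lra.
have z0 : 0 < z by apply: lt_le_trans ez; rewrite divr_gt0.
have lz : log_barrier e z = z ^+ 2 / 2 - ln z by rewrite /log_barrier ifT.
pose u := (z - y) / y.
have uz : 1 + u = z / y by rewrite /u; field; rewrite gt_eqF.
have lnz : ln z = ln y + ln (1 + u).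
  by rewrite uz -lnM ?posrE ?divr_gt0// mulrC divfK// gt_eqF.
have del0 : 0 < e / (2 * M) by rewrite divr_gt0// mulr_gt0.
have u1 : e / (2 * M) - 1 <= u.
  rewrite lerBlDl uz ler_pdivlMr//.
  apply: le_trans ez; rewrite ler_pdivlMr// -mulrA [y * 2]mulrC mulrA.
  by rewrite -mulrA mulrAC; rewrite ler_pdivrMr ?mulr_gt0//; rewrite ler_pM2l//; lra.
have T := oppr_ln1D_le_taylor2 del0 u1.
have u3 : `|u| ^+ 3 / (e / (2 * M)) <= C1 * `|z - y| ^+ 3.
  rewrite /u normrM exprMn (gtr0_norm (_ : 0 < y^-1)) ?invr_gt0// exprVn.
  have -> : `|z - y| ^+ 3 / y ^+ 3 / (e / (2 * M)) = `|z - y| ^+ 3 * (2 * M / e) / y ^+ 3.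
    by field; rewrite !gt_eqF.
  have -> : C1 * `|z - y| ^+ 3 = `|z - y| ^+ 3 * (2 * M / e) / e ^+ 3 by rewrite /C1; ring.
  apply: ler_wpM2l.
    by apply: mulr_ge0 => //; rewrite divr_ge0 ?mulr_ge0 ?(ltW M0) ?(ltW e0).
  rewrite lef_pV2 ?posrE ?exprn_gt0// lerXn2r// nnegrE; exact: ltW.
have c3 : 0 <= C2 * `|z - y| ^+ 3 by exact: mulr_ge0.
rewrite lz E lnz.
have -> : (C1 + C2) * `|z - y| ^+ 3 = C1 * `|z - y| ^+ 3 + C2 * `|z - y| ^+ 3 by ring.
have -> : (1 + y ^- 2) / 2 * (z - y) ^+ 2 = (z - y) ^+ 2 / 2 + u ^+ 2 / 2.
  by rewrite /u; field; rewrite gt_eqF.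
have -> : (y - y^-1) * (z - y) = y * (z - y) - u by rewrite /u; field; rewrite gt_eqF.
lra.
Qed.

End lyapunov_at_zero.

(** The singular terms cancel: - b / y brings - A y^-2, which dominates c^2 / 2 y^-2. What remains
    is A (y + 1) from b y, A from c^2 / 2, and B. *)
Lemma log_barrier_generator {R : realType} (d : nat) (m g e M y : R)
    (hd : (2 <= d)%N) (hm : 0 < m) (hg : 0 <= g) :
  0 < e -> e <= y <= M ->
  (y - y^-1) * cutoff_drift d m g e y + m^-1 ^+ 2 / 2 * (1 + y ^- 2) <=
  (d%:R - 1) / (2 * m ^+ 2) * (M + 2) + g / (2 * m ^+ 2).
Proof.
move=> e0 /andP[ey yM]; have y0 : 0 < y by exact: lt_le_trans ey.
rewrite cutoff_driftE//.
have A0 := coth_coeff_ge0 hd hm; have A1 := coth_coeff_ge hd hm.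
have b1 := radial_drift_le (d := d) hd hm hg y0.
have b2 := radial_drift_div_ge hd hm hg y0.
set A := (d%:R - 1) / (2 * m ^+ 2) in A0 A1 b1 b2 *.
set B := g / (2 * m ^+ 2) in b2 *.
set b := radial_drift d m g y in b1 b2 *.
have b3 : b * y <= A * (y + 1).
  apply: (le_trans (ler_wpM2r (ltW y0) b1)).
  rewrite le_eqVlt; apply/orP; left; apply/eqP; field; by rewrite gt_eqF.
have -> : (y - y^-1) * b = b * y - b / y by ring.
have i0 : 0 <= y ^- 2 by rewrite invr_ge0 exprn_ge0// ltW.
have := ler_wpM2r i0 A1; have := ler_wpM2l A0 yM.
have -> : A / y ^+ 2 = A * y ^- 2 by [].
move: b2; have -> : A / y ^+ 2 = A * y ^- 2 by [].
move: (y ^- 2) i0 => i i0; move: (b / y) => z.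
lra.
Qed.

Section positivity.
Context {dT : measure_display} {T : measurableType dT} {R : realType}.
Variables (P : probability T R) (F : R -> set (set T)) (W : R -> T -> R).
Hypothesis hW : wiener P F W.
Variables (d : nat) (m g : R).
Hypotheses (hd : (2 <= d)%N) (hm : 0 < m) (hg : 0 <= g).

(** The numerator is linear in M and the denominator quadratic, and neither depends on e; hence the
    probability is small for M large, for all e below the threshold exp (- (M - 1)^2 / 2). *)
Lemma cutoff_solution_ge (s0 e M Te : R) (x : T -> R -> R) :
  0 < e -> 1 < M -> e <= expR (- ((M - 1) ^+ 2 / 2)) -> 0 < Te -> e / 2 <= s0 ->
  {ae P, forall w, ode_solution (cutoff_drift d m g e) m^-1 s0 (W ^~ w) Te (x w)} ->
  exists D, [/\ measurable D,
    (P D <= (((s0 ^+ 2 / 2 - ln s0) +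
      Te * ((d%:R - 1) / (2 * m ^+ 2) * (M + 2) + g / (2 * m ^+ 2))) /
      ((M - 1) ^+ 2 / 2))%:E)%E &
    {ae P, forall w, ~ D w -> forall t, 0 <= t <= Te -> e <= x w t}].
Proof.
move=> e0 M1 eM Te0 es0 xsol.
have [L L0 bL] := cutoff_drift_lipschitz hd hm hg e0.
have bK := cutoff_drift_bounded hd hm hg e0.
have [C C0 ft] := log_barrier_taylor e0 M1 eM.
have A0 := coth_coeff_ge0 hd hm; have B0 := tanh_coeff_ge0 hm hg.
set A := (d%:R - 1) / (2 * m ^+ 2) in A0 bK *.
set B := g / (2 * m ^+ 2) in B0 bK *.
have K0 : 0 <= A * (1 + e^-1) + B.
  by rewrite addr_ge0// mulr_ge0// addr_ge0// invr_ge0 ltW.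
have gam0 : 0 <= A * (M + 2) + B by rewrite addr_ge0// mulr_ge0//; lra.
have q0 : 0 < (M - 1) ^+ 2 / 2 by rewrite divr_gt0// exprn_gt0// subr_gt0.
have Q0 : 0 <= 1 + e ^- 2 by rewrite addr_ge0// invr_ge0 exprn_ge0// ltW.
have step := @taylor_step_condition R `[e, M]%classic (log_barrier e) (cutoff_drift d m g e)
  (fun y => y - y^-1) (fun y => 1 + y ^- 2) (cst 0) C _ _ m^-1 (A * (M + 2) + B)
  C0 K0 Q0 (measurable_log_barrier e) (fun y => log_barrier_ge0 y e0 M1 eM) bK.
have cI : closed `[e, M]%classic by exact: itv_closed.
have qQ y : `[e, M]%classic y -> `|1 + y ^- 2| <= 1 + e ^- 2.
  rewrite /= in_itv/= => /andP[ey _]; have y0 := lt_le_trans e0 ey.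
  rewrite ger0_norm; last by rewrite addr_ge0// invr_ge0 exprn_ge0// ltW.
  rewrite lerD2l lef_pV2 ?posrE ?exprn_gt0//.
  by rewrite lerXn2r// nnegrE; exact: ltW.
have ft' y z : `[e, M]%classic y -> log_barrier e z <= log_barrier e y +
    (y - y^-1) * (z - y) + (1 + y ^- 2) / 2 * (z - y) ^+ 2 + C * `|z - y| ^+ 3.
  by rewrite /= in_itv; exact: ft.
have gen y : `[e, M]%classic y -> (y - y^-1) * cutoff_drift d m g e y +
    m^-1 ^+ 2 / 2 * (1 + y ^- 2) <= A * (M + 2) + B - cst 0 y.
  by rewrite /= in_itv subr0; exact: log_barrier_generator.
have {}step := step qQ ft' gen.
have step0 u : 0 < u -> exists2 del, 0 < del & forall h, 0 < h < del -> forall y, `[e, M]%classic y ->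
    (\int[gauss_prob h]_z (log_barrier e (y + (h * cutoff_drift d m g e y + m^-1 * z)))%:E <=
    (log_barrier e y + h * (A * (M + 2) + B + u))%:E)%E.
  move=> /step[del del0 H]; exists del => // h hd' y Iy.
  by have := H h hd' y Iy; rewrite /= mulr0 adde0.
have [D [mD PD HD]] := exit_prob_limit hW L0 bL Te0 xsol cI
  (measurable_log_barrier e) (fun y => log_barrier_ge0 y e0 M1 eM) gam0 q0
  (fun y => @log_barrier_exit _ _ _ y e0 M1 eM) step0.
exists D; split => //.
  by move: PD; rewrite /log_barrier es0.
apply: filterS HD => w Hw nD t tT; have := Hw nD t tT.
by rewrite /= in_itv/= => /andP[].
Qed.

End positivity.

(** * Recurrence *)

Section lyapunov_at_infinity.
Context {R : realType}.
Implicit Types (K lam a y z : R).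

(* The concave correction K (1 - exp (- lam y)) absorbs the drift on bounded
   intervals, where ln (1 + y) alone is not a supersolution. *)
Definition log_growth K lam y : R :=
  if 0 <= y then ln (1 + y) + K * (1 - expR (- (lam * y))) else 0.

Lemma log_growth_ge0 K lam y : 0 <= K -> 0 < lam -> 0 <= log_growth K lam y.
Proof.
move=> K0 lam0; rewrite /log_growth; case: ifPn => // y0.
rewrite addr_ge0 ?ln_ge0 ?lerDl// mulr_ge0// subr_ge0 -[leRHS]expR0 ler_expR oppr_le0.
by rewrite mulr_ge0// ltW.
Qed.

Lemma log_growth_ge_ln K lam y : 0 <= K -> 0 < lam -> 0 <= y -> ln (1 + y) <= log_growth K lam y.
Proof.
move=> K0 lam0 y0; rewrite /log_growth y0 lerDl mulr_ge0// subr_ge0 -[leRHS]expR0.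
by rewrite ler_expR oppr_le0 mulr_ge0// ltW.
Qed.

Lemma measurable_log_growth K lam : measurable_fun setT (log_growth K lam).
Proof.
apply: measurable_fun_ifT => //.
- exact: measurable_fun_ler.
- apply: measurable_funD.
    by apply: measurableT_comp; [exact: measurable_ln|exact: measurable_funD].
  apply: measurable_funM => //; apply: measurable_funB => //.
  apply: measurableT_comp => //; apply: measurableT_comp => //; exact: measurable_funM.
Qed.

Definition log_growth' K lam y := (1 + y)^-1 + K * lam * expR (- (lam * y)).
Definition log_growth'' K lam y := - ((1 + y) ^- 2 + K * lam ^+ 2 * expR (- (lam * y))).

Let expN_le1 lam y : 0 < lam -> 0 <= y -> expR (- (lam * y)) <= 1.
Proof. by move=> l0 y0; rewrite -[leRHS]expR0 ler_expR oppr_le0 mulr_ge0// ltW. Qed.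

Let inv_le1 y : 0 <= y -> (1 + y)^-1 <= 1.
Proof. by move=> y0; rewrite invf_le1 ?lerDl// ltr_wpDr. Qed.

Let inv2_le1 y : 0 <= y -> (1 + y) ^- 2 <= 1.
Proof. by move=> y0; rewrite invf_le1 ?exprn_gt0 ?ltr_wpDr// exprn_ege1// lerDl. Qed.

Lemma log_growth''_le K lam y : 0 <= K -> 0 < lam -> 0 <= y ->
  `|log_growth'' K lam y| <= 1 + K * lam ^+ 2.
Proof.
move=> K0 l0 y0; have KL : 0 <= K * lam ^+ 2 by rewrite mulr_ge0// sqr_ge0.
rewrite normrN ger0_norm; last first.
  by rewrite addr_ge0 ?invr_ge0 ?exprn_ge0 ?addr_ge0// mulr_ge0// expR_ge0.
by rewrite lerD ?inv2_le1// ler_piMr// expN_le1.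
Qed.

(** For z >= 0 the third-order bounds on ln and exp give C1. For z < 0 the function is 0 and the
    jump from y >= a is longer than a, so the cubic term with C2 dominates the linear and quadratic
    ones. *)
Lemma log_growth_taylor K lam a : 0 <= K -> 0 < lam -> 0 < a ->
  exists2 C, 0 <= C & forall y z, a <= y ->
  log_growth K lam z <= log_growth K lam y + log_growth' K lam y * (z - y) +
    log_growth'' K lam y / 2 * (z - y) ^+ 2 + C * `|z - y| ^+ 3.
Proof.
move=> K0 l0 a0.
pose C1 := 3^-1 + K * lam ^+ 3 / 6.
pose C2 := (1 + K * lam) / a ^+ 2 + (1 + K * lam ^+ 2) / (2 * a).
have l00 : 0 <= lam by exact: ltW.
have KL : 0 <= K * lam ^+ 2 by rewrite mulr_ge0// sqr_ge0.
have KL1 : 0 <= K * lam by exact: mulr_ge0.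
have KL3 : 0 <= K * lam ^+ 3 by rewrite mulr_ge0// exprn_ge0.
have C10 : 0 <= C1 by rewrite addr_ge0// divr_ge0.
have C20 : 0 <= C2.
  by rewrite addr_ge0// divr_ge0 ?addr_ge0 ?exprn_ge0 ?mulr_ge0// ltW.
exists (C1 + C2); first exact: addr_ge0.
move=> y z ay.
have y0 : 0 <= y by rewrite (le_trans (ltW a0)).
have y1 : 0 < 1 + y by rewrite ltr_wpDr.
have -> : (C1 + C2) * `|z - y| ^+ 3 = C1 * `|z - y| ^+ 3 + C2 * `|z - y| ^+ 3 by ring.
have r0 : 0 <= `|z - y| by [].
have [z0|z0] := leP 0 z; last first.
  have -> : log_growth K lam z = 0 by rewrite /log_growth leNgt z0.
  have fy := log_growth_ge0 y K0 l0.
  have qy := log_growth''_le K0 l0 y0.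
  have py : log_growth' K lam y <= 1 + K * lam.
    by rewrite lerD ?inv_le1// ler_piMr// expN_le1.
  set p := log_growth' K lam y in py *; set q := log_growth'' K lam y in qy *.
  set r := `|z - y| in r0 *.
  have rE : r = y - z by rewrite /r distrC gtr0_norm//; lra.
  have ra : a <= r by lra.
  have -> : z - y = - r by rewrite rE; ring.
  have c1 : (1 + K * lam) * r <= (1 + K * lam) / a ^+ 2 * r ^+ 3.
    have -> : (1 + K * lam) / a ^+ 2 * r ^+ 3 = (1 + K * lam) * (r * (r ^+ 2 / a ^+ 2)).
      by field; rewrite gt_eqF.
    rewrite ler_wpM2l ?addr_ge0// ler_peMr// ler_pdivlMr ?exprn_gt0// mul1r.
    by rewrite lerXn2r// nnegrE ltW.
  have c2 : (1 + K * lam ^+ 2) / 2 * r ^+ 2 <= (1 + K * lam ^+ 2) / (2 * a) * r ^+ 3.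
    have -> : (1 + K * lam ^+ 2) / (2 * a) * r ^+ 3 = (1 + K * lam ^+ 2) / 2 * (r ^+ 3 / a).
      by field; rewrite gt_eqF.
    by rewrite ler_wpM2l ?divr_ge0 ?addr_ge0// ler_pdivlMr// [r ^+ 3]exprSr ler_wpM2l// sqr_ge0.
  have c3 : - ((1 + K * lam ^+ 2) / 2 * r ^+ 2) <= q / 2 * r ^+ 2.
    rewrite -mulNr ler_wpM2r ?sqr_ge0// -mulNr ler_pM2r//.
    by have := ler_norm (- q); rewrite normrN; lra.
  have c4 : p * r <= (1 + K * lam) * r by rewrite ler_wpM2r.
  have c5 : 0 <= C1 * r ^+ 3 by rewrite mulr_ge0// exprn_ge0.
  have -> : C2 * r ^+ 3 = (1 + K * lam) / a ^+ 2 * r ^+ 3 + (1 + K * lam ^+ 2) / (2 * a) * r ^+ 3.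
    by rewrite /C2; ring.
  rewrite sqrrN; lra.
have z1 : 0 < 1 + z by rewrite ltr_wpDr.
pose u := (z - y) / (1 + y).
have uz : 1 + u = (1 + z) / (1 + y) by rewrite /u; field; rewrite gt_eqF.
have u1 : -1 < u by have : 0 < 1 + u by [rewrite uz divr_gt0|]; lra.
have T := ln1D_le_taylor3 u1.
have lnz : ln (1 + z) = ln (1 + y) + ln (1 + u).
  by rewrite uz -lnM ?posrE ?divr_gt0// mulrC divfK// gt_eqF.
pose v := - (lam * (z - y)).
have T2 := expR_ge_taylor3 v.
have ez : expR (- (lam * z)) = expR (- (lam * y)) * expR v.
  by rewrite -expRD /v; congr expR; ring.
set E := expR (- (lam * y)) in ez.
have E0 : 0 <= E by exact: expR_ge0.
have E1 : E <= 1 by exact: expN_le1.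
have u3 : u ^+ 3 <= `|z - y| ^+ 3.
  apply: (le_trans (ler_norm _)); rewrite normrX /u normrM exprMn ler_piMr ?exprn_ge0//.
  rewrite exprn_ile1// normfV ?invr_ge0// gtr0_norm//; exact: inv_le1.
have v3 : - (K * E * (v ^+ 3 / 6)) <= K * lam ^+ 3 / 6 * `|z - y| ^+ 3.
  have -> : - (K * E * (v ^+ 3 / 6)) = K * lam ^+ 3 / 6 * (E * (z - y) ^+ 3).
    by rewrite /v; ring.
  rewrite ler_wpM2l ?divr_ge0//; apply: (le_trans (ler_norm _)).
  by rewrite normrM normrX ger0_norm// ler_piMl ?exprn_ge0.
have T3 : K * E * (1 + v + v ^+ 2 / 2 + v ^+ 3 / 6) <= K * E * expR v.
  by rewrite ler_wpM2l// mulr_ge0.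
have c5 : 0 <= C2 * `|z - y| ^+ 3 by rewrite mulr_ge0// exprn_ge0.
rewrite /log_growth z0 y0 lnz ez /log_growth' /log_growth'' -/E.
have -> : ((1 + y)^-1 + K * lam * E) * (z - y) = u - K * E * v.
  by rewrite /u /v; ring.
have -> : - ((1 + y) ^- 2 + K * lam ^+ 2 * E) / 2 * (z - y) ^+ 2 =
    - (u ^+ 2 / 2) - K * E * (v ^+ 2 / 2).
  by rewrite /u /v exprMn exprVn; ring.
rewrite /C1; lra.
Qed.

Lemma log_growth_generator a kap : 0 < a -> 0 < kap -> exists K lam,
  [/\ 0 <= K, 0 < lam & forall y, a <= y ->
  log_growth' K lam y * (kap / y ^+ 2) + log_growth'' K lam y <= - ((1 + y) ^- 2 / 2)].
Proof.
move=> a0 kap0.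
(* Q bounds the drift kap / y^2 above a. With lam = 2 Q the concavity of the correction is twice its
   largest drift term, leaving a gain K lam Q e^(- lam y). For y >= X the logarithm suffices alone,
   because 2 kap (1 + y) <= 4 kap y <= y^2. *)
pose Q := kap / a ^+ 2; pose lam := 2 * Q; pose X := 4 * kap + 1.
have Q0 : 0 < Q by rewrite divr_gt0// exprn_gt0.
have lam0 : 0 < lam by rewrite mulr_gt0.
(* Chosen so that K lam e^(- lam y) >= 1 for y <= X: there the gain is at least Q, which bounds the
   drift term of the logarithm. *)
pose K := expR (lam * X) / lam.
have K0 : 0 <= K by rewrite divr_ge0 ?expR_ge0// ltW.
exists K, lam; split => // y ay.
have y0 : 0 < y by exact: lt_le_trans ay.
have s0 : 0 < (1 + y)^-1 by rewrite invr_gt0; lra.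
have t0 : 0 < kap / y ^+ 2 by rewrite divr_gt0// exprn_gt0.
have tQ : kap / y ^+ 2 <= Q.
  rewrite ler_pM2l// lef_pV2 ?posrE ?exprn_gt0// lerXn2r// nnegrE; exact: ltW.
rewrite /log_growth' /log_growth'' -[(1 + y) ^- 2]exprVn.
have E0 := expR_gt0 (- (lam * y)).
set E := expR (- (lam * y)) in E0 *.
have h1 : K * lam * E * (kap / y ^+ 2) <= K * lam * E * Q.
  apply: ler_wpM2l => //; apply: mulr_ge0; last exact: ltW.
  by apply: mulr_ge0 => //; exact: ltW.
have h2 : K * lam ^+ 2 * E = 2 * (K * lam * E * Q).
  rewrite expr2 {2}/lam; ring.
have KlE : K * lam = expR (lam * X) by rewrite /K divfK// gt_eqF.
suff : (1 + y)^-1 * (kap / y ^+ 2) <= (1 + y)^-1 ^+ 2 / 2 + K * lam * E * Q by lra.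
have [yX|yX] := leP X y.
  have h3 : 0 <= K * lam * E * Q.
    rewrite KlE; apply: mulr_ge0; last exact: ltW.
    by apply: mulr_ge0; [exact: expR_ge0|exact: ltW].
  suff : (1 + y)^-1 * (kap / y ^+ 2) <= (1 + y)^-1 ^+ 2 / 2 by lra.
  have y1 : 1 <= y by move: yX; rewrite /X; lra.
  have k1 : 4 * kap * y <= y * y by rewrite ler_pM2r//; move: yX; rewrite /X; lra.
  have k2 : kap * (1 + y) <= kap * (2 * y) by rewrite ler_pM2l//; lra.
  rewrite expr2 -mulrA ler_pM2l// ler_pdivrMr; last by rewrite mulr_gt0.
  have -> : (1 + y)^-1 / 2 * y ^+ 2 = (y * y / 2) / (1 + y).
    by field; rewrite gt_eqF//; lra.
  by rewrite ler_pdivlMr; lra.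
have h4 : Q <= K * lam * E * Q.
  rewrite ler_peMl ?(ltW Q0)// KlE /E -expRD -[leLHS]expR0 ler_expR.
  by rewrite -mulrBr; apply: mulr_ge0; [exact: ltW|rewrite subr_ge0 ltW].
have h5 : (1 + y)^-1 * (kap / y ^+ 2) <= 1 * Q.
  by rewrite ler_pM ?(ltW s0) ?(ltW t0)// inv_le1// ltW.
have : 0 <= (1 + y)^-1 ^+ 2 by exact: sqr_ge0.
lra.
Qed.

End lyapunov_at_infinity.

Lemma log_threshold {R : realType} (f e : R) : 0 <= f -> 0 < e ->
  exists2 M, 0 < M & 0 < ln (1 + M) /\ f / ln (1 + M) <= e / 2.
Proof.
move=> f0 e0; pose M := expR (2 * (f + 1) / e).
have M0 : 0 < M by exact: expR_gt0.
have phi0 : 0 < ln (1 + M) by rewrite ln_gt0//; lra.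
exists M => //; split => //.
rewrite ler_pdivrMr// mulrC -ler_pdivrMr ?divr_gt0// invf_div.
apply: (@le_trans _ _ (2 * (f + 1) / e)).
  by rewrite mulrCA mulrA ler_pM2r ?invr_gt0//; lra.
rewrite -[leLHS]expRK ler_ln ?posrE ?expR_gt0//; first by rewrite -/M; lra.
by lra.
Qed.

Section recurrence.
Context {dT : measure_display} {T : measurableType dT} {R : realType}.
Variables (P : probability T R) (F : R -> set (set T)) (W : R -> T -> R).

Lemma cutoff_stay_null (d : nat) (m g s0 a : R) (x : T -> R -> R) : wiener P F W ->
  (2 <= d)%N -> 0 < m -> 0 <= g -> d%:R - 1 <= g -> 0 < a -> 0 <= s0 ->
  {ae P, forall w, forall Te, ode_solution (cutoff_drift d m g (a / 2)) m^-1 s0 (W ^~ w) Te (x w)} ->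
  {ae P, forall w, ~ forall t, 0 <= t -> a <= x w t}.
Proof.
move=> hW hd hm hg gd a0 s00 xsol.
(* The margin between a / 2 and a lets the chains stay in the region when the solution stays above
   a, and on that region the truncated drift is the true one. *)
pose a' := a / 2.
have a'0 : 0 < a' by rewrite divr_gt0.
have aa : a' < a by rewrite /a'; lra.
have [L L0 bL] := cutoff_drift_lipschitz hd hm hg a'0.
have bK := cutoff_drift_bounded hd hm hg a'0.
have A0 := coth_coeff_ge0 hd hm; have A1 := coth_coeff_ge hd hm.
have B0 := tanh_coeff_ge0 hm hg.
have c0 : 0 < m^-1 ^+ 2 by rewrite exprn_gt0// invr_gt0.
have bq y : a' <= y -> cutoff_drift d m g a' y <= 2 * ((d%:R - 1) / (2 * m ^+ 2)) / y ^+ 2.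
  move=> ay; rewrite cutoff_driftE//; apply: radial_drift_le_sqr => //.
  exact: lt_le_trans ay.
set A := (d%:R - 1) / (2 * m ^+ 2) in A0 A1 bK bq.
set B := g / (2 * m ^+ 2) in B0 bK.
have Ap : 0 < A by apply: lt_le_trans A1; rewrite divr_gt0.
(* Factoring c^2 / 2 out of the generator turns the drift bound 2 A / y^2 into kap / y^2. *)
pose kap := 4 * A / m^-1 ^+ 2.
have kap0 : 0 < kap by rewrite divr_gt0// mulr_gt0.
have [K [lam [K0 lam0 gen]]] := log_growth_generator a'0 kap0.
have [C C0 ft] := log_growth_taylor K0 lam0 a'0.
(* The factor c^2 / 2 times the gain (1 + y)^-2 / 2 of the generator; the absolute value keeps l
   finite and nonnegative on the whole line. *)
pose l (y : R) : R := m^-1 ^+ 2 / 4 * (1 + `|y|) ^- 2.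
have ml : measurable_fun setT l.
  have -> : l = (fun y => m^-1 ^+ 2 / 4 * (1 + `|y|) `^ (- 2%:R)).
    by apply/funext => y; rewrite powRN powR_mulrn// addr_ge0.
  apply: measurable_funM; first exact: measurable_cst.
  apply: (measurableT_comp (measurable_powR (- 2%:R))).
  by apply: measurable_funD; [exact: measurable_cst|exact: normr_measurable].
have l0 y : 0 <= l y.
  apply: mulr_ge0; first by rewrite divr_ge0 ?(ltW c0).
  by rewrite invr_ge0 exprn_ge0 ?addr_ge0.
have Kb0 : 0 <= A * (1 + a'^-1) + B.
  by rewrite addr_ge0// mulr_ge0// addr_ge0// invr_ge0 ltW.
have Q0 : 0 <= 1 + K * lam ^+ 2 by rewrite addr_ge0// mulr_ge0// sqr_ge0.
have p0 y : 0 <= y -> 0 <= log_growth' K lam y.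
  by move=> y0; rewrite addr_ge0 ?invr_ge0 ?addr_ge0// mulr_ge0 ?expR_ge0// mulr_ge0// ltW.
have step := @taylor_step_condition R [set y | a' <= y] (log_growth K lam) (cutoff_drift d m g a')
  (log_growth' K lam) (log_growth'' K lam) l C _ _ m^-1 0 C0 Kb0 Q0 (measurable_log_growth K lam)
  (fun y => log_growth_ge0 y K0 lam0) bK.
have qQ y : a' <= y -> `|log_growth'' K lam y| <= 1 + K * lam ^+ 2.
  by move=> ay; apply: log_growth''_le => //; apply: le_trans ay; exact: ltW.
have G y : a' <= y -> log_growth' K lam y * cutoff_drift d m g a' y +
    m^-1 ^+ 2 / 2 * log_growth'' K lam y <= 0 - l y.
  move=> ay; have y0 : 0 <= y by apply: le_trans ay; exact: ltW.
  have g1 := gen y ay; have g2 := ler_wpM2l (p0 y y0) (bq y ay).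
  have E : log_growth' K lam y * (2 * A / y ^+ 2) =
      m^-1 ^+ 2 / 2 * (log_growth' K lam y * (kap / y ^+ 2)).
    rewrite /kap; field; rewrite !gt_eqF//; exact: lt_le_trans ay.
  rewrite E in g2.
  have c20 : 0 <= m^-1 ^+ 2 / 2 by rewrite divr_ge0// ltW.
  have := ler_wpM2l c20 g1; rewrite /l ger0_norm//.
  move: (log_growth' K lam y * (kap / y ^+ 2)) (log_growth'' K lam y) g2 => u v.
  by clear; lra.
have {}step := step qQ (fun y z => ft y z) G.
have {}step u : 0 < u -> exists2 del, 0 < del & forall h, 0 < h < del -> forall y, a' <= y ->
    (\int[gauss_prob h]_z (log_growth K lam (y + (h * cutoff_drift d m g a' y + m^-1 * z)))%:E +
     (h * l y)%:E <= (log_growth K lam y + h * u)%:E)%E.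
  by move=> /step; rewrite add0r.
apply: ae_small => e e0.
pose f0 := log_growth K lam s0.
have f00 : 0 <= f0 by exact: log_growth_ge0.
have [M M0 [phi0 phiE]] := log_threshold f00 e0.
pose phi := ln (1 + M).
pose eta := m^-1 ^+ 2 / 4 * (1 + M) ^- 2.
have eta0 : 0 < eta.
  apply: mulr_gt0; first by rewrite divr_gt0.
  by rewrite invr_gt0 exprn_gt0// addr_gt0.
(* A horizon so long that f0 / (Te eta) <= e / 2; using f0 + 1 keeps it positive when f0 = 0. *)
pose Te := 2 * (f0 + 1) / (e * eta).
have f10 : 0 < f0 + 1 by rewrite ltr_wpDl.
have Te0 : 0 < Te by exact: divr_gt0 (mulr_gt0 (ltr0Sn _ 1) f10) (mulr_gt0 e0 eta0).
have [|||D [mD PD HD]] := stay_prob_limit hW L0 bL Te0 _ aa (measurable_log_growth K lam)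
  (fun y => log_growth_ge0 y K0 lam0) ml l0 eta0 phi0 (M := M) _ _ step (x := x) (x0 := s0).
- by apply: filterS xsol => w; apply.
- move=> y ay yM; have y0 : 0 <= y by apply: le_trans ay; exact: ltW.
  rewrite /eta /l (ger0_norm y0); apply: ler_wpM2l; first by rewrite divr_ge0// ltW.
  have y1 : 0 < 1 + y by rewrite ltr_wpDr.
  have M1 : 0 < 1 + M by rewrite ltr_wpDr// ltW.
  rewrite lef_pV2 ?posrE ?exprn_gt0// lerXn2r ?nnegrE ?lerD2l//; exact: ltW.
- move=> y ay yM; have y0 : 0 <= y by apply: le_trans ay; exact: ltW.
  apply: le_trans (log_growth_ge_ln K0 lam0 y0).
  have M1 : 0 < 1 + M by rewrite addr_gt0.
  have My : 1 + M <= 1 + y by rewrite lerD2l ltW.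
  by rewrite /phi ler_ln// posrE; exact: lt_le_trans My.
exists D; split => //.
  apply: (le_trans PD); rewrite lee_fin -/f0 mulrDr.
  have : f0 / (Te * eta) <= e / 2.
    have -> : Te * eta = 2 * (f0 + 1) / e by rewrite /Te; field; rewrite !gt_eqF.
    rewrite invf_div mulrA ler_pdivrMr; last by rewrite mulr_gt0.
    have : 0 <= e * f0 by rewrite mulr_ge0// ltW.
    by move: e0; clear; lra.
  by move: phiE; clear; lra.
by apply: filterS HD => w Hw nD st; apply: nD; apply: Hw => t /andP[t0 _]; exact: st.
Qed.

End recurrence.

(** * Uniqueness and strong existence *)

Section completion.
Context {dT : measure_display} {T : measurableType dT} {R : realType}.
Variables (P : probability T R) (F : R -> set (set T)) (W : R -> T -> R).

(* Events of the completed filtration differ from events of [F] by a null set,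
   so they are still independent of the increments. *)
Lemma wiener_completed : wiener P F W -> wiener P (completed_filtration P W) W.
Proof.
move=> hW; have [[Fs Fle] aW W0 Wc Wi] := hW.
have pastF t : 0 <= t -> past_events W t `<=` F t.
  move=> t0 A [s]; rewrite /= in_itv/= => /andP[s0 st] [B mB <-].
  by rewrite setTI; apply: (Fle s t s0 st); exact: aW.
have genM t : 0 <= t ->
    past_events W t `|` [set N | measurable N /\ P N = 0%E] `<=` measurable.
  move=> t0 A [/(pastF t t0)|[]//]; exact: (Fs t t0).2.
pose C t := [set A : set T | measurable A /\ exists A' N, [/\ F t A', measurable N, P N = 0%E &
  forall w, ~ N w -> A w <-> A' w]].
have Cs t : 0 <= t -> sigma_algebra setT (C t).
  move=> t0; have [[F0 FD FU] FM] := Fs t t0.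
  split.
  - by split=> //; exists set0, set0; split => //; exact: measure0.
  - move=> A [mA [A' [N [FA' mN N0 AA']]]]; split; first exact: measurableD.
    exists (setT `\` A'), N; split => //; first exact: FD.
    by move=> w /AA' h; split=> -[_ nA]; split => // /h.
  - move=> A CA; split; first by apply: bigcup_measurable => k _; have [] := CA k.
    have /choice[A' /choice[N H]] := fun k => (CA k).2.
    exists (\bigcup_k A' k), (\bigcup_k N k); split.
    + by apply: FU => k; have [] := H k.
    + by apply: bigcup_measurable => k _; have [] := H k.
    + apply: measure_negligible; first by apply: bigcup_measurable => k _; have [] := H k.
      by apply: negligible_bigcup => k; exists (N k); split => //; have [] := H k.
    + move=> w nN; split=> -[k _ Akw]; exists k => //; have [_ _ _ h] := H k.
        by apply/h => // Nk; apply: nN; exists k.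
      by apply/h => // Nk; apply: nN; exists k.
have compC t : 0 <= t -> completed_filtration P W t `<=` C t.
  move=> t0; apply: smallest_sub; first exact: Cs.
  move=> A [pA|[mA A0]].
    split; first by apply: (Fs t t0).2; exact: pastF.
    by exists A, set0; split => //; exact: pastF.
  split => //; exists set0, A; split => //.
  by have [[]] := Fs t t0.
split => //.
- split=> [t t0|s t s0 st].
    split; first exact: smallest_sigma_algebra.
    by move=> A /(compC t t0)[].
  apply: (@sub_sigma_algebra2 T setT). move=> A [[r]|nA]; last by right.
  rewrite /= in_itv/= => /andP[r0 rs] pA; left; exists r => //.
  by rewrite /= in_itv/= r0 (le_trans rs).
- move=> t t0 B mB; apply: sub_sigma_algebra; left; exists t.
    by rewrite /= in_itv/= t0 lexx.
  by exists B => //; rewrite setTI.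
- move=> s t s0 st B mB /=; have [PI ind] := Wi s t s0 st B mB; split => //.
  move=> A /(compC s s0)[mA [A' [N [FA' mN N0 AA']]]].
  have mI : measurable [set w | B (W t w - W s w)].
    have mW r : 0 <= r -> measurable_fun setT (W r).
      by move=> r0 _ B' mB'; rewrite setTI; apply: (Fs r r0).2; exact: aW.
    have := measurable_funB (mW t (le_trans s0 (ltW st))) (mW s s0).
    by move=> /(_ measurableT B mB); rewrite setTI.
  have mA' : measurable A' by exact: (Fs s s0).2.
  have eqP_ (X Y : set T) : measurable X -> measurable Y ->
      (forall w, ~ N w -> X w <-> Y w) -> P X = P Y.
    move=> mX mY XY.
    have H Z : measurable Z -> P Z = P (Z `\` N).
      move=> mZ; rewrite measureD//= ?ltey_eq ?fin_num_measure//.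
      have -> : P (Z `&` N) = 0%E; last by rewrite sube0.
      apply/eqP; rewrite -measure_le0 -N0; apply: le_measure; rewrite ?inE//.
      exact: measurableI.
    rewrite H// (H Y)//; congr (P _); apply/seteqP; split => w [Xw nN]; split => //.
      by apply/(XY w nN).
    by apply/(XY w nN).
  rewrite (eqP_ A A')// -(ind A')//; apply: eqP_; [exact: measurableI|exact: measurableI|].
  by move=> w nN; split=> -[Aw ?]; split => //; apply/(AA' w nN).
Qed.

End completion.

Section comparison.
Context {R : realType}.
Implicit Types (u v x y z b w : R -> R).
Notation mu := (@lebesgue_measure R).

Lemma integral_eq_comparison x y u v z (x0 T : R) :
  {within `[0, T], continuous x} -> {within `[0, T], continuous y} ->
  (forall t, 0 <= t <= T -> [/\ mu.-integrable `[0, t] (EFin \o u),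
     mu.-integrable `[0, t] (EFin \o v),
     x t = x0 + \int[mu]_(r in `[0, t]) u r + z t &
     y t = x0 + \int[mu]_(r in `[0, t]) v r + z t]) ->
  {ae mu, forall r, 0 <= r <= T -> y r < x r -> u r <= v r} ->
  forall t, 0 <= t <= T -> x t <= y t.
Proof.
move=> cx cy xy uv t tT; rewrite -subr_le0.
apply: (@integral_eq_le0 _ T (fun t => x t - y t) (fun r => u r - v r)) => //.
- by move=> r; apply: cvgB; [exact: cx|exact: cy].
- move=> r rT; have [iu iv -> ->] := xy r rT; split.
    exact: (integrableB _ iu iv).
  by rewrite RintegralB//; ring.
- apply: filterS uv; first exact: (ae_filter_ringOfSetsType mu).
  by move=> r H rT; rewrite subr_gt0 subr_le0; exact: H.
Qed.

Lemma ode_solution_unique b (c x0 : R) w (T : R) x y :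
  (forall r s, r <= s -> b s <= b r) ->
  ode_solution b c x0 w T x -> ode_solution b c x0 w T y ->
  forall t, 0 <= t <= T -> x t = y t.
Proof.
move=> bni xs ys t tT.
have H x' y' : ode_solution b c x0 w T x' -> ode_solution b c x0 w T y' -> x' t <= y' t.
  move=> [cx xE] [cy yE].
  apply: (@integral_eq_comparison x' y' (b \o x') (b \o y') (fun t => c * w t) x0 T) => //.
    by move=> r rT; have [? ?] := xE r rT; have [? ?] := yE r rT.
  by apply: aeW => r _ /ltW; exact: bni.
by apply/eqP; rewrite eq_le !H.
Qed.

Lemma ode_solution_eq_in b b' (c x0 : R) w (T : R) x x' :
  (forall t, 0 <= t <= T -> x t = x' t) -> (forall t, 0 <= t <= T -> b (x t) = b' (x' t)) ->
  ode_solution b c x0 w T x -> ode_solution b' c x0 w T x'.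
Proof.
move=> xx bb [/within_continuousP cx xE]; split.
  apply/within_continuousP => r rT e e0; have [del del0 H] := cx r rT e e0.
  have rT' : 0 <= r <= T by move: rT; rewrite /= in_itv.
  exists del => // s sT rs; have sT' : 0 <= s <= T by move: sT; rewrite /= in_itv.
  by rewrite -!xx//; exact: H.
move=> t tT; have [ix xt] := xE t tT; have [t0 tT'] := andP tT.
have bb' r : `[0, t]%classic r -> (b \o x) r = (b' \o x') r.
  by rewrite /= in_itv/= => /andP[r0 rt]; apply: bb; rewrite r0 (le_trans rt).
split.
  apply: eq_integrable ix => //.
  by move=> r; rewrite inE => /bb'/= ->.
rewrite -xx// xt; congr (_ + _ + _); apply: eq_Rintegral => r; rewrite inE; exact: bb'.
Qed.

Lemma within_continuous_nonneg x : (forall k : nat, {within `[0, k.+1%:R], continuous x}) ->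
  {within `[0, +oo[, continuous x}.
Proof.
move=> H; apply/within_continuousP => r; rewrite /= in_itv/= andbT => r0 e e0.
have rk := unstable.ltr_bound r; set k := Num.bound r in rk.
have [|del del0 Hd] := (within_continuousP _ _).1 (H k.+1) r _ e e0.
  by rewrite /= in_itv/= r0/= ltW// (lt_le_trans rk)// ler_nat -addn2 leq_addr.
exists (Num.min del 1); first by rewrite lt_min del0 ltr01.
move=> y; rewrite /= in_itv/= andbT lt_min => y0 /andP[yd y1].
apply: Hd => //; rewrite /= in_itv/= y0/=.
have : `|r - y| < 1 by [].
rewrite ltr_norml => /andP[h1 h2].
have : k.+2%:R = k%:R + 2 :> R by rewrite -addn2 natrD.
lra.
Qed.

End comparison.

Section uniqueness.
Context {R : realType} (d : nat) (m g : R).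
Hypotheses (hd : (2 <= d)%N) (hm : 0 < m) (hg : 0 <= g).
Notation mu := (@lebesgue_measure R).

Lemma zero_set_ae (x : R -> R) : {within `[0, +oo[, continuous x} ->
  mu [set t : R | 0 <= t /\ x t = 0] = 0%E ->
  {ae mu, forall r, 0 <= r -> x r <> 0}.
Proof.
move=> cx x0; exists [set t : R | 0 <= t /\ x t = 0]; split => //.
  have mD : measurable [set` `[0 : R, +oo[] by exact: measurable_itv.
  have mx : measurable_fun [set` `[0 : R, +oo[] x.
    exact: subspace_continuous_measurable_fun.
  have := mx mD [set 0] (measurable_set1 _).
  congr (measurable _); apply/seteqP; split => t /=; rewrite in_itv/= andbT => -[]//.
by move=> t /= /not_implyP[t0 /contrapT].
Qed.

(** The drift is nonincreasing only on the positive half-line and has a default value at 0. When Y <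
    X, comparing the drifts only requires the smaller solution Y to be positive, which holds at
    almost every time. *)
Lemma pathwise_unique_radial s0 : pathwise_unique (radial_drift d m g) m^-1 s0.
Proof.
move=> dT T P F F' W S S' [_ _ cS Sz Se] [_ _ cS' Sz' Se'].
apply: filterS2 (filterI Sz Sz') (filterI Se Se') => w /= [z z'] [E E'] t t0.
have [cw w0] := cS w; have [cw' w0'] := cS' w.
have nz := zero_set_ae cw z; have nz' := zero_set_ae cw' z'.
have H (X Y : R -> R) : {within `[0, +oo[, continuous X} -> {within `[0, +oo[, continuous Y} ->
  (forall t, 0 <= t -> 0 <= Y t) -> {ae mu, forall r, 0 <= r -> Y r <> 0} ->
  (forall t, 0 <= t -> mu.-integrable `[0, t] (fun r => (radial_drift d m g (X r))%:E) /\
     X t = s0 + \int[mu]_(r in `[0, t]) radial_drift d m g (X r) + m^-1 * W t w) ->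
  (forall t, 0 <= t -> mu.-integrable `[0, t] (fun r => (radial_drift d m g (Y r))%:E) /\
     Y t = s0 + \int[mu]_(r in `[0, t]) radial_drift d m g (Y r) + m^-1 * W t w) ->
  X t <= Y t.
  move=> cX cY Y0 nY XE YE.
  apply: (@integral_eq_comparison _ X Y (radial_drift d m g \o X) (radial_drift d m g \o Y)
     (fun t => m^-1 * W t w) s0 t).
  - by apply: continuous_subspaceW cX; exact: subset_itvl.
  - by apply: continuous_subspaceW cY; exact: subset_itvl.
  - move=> r /andP[r0 _]; have [iX eX] := XE r r0; have [iY eY] := YE r r0.
    exact: And4 iX iY eX eY.
  - apply: filterS nY; first exact: (ae_filter_ringOfSetsType mu).
    move=> r nr /andP[r0 _] YX.
    have Yr : 0 < Y r by rewrite lt_neqAle Y0// andbT eq_sym; apply/eqP; exact: nr.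
    exact: (radial_drift_nincr hd hm hg Yr (ltW YX)).
  - by rewrite t0 lexx.
apply/eqP; rewrite eq_le; apply/andP; split.
- exact: (H (S ^~ w) (S' ^~ w) cw cw' w0' nz' E E').
- exact: (H (S' ^~ w) (S ^~ w) cw' cw w0 nz E' E).
Qed.

End uniqueness.

(* On a time interval [0, t] the solution is a pointwise limit of Euler chains,
   each of which only depends on the path of W up to time t. *)
Lemma ode_solution_adapted {dT : measure_display} {T : measurableType dT} {R : realType}
    (P : probability T R) (F : R -> set (set T)) (W : R -> T -> R)
    (b : R -> R) (c x0 L t : R) (N : set T) (X : T -> R -> R) :
  wiener P F W -> 0 < L -> (forall y z, `|b y - b z| <= L * `|y - z|) ->
  0 < t -> F t N ->
  (forall w, ~ N w -> W 0 w = 0 /\ ode_solution b c x0 (W ^~ w) t (X w)) ->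
  measurable_fun [set: g_sigma_algebraType (F t)]
    (fun w : g_sigma_algebraType (F t) => if w \in N then x0 else X w t).
Proof.
move=> hW L0 bL t0 FN sol.
have sF := wiener_sigma_algebra hW (ltW t0).
have mb := lipschitz_measurable_fun L0 bL.
pose h j : R := t / j.+1%:R.
have h0 j : 0 < h j by rewrite divr_gt0// ltr0n.
have hj j : h j * j.+1%:R = t by rewrite divfK// pnatr_eq0.
pose Z j w := chain setT b c (h j) x0 (W ^~ w) j.+1.
apply: (@measurable_fun_cvg _ _ _ _ (fun j (w : g_sigma_algebraType (F t)) => if w \in N then x0 else Z j w)).
  move=> j; apply: measurable_fun_ifT.
  - apply: (measurable_fun_bool true); rewrite setTI.
    rewrite (_ : _ @^-1` _ = N); first by rewrite /measurable/= sigma_algebra_id.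
    by apply/seteqP; split => w /=; [move/set_mem|move/mem_set].
  - exact: measurable_cst.
  - apply/(sub_measurable_funP _ sF) => B mB; rewrite -{1}(hj j).
    exact: (chain_adapted hW c x0 measurableT mb (h0 j)).
move=> w _; have [Nw|nN] := pselect (N w).
  by under eq_fun do rewrite mem_set//; rewrite mem_set//; exact: cvg_cst.
under eq_fun do rewrite memNset//; rewrite memNset//.
have [W0 Xs] := sol w nN.
apply/cvgrPdist_lt => e e0.
have [del del0 H] := chain_cvg L0 bL W0 Xs e0.
have [n0 hn0] := mesh_lt t del0.
exists n0 => // j /= n0j.
have -> : X w t = X w (h j * j.+1%:R) by rewrite hj.
rewrite distrC; apply: (H (h j) j.+1) => //; last by rewrite hj.
by rewrite h0 hn0.
Qed.

Section existence.
Context {R : realType} (d : nat) (m g : R).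
Hypotheses (hd : (2 <= d)%N) (hm : 0 < m) (hg : 0 <= g).
Notation mu := (@lebesgue_measure R).

Let eps (n : nat) : R := n.+1%:R^-1.
Let eps_gt0 n : 0 < eps n. Proof. by rewrite invr_gt0 ltr0n. Qed.

Lemma cutoff_solution_exists e s0 (w : R -> R) : 0 < e ->
  {within `[0, +oo[, continuous w} ->
  exists x, forall T, ode_solution (cutoff_drift d m g e) m^-1 s0 w T x.
Proof.
move=> e0 cw.
have [L L0 bL] := cutoff_drift_lipschitz hd hm hg e0.
have bK := cutoff_drift_bounded hd hm hg e0.
have A0 := coth_coeff_ge0 hd hm; have B0 := tanh_coeff_ge0 hm hg.
have i0 : 0 <= 1 + e^-1 by rewrite addr_ge0// invr_ge0 ltW.
exact: (ode_solution_exists m^-1 s0 L0 bL (addr_ge0 (mulr_ge0 A0 i0) B0) bK cw).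
Qed.

(** Along a path above e the two truncated drifts coincide, so x also solves the equation truncated
    at e', whose solution is unique. *)
Lemma cutoff_solution_ge_eq e e' s0 w T x x' : 0 < e' -> e' <= e ->
  ode_solution (cutoff_drift d m g e) m^-1 s0 w T x ->
  ode_solution (cutoff_drift d m g e') m^-1 s0 w T x' ->
  (forall t, 0 <= t <= T -> e <= x t) -> forall t, 0 <= t <= T -> x' t = x t.
Proof.
move=> e'0 ee xs xs' xe t tT; symmetry.
have bni r s : r <= s -> cutoff_drift d m g e' s <= cutoff_drift d m g e' r.
  exact: (cutoff_drift_nincr hd hm hg e'0).
have {}xs : ode_solution (cutoff_drift d m g e') m^-1 s0 w T x.
  apply: ode_solution_eq_in xs => // r rT.
  by rewrite (cutoff_driftE _ _ _ (xe r rT)) (cutoff_driftE _ _ _ (le_trans ee (xe r rT))).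
exact: (ode_solution_unique bni xs xs' tT).
Qed.

Section paths.
Context {dT : measure_display} {T : measurableType dT}.
Variables (P : probability T R) (F : R -> set (set T)) (W : R -> T -> R).
Hypothesis hW : wiener P F W.

Lemma cutoff_solution_positive s0 (X : nat -> T -> R -> R) : 0 < s0 ->
  {ae P, forall w, forall n Te, ode_solution (cutoff_drift d m g (eps n)) m^-1 s0 (W ^~ w) Te (X n w)} ->
  {ae P, forall w, forall k : nat, exists n, forall t : R, 0 <= t <= k.+1%:R -> eps n <= X n w t}.
Proof.
move=> s00 Xs; apply/ae_foralln => k; apply: ae_small => e e0.
have A0 := coth_coeff_ge0 hd hm; have B0 := tanh_coeff_ge0 hm hg.
have k0 : 0 < k.+1%:R :> R by rewrite ltr0n.
pose A := (d%:R - 1) / (2 * m ^+ 2); pose B := g / (2 * m ^+ 2).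
pose al := s0 ^+ 2 / 2 - ln s0 + k.+1%:R * (3 * A + B).
pose be := k.+1%:R * A.
have al0 : 0 <= al.
  have := @le_ln1Dx R (s0 - 1); rewrite (addrC 1) subrK => /(_ (ltac:(lra))) ls.
  rewrite addr_ge0//; first by have := sqr_ge0 (s0 - 1); nra.
  by apply: mulr_ge0 => //; rewrite addr_ge0// mulr_ge0.
have be0 : 0 <= be by apply: mulr_ge0.
(* With M = 1 + r the bound becomes (al + be r) / (r^2 / 2), at most 2 (al + be) / r as r >= 1,
   hence at most e. *)
pose r := 1 + 2 * (al + be) / e.
have re : 2 * (al + be) / e = r - 1 by rewrite /r; ring.
have r1 : 1 <= r.
  by rewrite /r lerDl divr_ge0 ?(ltW e0)// mulr_ge0// addr_ge0.
pose M := 1 + r.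
have M1 : 1 < M by rewrite /M; lra.
(* The first entry is the threshold required by the barrier; the second places s0 where the barrier
   has its logarithmic form. *)
pose del := Num.min (expR (- ((M - 1) ^+ 2 / 2))) s0.
have del0 : 0 < del by rewrite lt_min expR_gt0.
have [n /(_ n (leqnn n))] := mesh_lt 1 del0.
rewrite div1r -/(eps n) lt_min => /andP[en es].
have es0 : eps n / 2 <= s0.
  by apply: le_trans (ltW es); rewrite ler_pdivrMr//; have := eps_gt0 n; lra.
have [|D [mD PD HD]] := @cutoff_solution_ge _ _ _ P F W hW d m g hd hm hg s0 (eps n) M k.+1%:R (X n)
  (eps_gt0 n) M1 (ltW en) k0 es0.
  by apply: filterS Xs => w; apply.
exists D; split => //; last first.
  by apply: filterS HD => w Hw nD; exists n; exact: Hw.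
apply: (le_trans PD); rewrite lee_fin -/A -/B.
have -> : M - 1 = r by rewrite /M; ring.
have r0 : 0 < r by exact: lt_le_trans r1.
rewrite ler_pdivrMr; last by rewrite divr_gt0// exprn_gt0.
have -> : s0 ^+ 2 / 2 - ln s0 + k.+1%:R * (A * (M + 2) + B) = al + be * r.
  by rewrite /al /be /M; ring.
have h1 : al <= al * r by rewrite ler_peMr.
have h2 : 2 * (al + be) <= r * e.
  by rewrite -ler_pdivrMr// re; lra.
have h3 : 2 * (al + be) * r <= r * e * r by rewrite ler_pM2r.
rewrite expr2; lra.
Qed.

End paths.

Lemma positive_strong_existence_radial (s0 : R) : 0 < s0 ->
  positive_strong_existence (radial_drift d m g) m^-1 s0.
Proof.
move=> s00 dT T P W sW.
have hW : wiener P (completed_filtration P W) W by exact: wiener_completed sW.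
have [_ _ W0 Wc _] := hW.
pose good w := {within `[0, +oo[, continuous (W ^~ w)}.
have /choice[X0 X0P] : forall wn : T * nat, exists x, good wn.1 -> forall Te,
    ode_solution (cutoff_drift d m g (eps wn.2)) m^-1 s0 (W ^~ wn.1) Te x.
  move=> [w n]; have [gw|ngw] := pselect (good w); last by exists (cst 0).
  by have [x xP] := cutoff_solution_exists s0 (eps_gt0 n) gw; exists x.
pose X n w := X0 (w, n).
have Xs : {ae P, forall w, forall n Te,
    ode_solution (cutoff_drift d m g (eps n)) m^-1 s0 (W ^~ w) Te (X n w)}.
  by apply: filterS Wc => w gw n Te; exact: (X0P (w, n)).
have Xp := cutoff_solution_positive hW s00 Xs.
have [N [mN N0 HN]] : {ae P, forall w, [/\ W 0 w = 0, forall n Te,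
    ode_solution (cutoff_drift d m g (eps n)) m^-1 s0 (W ^~ w) Te (X n w) &
    forall k : nat, exists n, forall t : R, 0 <= t <= k.+1%:R -> eps n <= X n w t]}.
  by apply: filterS3 W0 Xs Xp.
have {}HN w : ~ N w -> [/\ W 0 w = 0, forall n Te,
    ode_solution (cutoff_drift d m g (eps n)) m^-1 s0 (W ^~ w) Te (X n w) &
    forall k : nat, exists n, forall t : R, 0 <= t <= k.+1%:R -> eps n <= X n w t].
  by move=> nN; apply: contrapT => K; apply: nN; exact: HN.
have /choice[idx0 idxP] : forall wk : T * nat, exists n, ~ N wk.1 ->
    forall t : R, 0 <= t <= wk.2.+1%:R -> eps n <= X n wk.1 t.
  move=> [w k]; have [Nw|nN] := pselect (N w); first by exists 0%N.
  by have [_ _ /(_ k)[n nP]] := HN w nN; exists n.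
pose idx w k := idx0 (w, k).
(* A solution must be continuous and nonnegative on every path, hence the constant on the null set
   N, which belongs to each sigma-algebra of the completed filtration. Elsewhere the truncation
   index depends on an integer horizon beyond t. *)
pose S t w := if w \in N then s0 else X (idx w (Num.bound t)) w t.
have SN t w : N w -> S t w = s0 by move=> Nw; rewrite /S mem_set.
have later w k n (t : R) : ~ N w -> (idx w k <= n)%N -> 0 <= t <= k.+1%:R ->
    X n w t = X (idx w k) w t.
  move=> nN kn; have [_ sol _] := HN w nN.
  apply: (@cutoff_solution_ge_eq (eps (idx w k)) (eps n) s0 (W ^~ w)) => //.
    by rewrite lef_pV2 ?posrE ?ltr0n// ler_nat.
  exact: (idxP (w, k) nN).
have SE w k (t : R) : ~ N w -> 0 <= t <= k.+1%:R -> S t w = X (idx w k) w t.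
  move=> nN tk; rewrite /S memNset//; have /andP[t0 _] := tk.
  rewrite -(later w k (maxn (idx w k) (idx w (Num.bound t))))//; last exact: leq_maxl.
  rewrite -(later w (Num.bound t) (maxn (idx w k) (idx w (Num.bound t))))//; first exact: leq_maxr.
  by rewrite t0/= ltW// (lt_le_trans (unstable.ltr_bound _))// ler_nat.
have Sge w k (t : R) : ~ N w -> 0 <= t <= k.+1%:R -> eps (idx w k) <= S t w.
  by move=> nN tk; rewrite (SE w k)//; exact: (idxP (w, k) nN).
have tbound (t : R) : 0 <= t -> 0 <= t <= (Num.bound t).+1%:R.
  by move=> t0; rewrite t0/= ltW// (lt_le_trans (unstable.ltr_bound _))// ler_nat.
have Ssol w k : ~ N w -> ode_solution (radial_drift d m g) m^-1 s0 (W ^~ w) k.+1%:R (S ^~ w).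
  move=> nN; have [_ sol _] := HN w nN.
  apply: ode_solution_eq_in (sol (idx w k) k.+1%:R).
    by move=> t tk; rewrite (SE w k).
  move=> t tk; rewrite cutoff_driftE ?(SE w k)//; exact: (idxP (w, k) nN).
have Spos w (t : R) : ~ N w -> 0 <= t -> 0 < S t w.
  by move=> nN t0; apply: lt_le_trans (Sge w _ t nN (tbound t t0)).
have aeN Q : (forall w, ~ N w -> Q w) -> {ae P, forall w, Q w}.
  move=> H; exists N; split => // w /= nQ; apply: contrapT => nN; apply: nQ; exact: H.
exists S; split; last by apply: aeN => w nN t; exact: Spos.
split => //.
- move=> t t0 B mB.
  have sF := wiener_sigma_algebra hW t0.
  move: B mB; apply/(sub_measurable_funP _ sF).
  have [t_gt0|t_le0] := ltP 0 t; last first.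
    have -> : t = 0 by apply/eqP; rewrite eq_le t_le0.
    rewrite (_ : S 0 = cst s0); first exact: measurable_cst.
    apply/funext => w; have [Nw|nN] := pselect (N w); first exact: SN.
    have [W0w _ _] := HN w nN; have [_ /(_ 0)] := Ssol w 0%N nN.
    rewrite lexx ler01 => /(_ isT)[_ ->].
    by rewrite W0w mulr0 set_itv1 Rintegral_set1 !addr0.
  (* The index [idx] comes from a choice in w and carries no measurability. For fixed w and t,
     however, X n w t is constant in n from that index on, so S t is a pointwise limit of adapted
     variables. *)
  apply: (@measurable_fun_cvg _ _ _ _ (fun n (w : g_sigma_algebraType (completed_filtration P W t)) =>
      if w \in N then s0 else X n w t)).
    move=> n; have [L L0 bL] := cutoff_drift_lipschitz hd hm hg (eps_gt0 n).
    apply: (ode_solution_adapted hW L0 bL t_gt0).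
      by apply: sub_sigma_algebra; right.
    by move=> w nN; have [W0w sol _] := HN w nN; split.
  move=> w _; have [Nw|nN] := pselect (N w).
    by rewrite SN//; under eq_fun do rewrite mem_set//; exact: cvg_cst.
  under eq_fun do rewrite memNset//.
  apply: cvg_near_cst; exists (idx w (Num.bound t)) => // n /= kn.
  by rewrite (later w _ _ _ nN kn (tbound t t0)) (SE w (Num.bound t))//; exact: tbound.
- move=> w; have [Nw|nN] := pselect (N w).
    split; last by move=> t _; rewrite SN// ltW.
    have -> : S ^~ w = cst s0 by apply/funext => t; exact: SN.
    by move=> t; exact: cvg_cst.
  split; last by move=> t t0; apply/ltW/Spos.
  by apply: within_continuous_nonneg => k; have [] := Ssol w k nN.
- apply: aeN => w nN; rewrite (_ : [set t : R | _] = set0) ?measure0//.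
  apply/seteqP; split => // t /= [t0 St]; have := Spos w t nN t0.
  by rewrite St ltxx.
- apply: aeN => w nN t t0; have [_ Se] := Ssol w (Num.bound t) nN.
  exact: (Se t (tbound t t0)).
Qed.

End existence.

(** * Long-time behaviour *)

Section hitting.
Context {dT : measure_display} {T : measurableType dT} {R : realType}.
Implicit Types (S Z : R -> T -> R) (a : R).

Lemma hitting_time_pinftyP S a w :
  hitting_time S a w = +oo%E <-> forall t, 0 <= t -> S t w <> a.
Proof.
split=> [Hoo t t0 St|H].
  have : (hitting_time S a w <= t%:E)%E by apply: ereal_inf_lbound; exists t.
  by rewrite Hoo leye_eq.
rewrite /hitting_time (_ : [set t%:E | t in _] = set0) ?ereal_inf0//.
by apply/seteqP; split => // y [t [t0 /(H t t0)]].
Qed.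

(** Strict inequalities at rational times do not pass to limits. On each compact interval the
    minimum provides a margin 1 / (k + 1), and with this margin rational times suffice by
    continuity. *)
Lemma measurable_forall_gt Z a :
  (forall t, 0 <= t -> measurable_fun setT (Z t)) ->
  (forall w, {within `[0, +oo[, continuous (Z ^~ w)}) ->
  measurable [set w | forall t, 0 <= t -> a < Z t w].
Proof.
move=> mZ cZ.
pose q (p j : nat) : R := p%:R / j.+1%:R.
have q0 p j : 0 <= q p j by rewrite divr_ge0.
rewrite (_ : [set w | _] = \bigcap_(N : nat) \bigcup_(k : nat) \bigcap_(p : nat) \bigcap_(j : nat)
    [set w | q p j <= N%:R -> a + k.+1%:R^-1 <= Z (q p j) w]).
  apply: bigcap_measurable => [|N _]; first by exists 0%N.
  apply: bigcup_measurable => k _.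
  apply: bigcap_measurable => [|p _]; first by exists 0%N.
  apply: bigcap_measurable => [|j _]; first by exists 0%N.
  rewrite (_ : [set w | _] = if q p j <= N%:R then Z (q p j) @^-1` `[a + k.+1%:R^-1, +oo[ else setT).
    case: ifP => // _; rewrite -[X in measurable X]setTI.
    by apply: mZ => //; exact: measurable_itv.
  apply/seteqP; split => w /=; case: ifP => //= _; rewrite in_itv/= andbT //.
  by apply.
apply/seteqP; split => w /=.
  move=> aZ N _.
  have [|c] := @EVT_min R (Z ^~ w) 0 N%:R (ler0n _ _).
    by apply: continuous_subspaceW (cZ w); exact: subset_itvl.
  rewrite in_itv/= => /andP[c0 cN] cmin.
  have ac : 0 < Z c w - a by rewrite subr_gt0 aZ.
  have [k /(_ k (leqnn k))] := mesh_lt 1 ac.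
  rewrite div1r => kac; exists k => // p _ j _ /= qN.
  have := cmin (q p j); rewrite in_itv/= q0 qN => /(_ isT); apply: le_trans.
  by rewrite -lerBrDl ltW.
move=> H t t0.
have tN := unstable.ltr_bound t; set N := Num.bound t in tN.
have [k _ Hk] := H N I.
have k0 : 0 < k.+1%:R^-1 :> R by rewrite invr_gt0 ltr0n.
have [|del del0 Hd] := (within_continuousP _ _).1 (cZ w) t _ _ k0.
  by rewrite /= in_itv/= t0.
have [j /(_ j (leqnn j))] := mesh_lt 1 del0; rewrite div1r => jdel.
have j0 : 0 < j.+1%:R :> R by rewrite ltr0n.
pose p := Num.truncn (t * j.+1%:R).
have /andP[pt tp] : p%:R <= t * j.+1%:R < p.+1%:R by apply: truncn_itv; rewrite mulr_ge0.
have qt : q p j <= t by rewrite ler_pdivrMr.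
have tq : t - q p j < j.+1%:R^-1.
  rewrite ltrBlDr /q -[X in X + _]mul1r -mulrDl ltr_pdivlMr//.
  by rewrite addrC natr1.
have := Hk p I j I => /= /(_ (le_trans qt (ltW tN))) aq.
have := Hd (q p j); rewrite /= in_itv/= q0 => /(_ isT).
rewrite ger0_norm ?subr_ge0// => /(_ (lt_trans tq jdel)).
rewrite ltr_norml => /andP[+ _].
move: (k.+1%:R^-1) aq => e /=; lra.
Qed.

Lemma within_nonneg_IVT (x : R -> R) a s t : {within `[0, +oo[, continuous x} ->
  0 <= s -> 0 <= t -> x s <= a <= x t -> exists2 r, 0 <= r & x r = a.
Proof.
move=> cx s0 t0 /andP[sa at_].
have H u v : 0 <= u -> u <= v -> Num.min (x u) (x v) <= a <= Num.max (x u) (x v) ->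
    exists2 r, 0 <= r & x r = a.
  move=> u0 uv huv.
  have [|r] := IVT uv _ huv.
    apply: continuous_subspaceW cx => z; rewrite /= !in_itv/= andbT => /andP[uz _].
    exact: le_trans uz.
  by rewrite in_itv/= => /andP[ur _] xr; exists r => //; exact: le_trans ur.
have [st|ts] := leP s t.
  by apply: (H s t) => //; rewrite ge_min sa le_max at_ orbT.
by apply: (H t s) => //; [exact: ltW|rewrite ge_min sa orbT le_max at_].
Qed.

Lemma hitting_time_pinfty_gt S a w : {within `[0, +oo[, continuous (S ^~ w)} ->
  a < S 0 w -> hitting_time S a w = +oo%E <-> forall t, 0 <= t -> a < S t w.
Proof.
move=> cS a0; rewrite hitting_time_pinftyP; split=> [H t t0|H t t0 St].
  rewrite ltNge; apply/negP => Sta.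
  have [|r r0 Sr] := within_nonneg_IVT cS t0 (lexx 0) (a := a).
    by rewrite Sta ltW.
  exact: H Sr.
by have := H t t0; rewrite St ltxx.
Qed.

(** By the intermediate value theorem a path that avoids a stays strictly on one side of it; the
    lower side is the upper one for - S. *)
Lemma hitting_time_pinfty_measurable S a :
  (forall t, 0 <= t -> measurable_fun setT (S t)) ->
  (forall w, {within `[0, +oo[, continuous (S ^~ w)}) ->
  measurable [set w | hitting_time S a w = +oo%E].
Proof.
move=> mS cS.
rewrite (_ : [set w | _] = [set w | forall t, 0 <= t -> a < S t w] `|`
    [set w | forall t, 0 <= t -> - a < - S t w]).
  apply: measurableU; first exact: measurable_forall_gt.
  apply: (@measurable_forall_gt (fun t w => - S t w)).
    by move=> t t0; apply: measurable_funN; exact: mS.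
  by move=> w t; apply: cvgN; exact: cS.
apply/seteqP; split => w /=; last first.
  case=> H; apply/hitting_time_pinftyP => t t0 St; have := H t t0.
    by rewrite St ltxx.
  by rewrite St ltxx.
move/hitting_time_pinftyP => H.
have [a0|a0] := ltP a (S 0 w); [left|right] => t t0; [|rewrite ltrN2]; rewrite ltNge; apply/negP => h.
  have [|r r0] := within_nonneg_IVT (cS w) t0 (lexx 0) (a := a); first by rewrite h ltW.
  exact: H.
have [|r r0] := within_nonneg_IVT (cS w) (lexx 0) t0 (a := a); first by rewrite a0 h.
exact: H.
Qed.

End hitting.

Section long_time.
Context {R : realType} (d : nat) (m g : R).
Hypotheses (hd : (2 <= d)%N) (hm : 0 < m) (hg : 0 <= g).
Notation mu := (@lebesgue_measure R).
Notation b := (radial_drift d m g).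

Section solution.
Context {dT : measure_display} {T : measurableType dT}.
Variables (P : probability T R) (F : R -> set (set T)) (W S : R -> T -> R) (s0 : R).
Hypothesis sol : sde_solution P F b m^-1 W s0 S.

Lemma sde_solution_start : {ae P, forall w, S 0 w = s0}.
Proof.
have [[_ _ W0 _ _] _ _ _ SE] := sol.
apply: filterS2 W0 SE => w W0 /(_ 0 (lexx 0))[_ ->].
by rewrite W0 mulr0 set_itv1 Rintegral_set1 !addr0.
Qed.

Lemma sde_solution_linear_ge : {ae P, forall w, forall t, 0 <= t ->
  s0 + ((d%:R - 1) / (2 * m ^+ 2) - g / (2 * m ^+ 2)) * t + m^-1 * W t w <= S t w}.
Proof.
have [_ _ cS Sz SE] := sol.
set kap := _ - g / _.
apply: filterS2 Sz SE => w z E t t0.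
have [cw w0] := cS w; have [ib ->] := E t t0.
have ik := integrable_cst0 kap t.
rewrite lerD2r lerD2l -(Rintegral_cst0 kap t0) -subr_le0.
have := @Rintegral_le0_ae R `[0, t] (fun r => kap - b (S r w)) _ (integrableB _ ik ib).
rewrite (RintegralB _ ik ib)//; apply => //.
apply: filterS (zero_set_ae cw z); first exact: (ae_filter_ringOfSetsType mu).
move=> r nz; rewrite /= in_itv/= => /andP[r0 _].
rewrite subr_le0; apply: radial_drift_ge => //.
by rewrite lt_neqAle w0// andbT eq_sym; apply/eqP; exact: nz.
Qed.

End solution.

Lemma transient_radial : g < d%:R - 1 -> transient b m^-1.
Proof.
move=> gd a s0 a0 as0 dT T P F W S sol.
have [hW aS cS Sz SE] := sol.
have S0 := sde_solution_start sol.
have Sge := sde_solution_linear_ge sol.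
set kap := _ - _ in Sge.
have m2 : 0 < 2 * m ^+ 2 by rewrite mulr_gt0// exprn_gt0.
have kap0 : 0 < kap by rewrite /kap -mulrBl divr_gt0// subr_gt0.
have c0 : 0 < m^-1 by rewrite invr_gt0.
split; last first.
  (* Half of the drift makes W plus drift bounded below, the other half drives S to infinity. *)
  have kap20 : 0 < kap / 2 by rewrite divr_gt0.
  apply: filterS2 Sge (brownian_drift_bounded_below hW c0 kap20) => w H [C HC] _.
  apply/cvgryPge => A; exists (Num.max 0 ((A + C - s0) / (kap / 2))); split; first exact: num_real.
  move=> t; rewrite gt_max => /andP[t0]; rewrite ltr_pdivrMr// => tA.
  have := H t (ltW t0); have := HC t (ltW t0).
  have : kap = 2 * (kap / 2) by rewrite mulrC divfK.
  move: (kap / 2) tA => k tA ->; nra.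
(* Half of the gap, so that S >= s0 - eta still lies strictly above a. *)
have eta0 : 0 < (s0 - a) / 2 by rewrite divr_gt0// subr_gt0.
have [D [mD PD HD]] := brownian_drift_ge hW c0 kap0 eta0.
set E := [set w | _].
have mS t : 0 <= t -> measurable_fun setT (S t).
  by move=> t0 _ B mB; rewrite setTI; apply: (wiener_sub_measurable hW t0); exact: aS.
have mE : measurable E by apply: hitting_time_pinfty_measurable => // w; have [] := cS w.
have PD1 : (P D < 1)%E.
  apply: le_lt_trans PD _; rewrite lte_fin expR_lt1 oppr_lt0.
  by rewrite mulr_gt0// divr_gt0 ?exprn_gt0// mulr_gt0.
have [N [mN N0 HN]] : {ae P, forall w, ~ D w -> E w}.
  apply: filterS3 S0 Sge HD => w S0w Sw Dw nD.
  rewrite /E /= (hitting_time_pinfty_gt (cS w).1) ?S0w// => t t0.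
  have := Sw t t0; have := Dw nD t t0.
  have h : s0 - a = 2 * ((s0 - a) / 2) by rewrite mulrC divfK.
  move: (_ / 2) h eta0 => e h e0; lra.
rewrite lt_neqAle measure_ge0 andbT; apply/eqP => PE.
have : (P setT <= P (D `|` (N `|` E)))%E.
  apply: le_measure; rewrite ?inE//; first by do 2 apply: measurableU => //.
  move=> w _; have [Dw|nD] := pselect (D w); first by left.
  have [Nw|nN] := pselect (N w); first by right; left.
  right; right; apply: contrapT => nE; apply: nN; apply: HN => /= h.
  by apply: nE; exact: h.
rewrite probability_setT leNgt => /negP; apply.
apply: le_lt_trans (measureU2 _ mD (measurableU _ _ mN mE)) _.
have PNE : (P (N `|` E) <= 0)%E.
  apply: le_trans (measureU2 _ mN mE) _; rewrite -[leRHS]adde0.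
  by apply: leeD; rewrite le_eqVlt; apply/orP; left; apply/eqP; [exact: N0|exact: esym PE].
apply: le_lt_trans PD1; rewrite -[leRHS]adde0; exact: leeD.
Qed.

Lemma recurrent_radial : d%:R - 1 <= g -> recurrent b m^-1.
Proof.
move=> dg a s0 a0 as0 dT T P F W S sol.
have [hW aS cS Sz SE] := sol.
have [_ _ _ Wc _] := hW.
have S0 := sde_solution_start sol.
have a20 : 0 < a / 2 by rewrite divr_gt0.
pose bc := cutoff_drift d m g (a / 2).
(* The truncated equation must hold for almost all w, whereas S solves it only
   on the paths which do not reach a; elsewhere S is replaced. *)
have /choice[x Hx] : forall w, exists x : R -> R, {within `[0, +oo[, continuous (W ^~ w)} ->
    (forall Te, ode_solution bc m^-1 s0 (W ^~ w) Te x) /\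
    ((forall Te, ode_solution bc m^-1 s0 (W ^~ w) Te (S ^~ w)) -> x = S ^~ w).
  move=> w; have [Sw|nSw] := pselect (forall Te, ode_solution bc m^-1 s0 (W ^~ w) Te (S ^~ w)).
    by exists (S ^~ w).
  have [cw|ncw] := pselect {within `[0, +oo[, continuous (W ^~ w)}; last by exists (cst 0).
  have [x xP] := cutoff_solution_exists hd hm hg s0 a20 cw.
  by exists x => _; split; [exact: xP|move=> Sw; case: (nSw Sw)].
have xs : {ae P, forall w, forall Te, ode_solution bc m^-1 s0 (W ^~ w) Te (x w)}.
  by apply: filterS Wc => w cw; exact: (Hx w cw).1.
have nst := cutoff_stay_null hW hd hm hg dg a0 (ltW (lt_trans a0 as0)) xs.
apply: filterS2 (filterI nst Wc) (filterI S0 SE) => w [ns cw] [S0w E].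
rewrite ltey; apply/eqP => Hoo; apply: ns.
have cSw := (cS w).1.
have aSw : forall t, 0 <= t -> a < S t w.
  by apply/(hitting_time_pinfty_gt cSw) => //; rewrite S0w.
have a2S t : 0 <= t -> a / 2 <= S t w by move=> /aSw; lra.
have -> : x w = S ^~ w; last by move=> t /aSw/ltW.
apply: (Hx w cw).2 => Te.
have sb : ode_solution b m^-1 s0 (W ^~ w) Te (S ^~ w).
  split; first by apply: continuous_subspaceW cSw; exact: subset_itvl.
  by move=> t /andP[t0 _]; have [ib Et] := E t t0; split; [exact: ib|exact: Et].
have bb t : 0 <= t <= Te -> b (S t w) = bc (S t w).
  by move=> /andP[t0 _]; rewrite /bc cutoff_driftE// a2S.
exact: (ode_solution_eq_in (fun t _ => erefl) bb sb).
Qed.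

End long_time.

Theorem theorem4p1 (R : realType) (d : nat) (m g : R)
    (hd : (2 <= d)%N) (hm : 0 < m) (hg : 0 <= g) :
  [/\ forall s0 : R, 0 < s0 ->
        positive_strong_existence (radial_drift d m g) m^-1 s0 /\
        pathwise_unique (radial_drift d m g) m^-1 s0,
      g < d%:R - 1 -> transient (radial_drift d m g) m^-1 &
      d%:R - 1 <= g -> recurrent (radial_drift d m g) m^-1 ].
Proof.
split; [|exact: transient_radial|exact: recurrent_radial].
move=> s0 s00; split; first exact: positive_strong_existence_radial.
exact: pathwise_unique_radial.
Qed.
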